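(* Let $N\ge1$ be an integer and $\alpha>0$. Let $0<\gamma<N$, $\gamma<\frac2\alpha$, $q\in(1,\infty]$ satisfy $$\frac1q+\frac\gamma N<1,\qquad \frac{N\alpha}{2q}+\frac{\alpha\gamma}{2}<1 .$$ Let $\varphi\in L^q_\gamma(\mathbb R^N)$. Then the existence time $T_{\max}(\lambda\varphi)$ of the maximal solution in $L^q_\gamma(\mathbb R^N)$ of $\partial_tu=\Delta u+|u|^\alpha u$ on $\mathbb R^N$ with $u(0)=\lambda\varphi$ satisfies $$T_{\max}(\lambda\varphi)\ \ge\ \frac{C}{\left(\lambda\|\varphi\|_{L^q_\gamma}\right)^{\left(\frac1\alpha-\frac N{2q}-\frac\gamma2\right)^{-1}}}\qquad\text{for all }\lambda>0,$$ where $C=C(\alpha,q,\gamma,N)>0$ is a constant.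
   Context: $L^q_\gamma(\mathbb R^N)$ is the space of measurable $f:\mathbb R^N\to\mathbb R$ with $|\cdot|^\gamma f\in L^q(\mathbb R^N)$, normed by $\|f\|_{L^q_\gamma}=\||\cdot|^\gamma f\|_{L^q(\mathbb R^N)}$; $1/q=0$ if $q=\infty$. Solutions are solutions of the integral equation $u(t)=e^{t\Delta}u_0+\int_0^te^{(t-\sigma)\Delta}[|u(\sigma)|^\alpha u(\sigma)]\,d\sigma$ with $u_0=\lambda\varphi$, where $e^{t\Delta}$ is the heat semigroup on $\mathbb R^N$. Under the stated conditions the equation is locally well-posed in $L^q_\gamma(\mathbb R^N)$: with $r=(\alpha+1)q$ and $\nu=\gamma/(\alpha+1)$, there is $T>0$ and a solution $u\in C([0,T];L^q_\gamma(\mathbb R^N))$, unique among those for which $t^{\frac N2(\frac1q-\frac1r)+\frac{\nu\alpha}2}\|u(t)\|_{L^r_\nu}$ is bounded on $(0,T]$ (if $q=\infty$, then $r=\infty$, $[0,T]$ is replaced by $(0,T]$ and $u$ satisfies $\lim_{t\to0}\|u(t)-e^{t\Delta}u_0\|_{L^\infty_\gamma}=0$). This solution extends to a maximal interval $[0,T_{\max}(u_0))$, and either $T_{\max}(u_0)=\infty$ or $\|u(t)\|_{L^q_\gamma}\to\infty$ as $t\to T_{\max}(u_0)$. *)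

(* Defs.v *)
From HB Require Import structures.
From mathcomp Require Import all_boot all_order all_algebra.
From mathcomp Require Import all_classical all_reals all_analysis.

Set Implicit Arguments.
Unset Strict Implicit.
Unset Printing Implicit Defensive.

Import Order.TTheory GRing.Theory Num.Theory.
Import numFieldNormedType.Exports.

Local Open Scope classical_set_scope.
Local Open Scope ring_scope.

Definition Rn (R : realType) (N : nat) : Type := N.-tuple (measurableTypeR R).

HB.instance Definition _ (R : realType) (N : nat) := Measurable.on (Rn R N).

Section lebesgue_Rn.
Context {R : realType}.
Local Open Scope ereal_scope.

Definition cons_Rn N (p : measurableTypeR R * Rn R N) : Rn R N.+1 :=
  [tuple of p.1 :: p.2].

Lemma measurable_cons_Rn N : measurable_fun [set: _] (@cons_Rn N).
Proof. exact: measurable_cons. Qed.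

Section step.
Context (N : nat) (m : {sigma_finite_measure set (Rn R N) -> \bar R}).

Definition lebesgue_Rn_step : set (Rn R N.+1) -> \bar R :=
  pushforward (@lebesgue_measure R \x m) (@cons_Rn N).

Let step_measure : {measure set (Rn R N.+1) -> \bar R} :=
  measure_function_pushforward__canonical__measure_function_Measure
    (@lebesgue_measure R \x m) (@measurable_cons_Rn N).

HB.instance Definition _ := isMeasure.Build _ _ _ lebesgue_Rn_step
  (measure0 step_measure) (measure_ge0 step_measure)
  (@measure_semi_sigma_additive _ _ _ step_measure).

Let lebesgue_Rn_step_sigma_finite :
  sigma_finite [set: Rn R N.+1] lebesgue_Rn_step.
Proof.
have /sigma_finiteP[F [TF ndF Foo]] := sigma_finiteT (@lebesgue_measure R).
have /sigma_finiteP[G [TG ndG Goo]] := sigma_finiteT m.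
pose g (x : Rn R N.+1) : measurableTypeR R * Rn R N :=
  (thead x, [tuple of behead x]).
have mg : measurable_fun [set: Rn R N.+1] g.
  apply/measurable_fun_pair => /=; first exact: measurable_tnth.
  exact: measurable_behead.
have gK : cancel (@cons_Rn N) g.
  by move=> [a x]; rewrite /g theadE; congr (_, _); exact/val_inj.
exists (fun n => g @^-1` (F n `*` G n)).
  apply/esym; rewrite -subTset => x _.
  have : [set: measurableTypeR R] (g x).1 by [].
  have : [set: Rn R N] (g x).2 by [].
  rewrite TF TG => -[k _ Gk] [n _ Fn]; exists (maxn n k) => //; split.
    by move: Fn; exact/subsetPset/ndF/leq_maxl.
  by move: Gk; exact/subsetPset/ndG/leq_maxr.
move=> k; have [mFk Fkoo] := Foo k; have [mGk Gkoo] := Goo k; split.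
  by rewrite -[X in measurable X]setTI; apply: mg => //; exact: measurableX.
rewrite /lebesgue_Rn_step /pushforward -comp_preimage.
rewrite (_ : g \o _ = id) ?preimage_id; last by apply/funext => p; exact: gK.
by rewrite product_measure1E// lte_mul_pinfty// ge0_fin_numE.
Qed.

HB.instance Definition _ :=
  Measure_isSigmaFinite.Build _ _ _ lebesgue_Rn_step
    lebesgue_Rn_step_sigma_finite.
End step.

(* The Lebesgue measure on R^N, by iterated products, on the Borel sets of R^N
   (i.e., the product sigma-algebra on tuples). *)
Fixpoint lebesgue_Rn N : {sigma_finite_measure set (Rn R N) -> \bar R} :=
  if N is N'.+1 return {sigma_finite_measure set (Rn R N) -> \bar R}
  then lebesgue_Rn_step (lebesgue_Rn N')
  else dirac ([tuple] : Rn R 0).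

End lebesgue_Rn.

Section weighted_spaces.
Context {R : realType} {N : nat}.
Implicit Types (x y : Rn R N) (q : \bar R) (gamma : R).

(* 1/q as a real number, with 1/q = 0 for q = +oo. *)
Definition recip q : R := fine (q^-1)%E.

Definition sqdist x y : R := \sum_(i < N) ((tnth x i : R) - tnth y i) ^+ 2.

Definition enorm x : R := Num.sqrt (\sum_(i < N) (tnth x i : R) ^+ 2).

(* Extended real-valued functions are allowed because [heat] below is one. *)
Definition wnorm q gamma (f : Rn R N -> \bar R) : \bar R :=
  Lnorm (lebesgue_Rn N) q (fun x => (enorm x `^ gamma)%:E * f x)%E.

Definition Lqw q gamma : set (Rn R N -> R) :=
  [set f : Rn R N -> R | measurable_fun [set: Rn R N] f /\
                         (wnorm q gamma (EFin \o f) < +oo)%E].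

Definition heat_kernel (t : R) x y : R :=
  (4 * pi * t) `^ (- (N%:R / 2)) * expR (- (sqdist x y / (4 * t))).

(* e^{t Delta} f, for t > 0. *)
Definition heat (t : R) (f : Rn R N -> R) x : \bar R :=
  (\int[lebesgue_Rn N]_y (heat_kernel t x y * f y)%:E)%E.

End weighted_spaces.

Section nonlinear_heat_equation.
Context {R : realType} {N : nat} (alpha gamma : R) (q : \bar R).
Definition r_exp : \bar R := ((alpha + 1)%:E * q)%E.

Definition nu_exp : R := gamma / (alpha + 1).

Definition beta_exp : R :=
  N%:R / 2 * (recip q - recip r_exp) + nu_exp * alpha / 2.

Definition power_nonlinearity (v : R) : R := `|v| `^ alpha * v.

Definition duhamel (u : R -> Rn R N -> R) (t : R) (x : Rn R N) : \bar R :=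
  (\int[@lebesgue_measure R]_(s in `]0%R, t[)
     heat (t - s)%R (power_nonlinearity \o u s) x)%E.

Definition time_domain (T : R) : set R :=
  if q == +oo%E then `]0, T]%classic else `[0, T]%classic.

(* u is the solution on [0, T] with initial value u0 in the class in which the
   equation is well-posed. The curve t |-> u(t) is given by a jointly measurable
   representative. The integral equation is an equality in \bar R whose
   left-hand side is finite: since +oo - oo = -oo in \bar R, and the integral of
   f is the difference of those of its positive and negative parts, it forces
   both terms of the right-hand side to be finite and the Duhamel integral to be
   absolutely convergent. *)
Record mild_solution (T : R) (u0 : Rn R N -> R) (u : R -> Rn R N -> R) : Prop := MildSolution {
  mild_measurable :
    measurable_fun (`]0, T]%classic `*` [set: Rn R N])
      (fun p : measurableTypeR R * Rn R N => u p.1 p.2);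
  mild_Lqw : forall t, time_domain T t -> Lqw q gamma (u t);
  mild_continuous : forall t0, time_domain T t0 ->
    wnorm q gamma (fun x => (u t x - u t0 x)%:E)
      @[t --> within (time_domain T) (nbhs t0)] --> 0%E;
  mild_initial :
    if q == +oo%E then
      wnorm q gamma (fun x => (u t x)%:E - heat t u0 x)%E
        @[t --> 0^'+] --> 0%E
    else {ae lebesgue_Rn N, forall x, u 0 x = u0 x};
  mild_equation : forall t, 0 < t <= T ->
    {ae lebesgue_Rn N, forall x,
      ((u t x)%:E = heat t u0 x + duhamel u t x)%E};
  mild_bounded : exists M : R, forall t, 0 < t <= T ->
    ((t `^ beta_exp)%:E * wnorm r_exp nu_exp (EFin \o u t) <= M%:E)%E
}.

(* Solutions in the above class with the same initial value agree on their
   common interval, so this is the existence time of the maximal solution. *)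
Definition Tmax (u0 : Rn R N -> R) : \bar R :=
  ereal_sup [set T%:E | T in [set T : R |
    0 < T /\ exists u, mild_solution T u0 u]].

End nonlinear_heat_equation.

(* Main.v *)
Require Import Defs.
From HB Require Import structures.
From mathcomp Require Import all_boot all_order all_algebra.
From mathcomp Require Import all_classical all_reals all_analysis.
From mathcomp Require Import measurable_realfun ess_sup_inf.
From mathcomp Require Import lebesgue_integral_fubini normal_distribution.
From mathcomp Require Import ring lra.

Import Order.TTheory GRing.Theory Num.Theory.
Import numFieldNormedType.Exports.

Local Open Scope classical_set_scope.
Local Open Scope ring_scope.

Set Implicit Arguments.
Unset Strict Implicit.
Unset Printing Implicit Defensive.

(* Let h(t) = e^(t Delta)|u0| and b = N/(2q) + gamma/2. Hoelder's inequality with the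
   weight |y|^(-gamma) gives h(t) <= C t^(-b) ||u0|| pointwise and
   ||h(t)|| <= C ||u0|| in L^q_gamma. If |u| <= 2 h, then |u|^alpha |u| is at most
   c (||u0||^alpha) s^(-alpha b) h(s), and since e^((t-s) Delta) h(s) = h(t) the Duhamel
   term is at most c' ||u0||^alpha t^(1 - alpha b) h(t), where alpha b < 1. So the
   Picard map preserves {|u| <= 2 h} on (0, T] and contracts it in the norm
   sup |u| / h as soon as ||u0||^alpha T^(1 - alpha b) is small, which is the claimed
   lower bound; domination by h yields all the properties of the solution class,
   save for continuity at time 0 when q < oo, which follows from the strong
   continuity of the heat semigroup in L^q_gamma. *)

(** * Gaussian kernels *)

(** The hypothesis 1/q + gamma/N < 1 says that gamma q' < N, so that |y|^(-gamma q') is locally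
    integrable; alpha b < 1 makes s^(-alpha b) integrable at 0. Working in the pointwise order,
    rather than with a contraction in L^r_nu, has the advantage that a bound by a multiple of h
    passes through the heat semigroup without loss: singular integrals in space are estimated once,
    for h, and only a scalar integral in time remains. The bound in L^r_nu then comes from
    interpolation between the pointwise bound and the one in L^q_gamma. Differences in time obey the
    same order, with a later profile h(2T) in place of h(t). This fails at time 0, where the
    estimate of kernel differences degenerates like (t - s)/s. There the p-th power of e^(t Delta) f
    - f is split into a factor with Gaussian decay and a mean oscillation; that the latter vanishes
    is proved on half-spaces and carried to Borel sets by a sigma-algebra argument, in place of the
    density of continuous functions. As [Tmax] is a supremum, one solution on [0, T] suffices, and
    solving the smallness condition for T as an equality produces the exponent of the theorem. *)

Section product_integrals.
Context {R : realType}.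
Local Notation leb := (@lebesgue_measure R).

Lemma integral_Rn_cons N (f : Rn R N.+1 -> \bar R) :
  measurable_fun [set: Rn R N.+1] f -> (forall x, 0 <= f x)%E ->
  (\int[lebesgue_Rn N.+1]_y f y =
   \int[leb]_a \int[lebesgue_Rn N]_y f (cons_Rn (a, y)))%E.
Proof.
move=> mf f0 /=; rewrite /lebesgue_Rn_step.
rewrite (@ge0_integral_pushforward _ _ _ _ _ _ (@measurable_cons_Rn R N) _ [set: _])//.
rewrite preimage_setT (@fubini_tonelli1 _ _ _ _ _ _ (lebesgue_Rn N) (f \o @cons_Rn R N))//.
  by apply: (measurableT_comp mf); exact: measurable_cons_Rn.
by move=> x; exact: f0.
Qed.

Lemma integral_Rn_prod N (f : 'I_N -> R -> R) (c : 'I_N -> R) :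
  (forall i, measurable_fun [set: R] (f i)) -> (forall i x, 0 <= f i x) ->
  (forall i, (\int[leb]_x (f i x)%:E = (c i)%:E)%E) ->
  (\int[lebesgue_Rn N]_y (\prod_(i < N) f i (tnth y i))%:E =
   (\prod_(i < N) c i)%:E)%E.
Proof.
elim: N f c => [|N IH] f c mf f0 fc.
  rewrite big_ord0 /= integral_dirac ?diracT ?mul1e ?big_ord0//.
  under eq_fun do rewrite big_ord0.
  exact: measurable_cst.
have mP M (g : 'I_M -> R -> R) : (forall i, measurable_fun [set: R] (g i)) ->
    measurable_fun [set: Rn R M] (fun y : Rn R M => (\prod_(i < M) g i (tnth y i))%:E).
  move=> mg; apply/measurable_EFinP.
  apply: measurable_prod => i _.
  by apply: (measurableT_comp (mg i)); exact: measurable_tnth.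
rewrite integral_Rn_cons//; [|exact: mP|by move=> x; rewrite lee_fin prodr_ge0].
under eq_integral => a _.
  under eq_integral => y _.
    rewrite big_ord_recl tnth0.
    under eq_bigr do rewrite tnthS.
    rewrite EFinM.
    over.
  rewrite /= ge0_integralZl_EFin//; last 2 first.
  - by move=> y _; rewrite lee_fin prodr_ge0.
  - by apply: (mP N (fun i => f (lift ord0 i))) => i; exact: mf.
  rewrite (IH (fun i => f (lift ord0 i)) (fun i => c (lift ord0 i)))//.
  rewrite -EFinM mulrC EFinM.
  over.
rewrite ge0_integralZl_EFin//; last 3 first.
- by move=> x _; rewrite lee_fin f0.
- by have /measurable_EFinP := mf ord0.
(* The signs of the [c i] are read off the induction hypothesis: their product is the integral of a
   nonnegative function. *)
- rewrite -lee_fin -(@IH (fun i => f (lift ord0 i)))//.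
  by apply: integral_ge0 => x _; rewrite lee_fin prodr_ge0.
by rewrite fc big_ord_recl mulrC EFinM.
Qed.

End product_integrals.

Section gauss1.
Context {R : realType}.
Local Notation leb := (@lebesgue_measure R).
Implicit Types s t x y z : R.

(** The heat kernel of the line, that is, the normal density of variance [2 * t]. [heat_kernel] is
    the product of these over the coordinates, so Gaussian integrals on R^N reduce to dimension
    one. *)
Definition gauss1 t x y : R :=
  (4 * pi * t) `^ (- (1 / 2)) * expR (- ((x - y) ^+ 2 / (4 * t))).

Lemma gauss1_ge0 t x y : 0 <= gauss1 t x y.
Proof. by rewrite mulr_ge0// ?powR_ge0// expR_ge0. Qed.

Lemma gauss1C t x y : gauss1 t x y = gauss1 t y x.
Proof. by rewrite /gauss1 -(sqrrN (x - y)) opprB. Qed.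

Lemma measurable_gauss1 t x : measurable_fun [set: R] (gauss1 t x).
Proof.
apply: measurable_funM => //; apply: measurableT_comp => //.
apply: measurableT_comp => //; apply: measurable_funM => //.
by apply: measurable_funX; exact: measurable_funB.
Qed.

Lemma gauss1E t x y : 0 < t -> gauss1 t x y = normal_pdf x (Num.sqrt (2 * t)) y.
Proof.
move=> t0; rewrite normal_pdfE ?gt_eqF ?sqrtr_gt0 ?mulr_gt0//.
rewrite /normal_peak /normal_fun sqr_sqrtr ?mulr_ge0 ?ltW// gauss1C /gauss1.
congr (_ * expR _).
  rewrite powRN; congr (_^-1); rewrite mul1r powR12_sqrt; last first.
    by rewrite !mulr_ge0// ?pi_ge0// ltW.
  by congr Num.sqrt; ring.
by rewrite mulNr; congr (- (_ / _)); ring.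
Qed.

Lemma integral_gauss1 t x : 0 < t -> (\int[leb]_y (gauss1 t x y)%:E = 1)%E.
Proof.
move=> t0; under eq_integral do rewrite gauss1E//.
exact: integral_normal_pdf.
Qed.

(** Completing the square in [z]: the second factor on the right is again a Gaussian in [z], of mass
    1, centred at a weighted mean of [x] and [y]. Integrating in [z] leaves the semigroup law. *)
Lemma gauss1M s t x y z : 0 < s -> 0 < t ->
  gauss1 s x z * gauss1 t z y =
  gauss1 (s + t) x y * gauss1 (s * t / (s + t)) ((t * x + s * y) / (s + t)) z.
Proof.
move=> s0 t0; have st0 : 0 < s + t by rewrite addr_gt0.
rewrite /gauss1 mulrACA [RHS]mulrACA -!expRD -!powRM; last 4 first.
- by rewrite !mulr_ge0 ?pi_ge0// ltW.
- by rewrite !mulr_ge0 ?invr_ge0 ?pi_ge0// ltW.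
- by rewrite !mulr_ge0 ?pi_ge0// ltW.
- by rewrite !mulr_ge0 ?pi_ge0// ltW.
have s0' := lt0r_neq0 s0; have t0' := lt0r_neq0 t0; have st0' := lt0r_neq0 st0.
congr (_ `^ _ * expR _); first by field.
by field; rewrite s0' t0' st0'.
Qed.

Lemma integral_gauss1M s t x y : 0 < s -> 0 < t ->
  (\int[leb]_z (gauss1 s x z * gauss1 t z y)%:E = (gauss1 (s + t) x y)%:E)%E.
Proof.
move=> s0 t0; have st0 : 0 < s + t by rewrite addr_gt0.
under eq_integral do rewrite gauss1M// EFinM.
rewrite ge0_integralZl_EFin ?gauss1_ge0//.
- by rewrite integral_gauss1 ?mule1// divr_gt0// mulr_gt0.
- by move=> z _; rewrite lee_fin gauss1_ge0.
- by have /measurable_EFinP := @measurable_gauss1 (s * t / (s + t)) ((t * x + s * y) / (s + t)).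
Qed.

Lemma gauss1_ub t x y : 0 < t -> gauss1 t x y <= (4 * pi * t) `^ (- (1 / 2)).
Proof.
move=> t0; rewrite /gauss1 ler_piMr ?powR_ge0// expR_le1 oppr_le0.
by rewrite divr_ge0 ?sqr_ge0// mulr_ge0// ltW.
Qed.

End gauss1.

Section heat_kernel.
Context {R : realType} {N : nat}.
Local Notation mu := (@lebesgue_Rn R N).
Implicit Types (s t : R) (x y z : Rn R N).

Lemma sqdist_ge0 x y : 0 <= sqdist x y.
Proof. by apply: sumr_ge0 => i _; exact: sqr_ge0. Qed.

Lemma sqdistC x y : sqdist x y = sqdist y x.
Proof. by apply: eq_bigr => i _; rewrite -sqrrN opprB. Qed.

Lemma heat_kernel_ge0 t x y : 0 <= heat_kernel t x y.
Proof. by rewrite mulr_ge0 ?powR_ge0 ?expR_ge0. Qed.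

Lemma heat_kernelC t x y : heat_kernel t x y = heat_kernel t y x.
Proof. by rewrite /heat_kernel sqdistC. Qed.

Lemma heat_kernel_ub t x y : 0 < t ->
  heat_kernel t x y <= (4 * pi * t) `^ (- (N%:R / 2)).
Proof.
move=> t0; rewrite /heat_kernel ler_piMr ?powR_ge0// expR_le1 oppr_le0.
by rewrite divr_ge0 ?sqdist_ge0// mulr_ge0// ltW.
Qed.

Lemma heat_kernel_prod t x y : 0 < t ->
  heat_kernel t x y = \prod_(i < N) gauss1 t (tnth x i) (tnth y i).
Proof.
move=> t0; rewrite /heat_kernel /gauss1 big_split/= prodr_const card_ord.
rewrite -expR_sum; congr (_ * expR _); last first.
  by rewrite sumrN /sqdist mulr_suml.
by rewrite -powR_mulrn ?powR_ge0// -powRrM; congr powR; rewrite mul1r mulNr mulrC.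
Qed.

Lemma measurable_Vr : measurable_fun [set: R] (@GRing.inv R).
Proof.
(* Inversion is reduced to a power of the nonnegative number [t * t]; at 0 both sides are 0 by
   convention. *)
rewrite (_ : GRing.inv = fun t => (t * t) `^ (-1) * t); last first.
  apply/funext => t; rewrite powR_inv1 -?expr2 ?sqr_ge0//.
  have [->|t0] := eqVneq t 0; first by rewrite invr0 mulr0.
  by field.
apply: measurable_funM => //.
by apply: (measurableT_comp (@measurable_powR R (-1))); exact: measurable_funM.
Qed.

Section measurability.
Context d (T : measurableType d).
Variables (f : T -> R) (g h : T -> Rn R N).
Hypotheses (mf : measurable_fun [set: T] f).
Hypotheses (mg : measurable_fun [set: T] g) (mh : measurable_fun [set: T] h).

Lemma measurable_sqdist : measurable_fun [set: T] (fun w => sqdist (g w) (h w)).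
Proof.
apply: measurable_sum => i; apply: measurable_funX.
by apply: measurable_funB;
  [exact: (measurableT_comp (measurable_tnth i) mg)
  |exact: (measurableT_comp (measurable_tnth i) mh)].
Qed.

Lemma measurable_enorm : measurable_fun [set: T] (fun w => enorm (g w)).
Proof.
have -> : (fun w => enorm (g w)) =
    (fun w => (\sum_(i < N) (tnth (g w) i : R) ^+ 2) `^ 2^-1).
  by apply/funext => w; rewrite powR12_sqrt// sumr_ge0// => i _; exact: sqr_ge0.
apply: (measurableT_comp (@measurable_powR R _)).
apply: measurable_sum => i; apply: measurable_funX.
exact: (measurableT_comp (measurable_tnth i) mg).
Qed.

Lemma measurable_heat_kernel :
  measurable_fun [set: T] (fun w => heat_kernel (f w) (g w) (h w)).
Proof.
apply: measurable_funM.
  by apply: (measurableT_comp (@measurable_powR R _)); exact: measurable_funM.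
apply: measurableT_comp => //; apply: measurableT_comp => //.
apply: measurable_funM; first exact: measurable_sqdist.
by apply: (measurableT_comp measurable_Vr); exact: measurable_funM.
Qed.
End measurability.

Lemma integral_heat_kernel t x : 0 < t ->
  (\int[mu]_y (heat_kernel t x y)%:E = 1)%E.
Proof.
move=> t0; under eq_integral do rewrite heat_kernel_prod//.
rewrite (integral_Rn_prod (f := fun i => gauss1 t (tnth x i)) (c := fun=> 1)).
- by rewrite big1.
- by move=> i; exact: measurable_gauss1.
- by move=> i ?; exact: gauss1_ge0.
- by move=> i; exact: integral_gauss1.
Qed.

Lemma integral_heat_kernelM s t x y : 0 < s -> 0 < t ->
  (\int[mu]_z (heat_kernel s x z * heat_kernel t z y)%:E =
   (heat_kernel (s + t) x y)%:E)%E.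
Proof.
move=> s0 t0; have st0 : 0 < s + t by rewrite addr_gt0.
under eq_integral do rewrite !heat_kernel_prod// -big_split/=.
rewrite (integral_Rn_prod
  (f := fun i (w : R) => gauss1 s (tnth x i) w * gauss1 t w (tnth y i))
  (c := fun i => gauss1 (s + t) (tnth x i) (tnth y i))).
- by rewrite heat_kernel_prod.
- move=> i; apply: measurable_funM; first exact: measurable_gauss1.
  by under eq_fun do rewrite gauss1C; exact: measurable_gauss1.
- by move=> i z; rewrite mulr_ge0 ?gauss1_ge0.
- by move=> i; exact: integral_gauss1M.
Qed.

End heat_kernel.

(** * Weighted estimates of the heat kernel *)

Section singular.
Context {R : realType}.

Lemma measurable_le_set d (T : measurableType d) (f : T -> R) (r : R) :
  measurable_fun [set: T] f -> measurable [set x | (f x <= r)%R].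
Proof.
move=> mf; have := mf measurableT _ (measurable_itv `]-oo, r]%R).
by rewrite setTI.
Qed.

Lemma geometric_sum_le (z : R) K : 0 <= z < 1 ->
  \sum_(0 <= k < K) z ^+ k <= (1 - z)^-1.
Proof.
move=> /andP[z0 z1]; rewrite -[leRHS]mul1r ler_pdivlMr ?subr_gt0//.
have -> : (\sum_(0 <= k < K) z ^+ k) * (1 - z) = 1 - z ^+ K.
  elim: K => [|K IH]; first by rewrite big_geq// mul0r expr0 subrr.
  by rewrite big_nat_recr//= mulrDl IH exprS; ring.
by rewrite gerBl exprn_ge0.
Qed.

Lemma dyadic_scale (r a : R) : 0 < a -> a <= r ->
  exists k, 2 ^- k.+1 * r < a <= 2 ^- k * r.
Proof.
move=> a0 ar; have r0 : 0 < r by exact: lt_le_trans ar.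
have H : exists n, 2 ^- n * r < a.
  exists (Num.bound (r / a)).
  have h1 : r / a < (Num.bound (r / a))%:R.
    by rewrite archi_boundP// divr_ge0// ltW.
  rewrite mulrC ltr_pdivrMr ?exprn_gt0// mulrC -ltr_pdivrMr//.
  rewrite (lt_trans h1)// -natrX ltr_nat; exact: ltn_expl.
case: (ex_minnP H) => -[|k] hk hmin.
  by move: hk; rewrite expr0 invr1 mul1r ltNge ar.
exists k; rewrite hk/= leNgt; apply/negP => /hmin.
by rewrite ltnn.
Qed.

Context d (T : measurableType d) (m : {measure set T -> \bar R}).
Variables (rho : T -> R) (A n del : R).
Hypotheses (mrho : measurable_fun [set: T] rho) (rho0 : forall x, 0 <= rho x).
Hypotheses (A0 : 0 <= A) (del0 : 0 < del) (deln : del < n).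
Hypothesis mball : forall r, 0 < r ->
  (m [set x | (rho x <= r)%R] <= (A * r `^ n)%:E)%E.

Let sball r : set T := [set x | (rho x <= r)%R].

Let msball r : measurable (sball r).
Proof. exact: measurable_le_set. Qed.

(** [2^del] is the variation of the weight across one dyadic shell, and [1 / (1 - 2^(del - n))] sums
    the geometric series of the shells, which converges because [del < n]. Here [n] is the growth
    exponent of the balls: 1 for time, the dimension for space. *)
Definition singular_cst : R := 2 `^ del / (1 - 2 `^ (del - n)).

Lemma singular_cst_gt0 : 0 < singular_cst.
Proof.
rewrite divr_gt0 ?powR_gt0// subr_gt0 -[ltRHS](powRr0 2).
by rewrite /powR pnatr_eq0/= ltr_expR ltr_pM2r ?subr_lt0// ln_gt0// ltr1n.
Qed.

(* Cover the ball by dyadic shells; the shell masses form a geometric series. *)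
Lemma integral_singular_le r : 0 < r ->
  (\int[m]_(x in [set x | (rho x <= r)%R]) (rho x `^ (- del))%:E <=
   (singular_cst * A * r `^ (n - del))%:E)%E.
Proof.
move=> r0; have z1 : 0 <= (2 : R) `^ (del - n) < 1.
  rewrite powR_ge0/= -[ltRHS](powRr0 2).
  by rewrite /powR pnatr_eq0/= ltr_expR ltr_pM2r ?subr_lt0// ln_gt0// ltr1n.
(* [f k] dominates the weight on the shell between the radii [2^-(k+1) r] and [2^-k r], but lives on
   the whole ball, so that [mball] alone estimates its integral. *)
pose f k x : \bar R := (((2 ^- k.+1 * r) `^ (- del)) * \1_(sball (2 ^- k * r)) x)%:E.
have f0 k x : (0 <= f k x)%E by rewrite lee_fin mulr_ge0 ?powR_ge0.
have mf k : measurable_fun [set: T] (f k).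
  by apply/measurable_EFinP; exact: measurable_funM.
have msum : measurable_fun [set: T] (fun x => (\sum_(0 <= k <oo) f k x)%E).
  by apply: ge0_emeasurable_sum => // k x _ _; exact: f0.
have mpow : measurable_fun [set: T] (fun x => (rho x `^ (- del))%:E).
  by apply/measurable_EFinP; apply: (measurableT_comp (@measurable_powR R _)).
apply: (@le_trans _ _ (\int[m]_(x in sball r) (\sum_(0 <= k <oo) f k x))%E).
  apply: ge0_le_integral => //.
  - exact: msball.
  - by move=> x _; rewrite lee_fin powR_ge0.
  - exact: measurable_funTS.
  - exact: measurable_funTS.
  move=> x; rewrite /sball/= => rx.
  have [->|rx0] := eqVneq (rho x) 0.
    rewrite powR0 ?oppr_eq0 ?gt_eqF//; apply: nneseries_ge0 => k _ _; exact: f0.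
  have rx1 : 0 < rho x by rewrite lt_def rx0 rho0.
  have [k /andP[k1 k2]] := dyadic_scale rx1 rx.
  apply: (@le_trans _ _ (\sum_(0 <= i < k.+1) f i x)%E); last first.
    by apply: nneseries_lim_ge => i _ _; exact: f0.
  rewrite big_nat_recr//= (@le_trans _ _ (f k x))//; last first.
    by rewrite leeDr// sume_ge0.
  rewrite lee_fin indicE mem_set ?mulr1//.
  rewrite !powRN lef_pV2 ?posrE ?powR_gt0//; last first.
    by rewrite mulr_gt0// invr_gt0 exprn_gt0.
  rewrite ge0_ler_powR ?nnegrE ?(ltW k1) ?(ltW del0)//.
  by rewrite mulr_ge0 ?invr_ge0 ?exprn_ge0// ltW.
apply: (@le_trans _ _ (\int[m]_x (\sum_(0 <= k <oo) f k x))%E).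
  by apply: ge0_subset_integral => // x _; apply: nneseries_ge0 => k _ _; exact: f0.
rewrite integral_nneseries//.
apply: lime_le.
  by apply: is_cvg_nneseries => k _ _; apply: integral_ge0 => x _; exact: f0.
apply: nearW => K.
apply: (@le_trans _ _ (\sum_(0 <= k < K)
   (2 `^ del * A * r `^ (n - del) * (2 `^ (del - n)) ^+ k)%:E)%E); last first.
  rewrite sumEFin lee_fin -mulr_sumr /singular_cst.
  rewrite [leRHS](_ : _ =
    2 `^ del * A * r `^ (n - del) * (1 - 2 `^ (del - n))^-1); last by ring.
  by rewrite ler_wpM2l ?mulr_ge0 ?powR_ge0//; exact: geometric_sum_le.
apply: lee_sum => k _.
rewrite /f; under eq_integral do rewrite EFinM.
rewrite ge0_integralZl_EFin ?powR_ge0//; last first.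
  by apply/measurable_EFinP; apply: measurable_indic; exact: msball.
rewrite integral_indic// setIT.
have kr : 0 < 2 ^- k * r by rewrite mulr_gt0// invr_gt0 exprn_gt0.
apply: (@le_trans _ _ (((2 ^- k.+1 * r) `^ (- del))%:E * (A * (2 ^- k * r) `^ n)%:E)%E).
  by apply: lee_wpmul2l; [rewrite lee_fin powR_ge0|exact: mball].
rewrite -EFinM lee_fin le_eqVlt; apply/orP; left; apply/eqP.
have p2 : (2 : R) != 0 by rewrite pnatr_eq0.
rewrite !powRM ?invr_ge0 ?exprn_ge0// ?ltW//.
rewrite -!powR_invn// -!powRrM -powR_mulrn ?powR_ge0// -powRrM.
rewrite [in RHS](powRB (x := r)) ?lt0r_neq0 ?implybT// [r `^ (- del)]powRN.
rewrite [LHS](_ : _ = 2 `^ (- k.+1%:R * - del) * 2 `^ (- k%:R * n) * (r `^ n / r `^ del * A)); last by ring.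
rewrite -powRD ?p2 ?implybT//.
rewrite [RHS](_ : _ = 2 `^ del * 2 `^ ((del - n) * k%:R) * (r `^ n / r `^ del * A)); last by ring.
rewrite -powRD ?p2 ?implybT//; congr (_ `^ _ * _).
by rewrite -natr1; ring.
Qed.

End singular.

Section weights.
Context {R : realType}.
Local Notation leb := (@lebesgue_measure R).

(** The shell estimate with [rho] the absolute value and growth exponent 1; the interval lies in the
    ball of radius [t], and the factor 2 is the length of the unit ball. *)
Lemma integral_time_singular (a : R) : 0 < a < 1 -> exists C : R, 0 < C /\
  forall t, 0 < t ->
    (\int[leb]_(s in `]0%R, t[) (s `^ (- a))%:E <= (C * t `^ (1 - a))%:E)%E.
Proof.
move=> /andP[a0 a1]; exists (singular_cst 1 a * 2); split.
  by rewrite mulr_gt0// singular_cst_gt0.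
move=> t t0.
have mabs : measurable_fun [set: measurableTypeR R] (fun s : measurableTypeR R => `|s|).
  exact: normr_measurable.
have hb (r : R) : 0 < r ->
    (leb [set s : measurableTypeR R | (`|s| <= r)%R] <= (2 * r `^ 1)%:E)%E.
  move=> r0; rewrite (_ : [set s | _] = `[(- r), r]%classic); last first.
    by apply/seteqP; split => s; rewrite /= in_itv/= ler_norml.
  rewrite [leLHS](lebesgue_measure_itv `[(- r), r]%R)/= lte_fin gtrN// -EFinD lee_fin.
  by rewrite powRr1 ?(ltW r0)//; lra.
have := integral_singular_le (m := leb) mabs (fun s => normr_ge0 s) (ler0n R 2) a0 a1 hb t0.
apply: le_trans.
have mpw : measurable_fun [set: measurableTypeR R] (fun s : measurableTypeR R => (`|s| `^ (- a))%:E).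
  by apply/measurable_EFinP; apply: (measurableT_comp (@measurable_powR R _) mabs).
rewrite [leLHS](_ : _ = \int[leb]_(s in `]0%R, t[) (`|s| `^ (- a))%:E)%E; last first.
  apply: eq_integral => s; rewrite inE/= in_itv/= => /andP[s0 _].
  by rewrite ger0_norm// ltW.
apply: ge0_subset_integral.
- exact: measurable_itv.
- rewrite (_ : [set s | _] = `[(- t), t]%classic); last first.
    by apply/seteqP; split => s; rewrite /= in_itv/= ler_norml.
  exact: measurable_itv.
- exact: measurable_funTS.
- by move=> s _; rewrite lee_fin powR_ge0.
move=> s; rewrite /= in_itv/= => /andP[s0 st].
by rewrite ger0_norm ltW.
Qed.

Context {N : nat}.
Local Notation mu := (@lebesgue_Rn R N).
Implicit Types (s t : R) (x y z : Rn R N).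

Lemma enorm_ge0 x : 0 <= enorm x. Proof. exact: sqrtr_ge0. Qed.

Lemma enorm_powR x (p : R) : enorm x `^ p = (\sum_(i < N) (tnth x i : R) ^+ 2) `^ (p / 2).
Proof.
rewrite /enorm -powR12_sqrt; last by apply: sumr_ge0 => i _; exact: sqr_ge0.
by rewrite -powRrM mulrC.
Qed.

Lemma measurable_enorm_id : measurable_fun [set: Rn R N] (@enorm R N).
Proof. by apply: measurable_enorm. Qed.

Lemma tnth_le_enorm x i : `|tnth x i : R| <= enorm x.
Proof.
rewrite -sqrtr_sqr ler_wsqrtr// (bigD1 i)//= lerDl.
by apply: sumr_ge0 => j _; exact: sqr_ge0.
Qed.

(** The ball lies in the cube of side [2 * r], whose measure is a product integral. *)
Lemma lebesgue_ball_le r : 0 < r ->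
  (mu [set x | (enorm x <= r)%R] <= (2 ^+ N * r `^ N%:R)%:E)%E.
Proof.
move=> r0.
have mI : measurable `[(- r), r]%classic by exact: measurable_itv.
have -> : (2 ^+ N * r `^ N%:R)%:E =
    (\int[mu]_y (\prod_(i < N) \1_(`[(- r), r]%classic : set R) (tnth y i))%:E)%E.
  rewrite (integral_Rn_prod (f := fun i => \1_(`[(- r), r]%classic : set R)) (c := fun=> 2 * r)).
  - by rewrite prodr_const card_ord exprMn powR_mulrn// ltW.
  - by move=> i; exact: measurable_indic.
  - by move=> i x; rewrite indicE.
  - move=> i; rewrite integral_indic// setIT.
    rewrite [LHS](lebesgue_measure_itv `[(- r), r]%R)/= lte_fin gtrN// -EFinD opprK.
    by congr EFin; ring.
have mB : measurable [set x : Rn R N | (enorm x <= r)%R].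
  exact: measurable_le_set measurable_enorm_id.
rewrite -[X in mu X]setIT -integral_indic//.
apply: ge0_le_integral => //.
- exact/measurable_EFinP/measurable_indic.
- apply/measurable_EFinP; apply: measurable_prod => i _.
  have mind : measurable_fun [set: measurableTypeR R]
      (\1_(`[(- r), r]%classic : set (measurableTypeR R)) : _ -> R).
    exact: measurable_indic.
  exact: (measurableT_comp mind (measurable_tnth i)).
move=> x _; rewrite lee_fin indicE; case: (boolP (x \in _)) => [|_].
  rewrite inE/= => xr; rewrite big1// => i _; rewrite indicE mem_set//=.
  by rewrite in_itv/= -ler_norml (le_trans (tnth_le_enorm _ _)).
by apply: prodr_ge0 => i _; rewrite indicE.
Qed.

(** This is [ln z < z] at [z = u / p], multiplied by [p] and exponentiated. *)
Lemma powR_expRN_le (u p : R) : 0 <= u -> 0 < p -> u `^ p * expR (- u) <= p `^ p.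
Proof.
move=> u0 p0; have [->|un0] := eqVneq u 0; first by rewrite powR0 ?gt_eqF// mul0r powR_ge0.
have u1 : 0 < u by rewrite lt_def un0.
rewrite /powR (negbTE un0) gt_eqF// -expRD ler_expR.
have : ln (u / p) < u / p by apply: ln_sublinear; rewrite divr_gt0.
rewrite ln_div ?posrE// ltr_pdivlMr// => h.
lra.
Qed.

(** With [u = |x - y|^2 / (8 t)] the Gaussian exponent is [- 2 u] at time [t] and [- u] at time
    [2 t]. One half of it absorbs the power of the distance; the other half is the kernel at the
    doubled time. *)
Lemma heat_kernel_moment (p : R) : 0 < p -> exists C : R, 0 < C /\
  forall t x y, 0 < t ->
    sqdist x y `^ p * heat_kernel t x y <= C * t `^ p * heat_kernel (2 * t) x y.
Proof.
move=> p0; exists (2 `^ (N%:R / 2) * (8 `^ p * p `^ p)); split.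
  by rewrite !mulr_gt0 ?powR_gt0.
move=> t x y t0.
have tn0 := lt0r_neq0 t0.
rewrite /heat_kernel.
have -> : (4 * pi * (2 * t)) `^ (- (N%:R / 2)) = (4 * pi * t) `^ (- (N%:R / 2)) / 2 `^ (N%:R / 2) :> R.
  rewrite -powRN -powRM//; first by congr (_ `^ _); ring.
  by rewrite !mulr_ge0 ?pi_ge0 ?(ltW t0).
set u := sqdist x y / (8 * t).
have u0 : 0 <= u by rewrite divr_ge0 ?sqdist_ge0// mulr_ge0// ltW.
have -> : sqdist x y / (4 * (2 * t)) = u by rewrite /u; congr (_ / _); ring.
have -> : - (sqdist x y / (4 * t)) = - u + - u by rewrite /u; field.
rewrite expRD.
have -> : sqdist x y `^ p = 8 `^ p * t `^ p * u `^ p.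
  rewrite (_ : sqdist x y = 8 * t * u); last by rewrite /u; field.
  have t8 : 0 <= 8 * t by rewrite mulr_ge0// ltW.
  by rewrite (powRM _ t8 u0) (powRM _ (ler0n R 8) (ltW t0)).
have h := powR_expRN_le u0 p0.
set G := (4 * pi * t) `^ _; set E := expR _; set W := 2 `^ _.
have W0 : W != 0 by rewrite lt0r_neq0// powR_gt0.
rewrite [leLHS](_ : _ = (8 `^ p * t `^ p * G * E) * (u `^ p * E)); last by ring.
rewrite [leRHS](_ : _ = (8 `^ p * t `^ p * G * E) * p `^ p); last by field.
by rewrite ler_wpM2l// !mulr_ge0 ?powR_ge0 ?expR_ge0.
Qed.

Lemma heat_kernel_le s t x y : 0 < s -> s <= t ->
  heat_kernel s x y <= (t / s) `^ (N%:R / 2) * heat_kernel t x y.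
Proof.
move=> s0 st; have t0 : 0 < t by exact: lt_le_trans st.
rewrite /heat_kernel mulrA ler_pM ?powR_ge0 ?expR_ge0//.
  rewrite (_ : 4 * pi * t = 4 * pi * s * (t / s)); last by field; exact: lt0r_neq0.
  have ps : 0 <= 4 * pi * s by rewrite !mulr_ge0 ?pi_ge0// ltW.
  have ts : 0 < t / s by rewrite divr_gt0.
  rewrite (powRM _ ps (ltW ts)) mulrCA -powRD ?subrr ?powRr0 ?mulr1//.
  by apply/implyP => _; rewrite gt_eqF.
rewrite ler_expR lerN2 ler_wpM2l ?sqdist_ge0// lef_pV2 ?posrE ?mulr_gt0//.
by rewrite ler_pM2l.
Qed.

Lemma expr_sub1_le (r : R) n : 0 <= r <= 1 -> (1 + r) ^+ n - 1 <= 2 ^+ n * r.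
Proof.
move=> /andP[r0 r1].
(* The chord of a convex function on [0, 1]; unlike the weaker claim, it is stable under
   induction. *)
suff : (1 + r) ^+ n - 1 <= (2 ^+ n - 1) * r.
  by move=> h; apply: (le_trans h); rewrite ler_wpM2r// gerBl.
elim: n => [|n IH]; first by rewrite !expr0 !subrr mul0r.
have P1 : 1 <= (2 : R) ^+ n by rewrite exprn_ege1// ler1n.
rewrite !exprS; set P := 2 ^+ n in IH P1 *; set Q := (1 + r) ^+ n in IH *.
have h1 : (1 + r) * Q <= (1 + r) * (1 + (P - 1) * r).
  by rewrite ler_wpM2l// ?addr_ge0//; lra.
have h2 : 0 <= (P - 1) * (r * (1 - r)) by rewrite !mulr_ge0// subr_ge0.
nra.
Qed.

(** The kernel at [s] is [A e^(-v)] times the kernel [G] at [t], with [A = (t / s)^(N / 2) >= 1] and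
    [v >= 0] proportional to [|x - y|^2]. As [|1 - A e^(-v)| <= (A - 1) + v], the normalization
    contributes a multiple of [(t - s) / s]. The term [v G] is unbounded relative to [G] and is
    handled by the moment bound, hence the kernel at time [2 t]. *)
Lemma heat_kernel_diff : exists C : R, 0 < C /\
  forall s t x y, 0 < s -> s <= t -> t <= 2 * s ->
    `|heat_kernel t x y - heat_kernel s x y| <=
      C * ((t - s) / s) * heat_kernel (2 * t) x y.
Proof.
have [C [C0 HC]] := heat_kernel_moment (ltr01 : 0 < 1 :> R).
exists (2 ^+ N * 2 `^ (N%:R / 2) + C); split.
  by rewrite addr_gt0// mulr_gt0 ?exprn_gt0 ?powR_gt0.
move=> s t x y s0 st ts; have t0 : 0 < t by exact: lt_le_trans st.
have sn0 := lt0r_neq0 s0; have tn0 := lt0r_neq0 t0.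
set r := (t - s) / s.
have r01 : 0 <= r <= 1.
  by rewrite divr_ge0 ?subr_ge0 ?(ltW s0)//= ler_pdivrMr//; lra.
have r0 : 0 <= r by case/andP: r01.
set v := sqdist x y * (t - s) / (4 * s * t).
have v0 : 0 <= v.
  by rewrite divr_ge0 ?mulr_ge0 ?sqdist_ge0 ?subr_ge0 ?(ltW s0) ?(ltW t0).
set A := (t / s) `^ (N%:R / 2).
set G := heat_kernel t x y.
have G0 : 0 <= G by exact: heat_kernel_ge0.
have Gs : heat_kernel s x y = A * expR (- v) * G.
  rewrite /G /heat_kernel.
  rewrite (_ : 4 * pi * t = 4 * pi * s * (t / s)); last by field.
  have ps : 0 <= 4 * pi * s by rewrite !mulr_ge0 ?pi_ge0// ltW.
  rewrite [X in _ = _ * (X * _)]powRM ?divr_ge0 ?(ltW s0) ?(ltW t0)//.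
  rewrite (_ : - (sqdist x y / (4 * s)) = - v + - (sqdist x y / (4 * t))); last first.
    by rewrite /v; field; rewrite sn0 tn0.
  rewrite expRD.
  rewrite (_ : (t / s) `^ (- (N%:R / 2)) = A^-1); last by rewrite powRN.
  have An0 : A != 0 by rewrite lt0r_neq0// powR_gt0 ?divr_gt0.
  by field.
have A1 : 1 <= A.
  have ts1 : 1 <= t / s by rewrite ler_pdivlMr// mul1r.
  have -> : 1 = 1 `^ (N%:R / 2) :> R by rewrite powR1.
  by rewrite ge0_ler_powR ?nnegrE ?divr_ge0 ?(ltW s0) ?(ltW t0).
have AP : A <= (1 + r) ^+ N.
  have -> : 1 + r = t / s by rewrite /r; field.
  rewrite -powR_mulrn ?divr_ge0 ?(ltW s0) ?(ltW t0)// ler_powR//.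
    by rewrite ler_pdivlMr// mul1r.
  by rewrite ler_pdivrMr// ler_peMr// ler1n.
have hA : A - 1 <= 2 ^+ N * r.
  by apply: le_trans (expr_sub1_le N r01); rewrite lerB.
have ev1 : expR (- v) <= 1 by rewrite expR_le1 oppr_le0.
have ev2 : 1 - v <= expR (- v) by exact: expR_ge1Dx.
have ev0 : 0 <= expR (- v) by exact: expR_ge0.
have hv : v * G <= C * r * heat_kernel (2 * t) x y.
  have := HC t x y t0; rewrite !powRr1 ?sqdist_ge0 ?(ltW t0)// -/G => h.
  rewrite (_ : v * G = (r / (4 * t)) * (sqdist x y * G)); last first.
    by rewrite /v /r; field; rewrite sn0 tn0.
  apply: (@le_trans _ _ (r / (4 * t) * (C * t * heat_kernel (2 * t) x y))).
    by rewrite ler_wpM2l// divr_ge0// mulr_ge0// (ltW t0).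
  rewrite [leLHS](_ : _ = (C * r * heat_kernel (2 * t) x y) / 4); last by field.
  rewrite ler_pdivrMr// ler_peMr ?ler1n//.
  by rewrite mulr_ge0 ?heat_kernel_ge0// mulr_ge0// ltW.
have G2 : G <= 2 `^ (N%:R / 2) * heat_kernel (2 * t) x y.
  have := @heat_kernel_le t (2 * t) x y t0; rewrite mulrK ?unitfE//.
  by apply; lra.
have hAG : (A - 1) * G <= 2 ^+ N * 2 `^ (N%:R / 2) * r * heat_kernel (2 * t) x y.
  apply: (@le_trans _ _ ((2 ^+ N * r) * G)); first by rewrite ler_wpM2r.
  rewrite [leRHS](_ : _ = (2 ^+ N * r) * (2 `^ (N%:R / 2) * heat_kernel (2 * t) x y)); last by ring.
  by rewrite ler_wpM2l// mulr_ge0 ?exprn_ge0.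
rewrite Gs -{1}(mul1r G) -mulrBl normrM (ger0_norm G0).
apply: (@le_trans _ _ ((A - 1) * G + v * G)); last first.
  by rewrite (mulrDl _ _ r) [leRHS]mulrDl lerD.
rewrite -mulrDl ler_wpM2r// ler_norml; apply/andP; split; nra.
Qed.

(** The square of the norm is at most 4 times the maximum of the two squares. Passing through the
    maximum works for every positive [p], whereas convexity would require [p >= 1]. *)
Lemma enorm_powR_le x y (p : R) : 0 < p ->
  enorm x `^ p <= 2 `^ p * (enorm y `^ p + sqdist x y `^ (p / 2)).
Proof.
move=> p0; rewrite !enorm_powR.
set X := \sum_(i < N) _; set Y := \sum_(i < N) _; set Z := sqdist x y.
have Z0 : 0 <= Z by exact: sqdist_ge0.
have Y0 : 0 <= Y by apply: sumr_ge0 => i _; exact: sqr_ge0.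
have X0 : 0 <= X by apply: sumr_ge0 => i _; exact: sqr_ge0.
have XYZ : X <= 2 * (Y + Z).
  rewrite /X /Y /Z /sqdist -big_split/= mulr_sumr; apply: ler_sum => i _.
  set a : R := tnth x i; set b : R := tnth y i; have := sqr_ge0 (a - 2 * b); nra.
have h : X <= 4 * Num.max Y Z.
  apply: (le_trans XYZ); rewrite (_ : 4 = 2 * 2); last by ring.
  rewrite -mulrA ler_pM2l// mulrDl mul1r lerD// le_max lexx ?orbT//.
have -> : 2 `^ p = 4 `^ (p / 2) :> R.
  rewrite (_ : 4 = 2 ^+ 2); last by ring.
  by rewrite -powR_mulrn// -powRrM; congr powR; field.
apply: (@le_trans _ _ ((4 * Num.max Y Z) `^ (p / 2))).
  by rewrite ge0_ler_powR ?nnegrE ?divr_ge0 ?(ltW p0)// mulr_ge0// le_max Y0.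
rewrite powRM// ?le_max ?Y0// ler_wpM2l ?powR_ge0//.
by rewrite /Num.max; case: ifPn => _; rewrite ?lerDl ?lerDr powR_ge0.
Qed.

(** Only an inequality: for [a = 0] and nonzero [p] the product is 0, by the convention for powers
    of 0. *)
Lemma powRN_mulr_le1 (a p : R) : 0 <= a -> a `^ p * a `^ (- p) <= 1.
Proof.
move=> a0; have [a00|an0] := eqVneq (a `^ p) 0; first by rewrite a00 mul0r.
by rewrite powRN mulfV.
Qed.

Section gamma_weight.
Variable del : R.
Hypotheses (del0 : 0 < del) (delN : del < N%:R).

(** The integral is cut at [|y| = sqrt t]. Outside, the weight is at most [t^(- del / 2)] and the
    kernel has mass 1; inside, the kernel is at most its supremum, of order [t^(- N / 2)], and the
    shell estimate contributes [t^((N - del) / 2)]. *)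
Lemma heat_kernel_weight_sup : exists C : R, 0 < C /\ forall t x, 0 < t ->
  (\int[mu]_y (heat_kernel t x y * enorm y `^ (- del))%:E <=
   (C * t `^ (- (del / 2)))%:E)%E.
Proof.
exists (1 + singular_cst N%:R del * 2 ^+ N); split.
  by rewrite addr_gt0// mulr_gt0 ?exprn_gt0// singular_cst_gt0.
move=> t x t0.
have st0 : 0 < Num.sqrt t by rewrite sqrtr_gt0.
have H := integral_singular_le (m := mu) measurable_enorm_id enorm_ge0
  (exprn_ge0 N (ler0n R 2)) del0 delN lebesgue_ball_le st0.
set B := [set y | _] in H.
have mB : measurable B by exact: measurable_le_set measurable_enorm_id.
have mw : measurable_fun [set: Rn R N] (fun y => enorm y `^ (- del)).
  by apply: (measurableT_comp (@measurable_powR R _)); exact: measurable_enorm_id.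
have mG : measurable_fun [set: Rn R N] (heat_kernel t x).
  by apply: measurable_heat_kernel.
pose c := (4 * pi * t) `^ (- (N%:R / 2)).
have c0 : 0 <= c by exact: powR_ge0.
apply: (@le_trans _ _ (\int[mu]_y ((t `^ (- (del / 2)))%:E * (heat_kernel t x y)%:E +
   c%:E * ((enorm y `^ (- del))%:E * (\1_B y)%:E)))%E).
  apply: ge0_le_integral => //.
  - by move=> y _; rewrite lee_fin mulr_ge0 ?heat_kernel_ge0 ?powR_ge0.
  - by apply/measurable_EFinP; exact: measurable_funM.
  - apply: emeasurable_funD.
      by apply/measurable_EFinP; exact: measurable_funM.
    by apply/measurable_EFinP; apply: measurable_funM => //; apply: measurable_funM.
  move=> y _; rewrite -!EFinM -EFinD lee_fin indicE.
  case: (boolP (y \in B)) => [_|yB].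
    rewrite mulr1 -[leLHS]add0r lerD// ?mulr_ge0 ?powR_ge0 ?heat_kernel_ge0//.
    by rewrite ler_wpM2r ?powR_ge0// heat_kernel_ub.
  rewrite !mulr0 addr0 mulrC ler_wpM2r ?heat_kernel_ge0//.
  move: yB; rewrite notin_setE /B/= => /negP; rewrite -ltNge => yB.
  rewrite (_ : t `^ _ = Num.sqrt t `^ (- del)); last first.
    by rewrite -powR12_sqrt ?(ltW t0)// -powRrM; congr powR; field.
  have y0 : 0 < enorm y by exact: lt_trans yB.
  rewrite !powRN lef_pV2 ?posrE ?powR_gt0//.
  by rewrite ge0_ler_powR ?nnegrE// ltW.
rewrite ge0_integralD//; last 4 first.
- by move=> y _; rewrite -EFinM lee_fin mulr_ge0 ?heat_kernel_ge0 ?powR_ge0.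
- by apply/measurable_EFinP; exact: measurable_funM.
- by move=> y _; rewrite -!EFinM lee_fin !mulr_ge0 ?powR_ge0 ?indicE.
- by apply/measurable_EFinP; apply: measurable_funM => //; apply: measurable_funM.
rewrite ge0_integralZl_EFin ?powR_ge0//; last 2 first.
- by move=> y _; rewrite lee_fin heat_kernel_ge0.
- exact/measurable_EFinP.
rewrite integral_heat_kernel// mule1.
rewrite ge0_integralZl_EFin//; last 2 first.
- by move=> y _; rewrite -EFinM lee_fin mulr_ge0 ?powR_ge0 ?indicE.
- by apply/measurable_EFinP; apply: measurable_funM.
rewrite [X in (_ + c%:E * X)%E](_ : _ = \int[mu]_(y in B) (enorm y `^ (- del))%:E)%E; last first.
  rewrite [RHS]integral_mkcond; apply: eq_integral => y _.
  rewrite patchE indicE; case: (boolP (y \in B)) => _; first by rewrite mule1.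
  by rewrite mule0.
rewrite mulrDl mul1r EFinD; apply: leeD => //.
apply: (le_trans (lee_wpmul2l _ H)); rewrite ?lee_fin//.
rewrite mulrCA.
rewrite ler_wpM2l//.
  by rewrite mulr_ge0 ?exprn_ge0// ltW// singular_cst_gt0.
rewrite -powR12_sqrt ?(ltW t0)// -powRrM /c.
apply: (@le_trans _ _ (t `^ (- (N%:R / 2)) * t `^ (2^-1 * (N%:R - del)))).
  rewrite ler_wpM2r ?powR_ge0// !powRN lef_pV2 ?posrE ?powR_gt0 ?mulr_gt0 ?pi_gt0//.
  rewrite ge0_ler_powR ?nnegrE ?mulr_ge0 ?pi_ge0 ?(ltW t0)//.
  by rewrite ler_peMl ?(ltW t0)//; have := @pi_ge2 R; lra.
rewrite -powRD ?lt0r_neq0 ?implybT//.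
by rewrite le_eqVlt; apply/orP; left; apply/eqP; congr powR; field.
Qed.

(** [|x|^del] is split into [|y|^del], which cancels the weight, and [|x - y|^del], which the moment
    bound turns into [t^(del / 2)] and a kernel at time [2 t]. The supremum bound at that time
    compensates the power of [t]. *)
Lemma heat_kernel_weight_pt : exists C : R, 0 < C /\ forall t x, 0 < t ->
  (\int[mu]_y (enorm x `^ del * (heat_kernel t x y * enorm y `^ (- del)))%:E <= C%:E)%E.
Proof.
have [C1 [C10 H1]] := heat_kernel_weight_sup.
have d20 : 0 < del / 2 by rewrite divr_gt0.
have [C2 [C20 H2]] := heat_kernel_moment d20.
exists (2 `^ del * (1 + C1 * C2)); split.
  by rewrite mulr_gt0 ?powR_gt0// addr_gt0// mulr_gt0.
move=> t x t0.
have mw : measurable_fun [set: Rn R N] (fun y => enorm y `^ (- del)).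
  by apply: (measurableT_comp (@measurable_powR R _)); exact: measurable_enorm_id.
have mG s : measurable_fun [set: Rn R N] (heat_kernel s x).
  by apply: measurable_heat_kernel.
have k1 : 0 <= 2 `^ del :> R by exact: powR_ge0.
have k2 : 0 <= 2 `^ del * (C2 * t `^ (del / 2)) by rewrite !mulr_ge0 ?powR_ge0// ltW.
apply: (@le_trans _ _ (\int[mu]_y ((2 `^ del)%:E * (heat_kernel t x y)%:E +
   (2 `^ del * (C2 * t `^ (del / 2)))%:E * (heat_kernel (2 * t) x y * enorm y `^ (- del))%:E))%E).
  apply: ge0_le_integral => //.
  - by move=> y _; rewrite lee_fin !mulr_ge0 ?heat_kernel_ge0 ?powR_ge0.
  - by apply/measurable_EFinP; apply: measurable_funM => //; exact: measurable_funM.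
  - apply: emeasurable_funD; apply/measurable_EFinP; apply: measurable_funM => //.
    exact: measurable_funM.
  move=> y _; rewrite -!EFinM -EFinD lee_fin.
  set G := heat_kernel t x y; set W := enorm y `^ (- del).
  have G0 : 0 <= G by exact: heat_kernel_ge0.
  have W0 : 0 <= W by exact: powR_ge0.
  apply: (@le_trans _ _ (2 `^ del * (enorm y `^ del + sqdist x y `^ (del / 2)) * (G * W))).
    by apply: ler_wpM2r; [exact: mulr_ge0|exact: enorm_powR_le].
  rewrite [leLHS](_ : _ = 2 `^ del * (G * (enorm y `^ del * W)) + 2 `^ del * ((sqdist x y `^ (del / 2) * G) * W)); last by ring.
  rewrite lerD//.
    by rewrite ler_wpM2l// ler_piMr// powRN_mulr_le1 ?enorm_ge0.
  rewrite -[leRHS]mulrA ler_wpM2l// [leRHS]mulrA ler_wpM2r//; exact: H2.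
rewrite ge0_integralD//; last 4 first.
- by move=> y _; rewrite -EFinM lee_fin mulr_ge0 ?heat_kernel_ge0.
- by apply/measurable_EFinP; exact: measurable_funM.
- by move=> y _; rewrite -!EFinM lee_fin mulr_ge0// mulr_ge0 ?powR_ge0 ?heat_kernel_ge0.
- by apply/measurable_EFinP; apply: measurable_funM => //; exact: measurable_funM.
rewrite ge0_integralZl_EFin//; last 2 first.
- by move=> y _; rewrite lee_fin heat_kernel_ge0.
- exact/measurable_EFinP.
rewrite ge0_integralZl_EFin//; last 2 first.
- by move=> y _; rewrite lee_fin mulr_ge0 ?powR_ge0 ?heat_kernel_ge0.
- by apply/measurable_EFinP; exact: measurable_funM.
rewrite integral_heat_kernel// mule1 mulrDr mulr1 EFinD leeD2l//.
have t20 : 0 < 2 * t by rewrite mulr_gt0.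
apply: (le_trans (lee_wpmul2l _ (H1 _ x t20))); first by rewrite lee_fin.
rewrite -EFinM lee_fin -!mulrA ler_wpM2l//.
rewrite [leLHS](_ : _ = (C1 * C2) * (t `^ (del / 2) * (2 * t) `^ (- (del / 2)))); last by ring.
rewrite -[leRHS]mulr1 ler_wpM2l ?mulr_ge0 ?(ltW C10) ?(ltW C20)//.
rewrite powRN ler_pdivrMr ?powR_gt0// mul1r.
rewrite ge0_ler_powR ?nnegrE ?(ltW d20) ?(ltW t20) ?(ltW t0)//.
by rewrite ler_peMl ?(ltW t0)// ler1n.
Qed.

End gamma_weight.
End weights.

(** * The heat flow in weighted spaces *)

Section aheat.
Context {R : realType} {N : nat}.
Local Notation mu := (@lebesgue_Rn R N).
Implicit Types (s t : R) (x y z : Rn R N).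

Definition aheat t (f : Rn R N -> R) x : \bar R :=
  (\int[mu]_y (heat_kernel t x y * `|f y|)%:E)%E.

Lemma measurable_heat_kernel2 t x : measurable_fun [set: Rn R N] (heat_kernel t x).
Proof. by apply: measurable_heat_kernel. Qed.

Lemma measurable_heat_kernel1 t y : measurable_fun [set: Rn R N] ((heat_kernel t)^~ y).
Proof. by apply: measurable_heat_kernel. Qed.

Variable f : Rn R N -> R.
Hypothesis mf : measurable_fun [set: Rn R N] f.

Lemma measurable_aheat_int t x :
  measurable_fun [set: Rn R N] (fun y => (heat_kernel t x y * `|f y|)%:E).
Proof.
apply/measurable_EFinP; apply: measurable_funM; first exact: measurable_heat_kernel2.
exact: measurableT_comp.
Qed.

Lemma aheat_ge0 t x : (0 <= aheat t f x)%E.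
Proof. by apply: integral_ge0 => y _; rewrite lee_fin mulr_ge0 ?heat_kernel_ge0. Qed.

Lemma measurable_aheat :
  measurable_fun [set: measurableTypeR R * Rn R N] (fun p => aheat p.1 f p.2).
Proof.
pose F (z : (measurableTypeR R * Rn R N) * Rn R N) : \bar R :=
  (heat_kernel z.1.1 z.1.2 z.2 * `|f z.2|)%:E.
have mF : measurable_fun [set: (measurableTypeR R * Rn R N) * Rn R N] F.
  apply/measurable_EFinP; apply: measurable_funM.
    apply: measurable_heat_kernel => //.
    - by apply: (measurableT_comp measurable_fst); exact: measurable_fst.
    - by apply: (measurableT_comp measurable_snd); exact: measurable_fst.
  by apply: measurableT_comp => //; apply: (measurableT_comp mf).
apply: (measurable_fun_fubini_tonelli_F (m2 := mu) F mF) => z.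
by rewrite lee_fin mulr_ge0 ?heat_kernel_ge0.
Qed.

Lemma measurable_aheatx t : measurable_fun [set: Rn R N] (aheat t f).
Proof. exact: measurable_fun_pair2 measurable_aheat. Qed.

Lemma aheat_semigroup s t x : 0 < s -> 0 < t ->
  (\int[mu]_z ((heat_kernel s x z)%:E * aheat t f z) = aheat (s + t) f x)%E.
Proof.
move=> s0 t0.
under eq_integral => z _.
  rewrite -ge0_integralZl_EFin ?heat_kernel_ge0//; last 2 first.
  - by move=> y _; rewrite lee_fin mulr_ge0 ?heat_kernel_ge0.
  - exact: measurable_aheat_int.
  over.
pose F (z : Rn R N * Rn R N) : \bar R :=
  ((heat_kernel s x z.1)%:E * (heat_kernel t z.1 z.2 * `|f z.2|)%:E)%E.
have mF : measurable_fun [set: Rn R N * Rn R N] F.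
  apply/measurable_EFinP; apply: measurable_funM.
    by apply: measurable_heat_kernel.
  apply: measurable_funM; first exact: measurable_heat_kernel.
  by apply: measurableT_comp => //; apply: (measurableT_comp mf).
have F0 w : (0 <= F w)%E.
  rewrite /F -EFinM lee_fin; apply: mulr_ge0; first exact: heat_kernel_ge0.
  by apply: mulr_ge0 => //; exact: heat_kernel_ge0.
rewrite (fubini_tonelli (m1 := mu) (m2 := mu) F mF F0).
apply: eq_integral => y _; rewrite /F/=.
under eq_integral do rewrite -EFinM mulrCA mulrC EFinM.
transitivity ((`|f y|)%:E * \int[mu]_z (heat_kernel s x z * heat_kernel t z y)%:E)%E; last first.
  by rewrite integral_heat_kernelM// -EFinM mulrC.
rewrite -ge0_integralZl_EFin//.
- by apply: eq_integral => z _; rewrite -!EFinM; congr EFin; ring.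
- by move=> z _; rewrite lee_fin mulr_ge0 ?heat_kernel_ge0.
- by apply/measurable_EFinP; apply: measurable_funM;
    [exact: measurable_heat_kernel2|exact: measurable_heat_kernel1].
Qed.

Lemma aheat_le s t x : 0 < s -> s <= t ->
  (aheat s f x <= ((t / s) `^ (N%:R / 2))%:E * aheat t f x)%E.
Proof.
move=> s0 st; rewrite -ge0_integralZl_EFin ?powR_ge0//; last 2 first.
- by move=> y _; rewrite lee_fin mulr_ge0 ?heat_kernel_ge0.
- exact: measurable_aheat_int.
apply: ge0_le_integral => //.
- by move=> y _; rewrite lee_fin mulr_ge0 ?heat_kernel_ge0.
- exact: measurable_aheat_int.
- by apply: measurable_funeM; exact: measurable_aheat_int.
move=> y _; rewrite -EFinM lee_fin mulrA ler_wpM2r//; exact: heat_kernel_le.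
Qed.

Lemma aheat_diff_le (C : R) s t x : 0 <= C ->
  (forall y, `|heat_kernel t x y - heat_kernel s x y| <= C * heat_kernel (2 * t) x y) ->
  (\int[mu]_y (`|heat_kernel t x y - heat_kernel s x y| * `|f y|)%:E <=
   C%:E * aheat (2 * t) f x)%E.
Proof.
move=> C0 H; rewrite -ge0_integralZl_EFin//; last 2 first.
- by move=> y _; rewrite lee_fin mulr_ge0 ?heat_kernel_ge0.
- exact: measurable_aheat_int.
apply: ge0_le_integral => //.
- apply/measurable_EFinP; apply: measurable_funM; last exact: measurableT_comp.
  apply: measurableT_comp => //; apply: measurable_funB; exact: measurable_heat_kernel2.
- by apply: measurable_funeM; exact: measurable_aheat_int.
by move=> y _; rewrite -EFinM lee_fin mulrA ler_wpM2r.
Qed.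

End aheat.

(** * The weighted norms *)

Section wnorm.
Context {R : realType} {N : nat}.
Local Notation mu := (@lebesgue_Rn R N).
Implicit Types (s t : R) (x y z : Rn R N).

(** If the measure were null, the heat kernel would have integral 0 instead of 1. The norm with
    exponent [+oo] is an essential supremum only for a nonzero measure, so [wnormyE] relies on
    this. *)
Lemma lebesgue_Rn_gt0 : (0 < mu [set: Rn R N])%E.
Proof.
rewrite lt_neqAle measure_ge0 andbT eq_sym; apply/negP => /eqP mu0.
have : (\int[mu]_y (heat_kernel 1 (nseq_tuple N 0 : Rn R N) y)%:E = 1)%E.
  exact: integral_heat_kernel.
rewrite null_set_integral//; first by move/eqP; rewrite eqe eq_sym oner_eq0.
by apply/measurable_EFinP; exact: measurable_heat_kernel2.
Qed.

Lemma wnormE (p gamma : R) (f : Rn R N -> \bar R) :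
  wnorm p%:E gamma f =
  ((\int[mu]_x (`|(enorm x `^ gamma)%:E * f x| `^ p)) `^ p^-1)%E.
Proof. by rewrite /wnorm unlock. Qed.

Lemma wnormyE gamma (f : Rn R N -> \bar R) :
  wnorm +oo%E gamma f =
  ess_sup mu (fun x => `|(enorm x `^ gamma)%:E * f x|)%E.
Proof. by rewrite /wnorm unlock lebesgue_Rn_gt0. Qed.

Lemma wnorm_ge0 q gamma (f : Rn R N -> \bar R) : (0 <= wnorm q gamma f)%E.
Proof. exact: Lnorm_ge0. Qed.

Lemma measurable_weight gamma (f : Rn R N -> \bar R) : measurable_fun [set: Rn R N] f ->
  measurable_fun [set: Rn R N] (fun x => (enorm x `^ gamma)%:E * f x)%E.
Proof.
move=> mf; apply: emeasurable_funM => //; apply/measurable_EFinP.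
by apply: (measurableT_comp (@measurable_powR R _)); exact: measurable_enorm_id.
Qed.

Lemma le_wnorm (q : \bar R) gamma (c : R) (f g : Rn R N -> \bar R) : (0 < q)%E -> 0 <= c ->
  measurable_fun [set: Rn R N] f -> measurable_fun [set: Rn R N] g ->
  (forall x, `|f x| <= c%:E * `|g x|)%E ->
  (wnorm q gamma f <= c%:E * wnorm q gamma g)%E.
Proof.
move=> q0 c0 mf mg fg.
have fg' x : (`|(enorm x `^ gamma)%:E * f x| <= c%:E * `|(enorm x `^ gamma)%:E * g x|)%E.
  rewrite !abseM muleCA lee_wpmul2l//.
case: q q0 => [p|_|//].
  rewrite lte_fin => p0; rewrite !wnormE.
  have mp (h : Rn R N -> \bar R) : measurable_fun [set: Rn R N] h ->
      measurable_fun [set: Rn R N] (fun x => `|(enorm x `^ gamma)%:E * h x| `^ p)%E.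
    move=> mh; apply: (measurableT_comp (measurable_poweR _)).
    by apply: measurableT_comp => //; exact: measurable_weight.
  have -> : c%:E = (((c `^ p)%:E) `^ p^-1)%E.
    by rewrite poweR_EFin -powRrM mulfV ?gt_eqF// powRr1.
  rewrite -poweRM ?lee_fin ?powR_ge0//; last first.
    by apply: integral_ge0 => x _; exact: poweR_ge0.
  rewrite gt0_ler_poweR ?invr_ge0 ?(ltW p0)//.
  - by rewrite in_itv/= leey andbT; apply: integral_ge0 => x _; exact: poweR_ge0.
  - rewrite in_itv/= leey andbT; apply: mule_ge0; first by rewrite lee_fin powR_ge0.
    by apply: integral_ge0 => x _; exact: poweR_ge0.
  rewrite -ge0_integralZl_EFin ?powR_ge0//; last 2 first.
  - by move=> x _; exact: poweR_ge0.
  - exact: mp.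
  apply: ge0_le_integral => //.
  - by move=> x _; exact: poweR_ge0.
  - exact: mp.
  - by apply: measurable_funeM; exact: mp.
  move=> x _; rewrite -[(c `^ p)%:E]/(c%:E `^ p)%E -poweRM ?lee_fin//.
  by rewrite gt0_ler_poweR ?(ltW p0)// in_itv/= leey andbT// mule_ge0.
rewrite !wnormyE; apply/ess_supP.
have := ess_sup_ge mu (fun x => `|(enorm x `^ gamma)%:E * g x|%E).
apply: filterS => x gx; apply: (le_trans (fg' x)).
by rewrite lee_wpmul2l.
Qed.

(** At the origin the weights [|y|^gamma] and [|y|^(- gamma)] are both 0 by convention and do not
    cancel; the set where this happens is negligible, being contained in arbitrarily small balls. *)
Lemma null_enorm0 : (0 < N)%N -> mu [set x | (enorm x <= 0)%R] = 0%E.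
Proof.
move=> N0; apply/eqP; rewrite eq_le measure_ge0 andbT.
apply/lee_addgt0Pr => e e0; rewrite add0e.
pose r : R := Num.min 1 (e / 2 ^+ N).
have r0 : 0 < r by rewrite /r lt_min ltr01 divr_gt0 ?exprn_gt0.
apply: (@le_trans _ _ (mu [set x | (enorm x <= r)%R])).
  apply: le_measure; rewrite ?inE; try exact: measurable_le_set measurable_enorm_id.
  by move=> x /= h; rewrite (le_trans h)// ltW.
apply: (le_trans (lebesgue_ball_le r0)); rewrite lee_fin.
have r1 : r <= 1 by rewrite /r ge_min lexx.
apply: (@le_trans _ _ (2 ^+ N * r)).
  rewrite ler_wpM2l ?exprn_ge0// powR_mulrn ?(ltW r0)//.
  by rewrite -[leRHS]expr1 ler_wiXn2l// ltW.
by rewrite mulrC -ler_pdivlMr ?exprn_gt0// /r ge_min lexx orbT.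
Qed.

End wnorm.

(** * Smoothing and interpolation in the weighted spaces *)

Section lqw.
Context {R : realType} {N : nat}.
Hypothesis N0 : (0 < N)%N.
Local Notation mu := (@lebesgue_Rn R N).
Implicit Types (s t : R) (x y z : Rn R N).

Lemma recip_fin (p : R) : p != 0 -> recip p%:E = p^-1.
Proof. by move=> p0; rewrite /recip inver (negbTE p0). Qed.

Lemma recipy : recip (+oo : \bar R) = 0.
Proof. by rewrite /recip invey. Qed.

Lemma ae_enorm_gt0 : {ae mu, forall y, 0 < enorm y}.
Proof.
exists [set x | (enorm x <= 0)%R]; split.
- exact: measurable_le_set measurable_enorm_id.
- exact: null_enorm0.
- by move=> x /= /negP; rewrite -leNgt.
Qed.

Lemma measurable_weightr (g : R) (f : Rn R N -> R) : measurable_fun [set: Rn R N] f ->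
  measurable_fun [set: Rn R N] (fun y => enorm y `^ g * f y).
Proof.
move=> mf; apply: measurable_funM => //.
by apply: (measurableT_comp (@measurable_powR R _)); exact: measurable_enorm_id.
Qed.

Lemma wnorm_EFin (p gamma : R) (f : Rn R N -> R) : wnorm p%:E gamma (EFin \o f) =
  ((\int[mu]_y ((enorm y `^ gamma * `|f y|) `^ p)%:E) `^ p^-1)%E.
Proof.
rewrite wnormE; congr poweR; apply: eq_integral => y _ /=.
by rewrite normrM (ger0_norm (powR_ge0 _ _)).
Qed.

Section finite_exponent.
Variables (p gamma : R).
Hypothesis p1 : 1 < p.

Let pc : R := p / (p - 1).

Let p0 : 0 < p. Proof. exact: lt_trans p1. Qed.
Let pm0 : 0 < p - 1. Proof. by rewrite subr_gt0. Qed.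
Let pc0 : 0 < pc. Proof. by rewrite divr_gt0. Qed.
Let pcV : pc^-1 = 1 - p^-1.
Proof. by rewrite /pc; field; rewrite !lt0r_neq0. Qed.

(** The heat flow of the [p]-th power of the weighted function. It carries both estimates of the
    flow of [f]: the supremum of the kernel bounds it pointwise, and conservation of mass gives its
    integral. *)
Definition wmass t (f : Rn R N -> R) x : \bar R :=
  (\int[mu]_y (heat_kernel t x y * (enorm y `^ gamma * `|f y|) `^ p)%:E)%E.

Variable f : Rn R N -> R.
Hypothesis mf : measurable_fun [set: Rn R N] f.

Let mF : measurable_fun [set: Rn R N] (fun y => (enorm y `^ gamma * `|f y|) `^ p).
Proof.
apply: (measurableT_comp (@measurable_powR R _)); apply: measurable_weightr.
exact: measurableT_comp.
Qed.

Lemma wmass_ge0 t x : (0 <= wmass t f x)%E.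
Proof. by apply: integral_ge0 => y _; rewrite lee_fin mulr_ge0 ?heat_kernel_ge0 ?powR_ge0. Qed.

Lemma wmass_le t x : 0 < t ->
  (wmass t f x <= (t `^ (- (N%:R / 2)))%:E *
    \int[mu]_y ((enorm y `^ gamma * `|f y|) `^ p)%:E)%E.
Proof.
move=> t0; rewrite -ge0_integralZl_EFin ?powR_ge0//; last 2 first.
- by move=> y _; rewrite lee_fin powR_ge0.
- exact/measurable_EFinP.
apply: ge0_le_integral => //.
- by move=> y _; rewrite lee_fin mulr_ge0 ?heat_kernel_ge0 ?powR_ge0.
- apply/measurable_EFinP; apply: measurable_funM => //.
  exact: measurable_heat_kernel2.
- by apply/measurable_EFinP; exact: measurable_funM.
move=> y _; rewrite -EFinM lee_fin ler_wpM2r ?powR_ge0//.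
apply: (le_trans (heat_kernel_ub _ _ t0)).
rewrite !powRN lef_pV2 ?posrE ?powR_gt0 ?mulr_gt0 ?pi_gt0//.
rewrite ge0_ler_powR ?nnegrE ?mulr_ge0 ?pi_ge0 ?(ltW t0)//.
by rewrite ler_peMl ?(ltW t0)//; have := @pi_ge2 R; lra.
Qed.

Lemma integral_wmass t : 0 < t ->
  (\int[mu]_x wmass t f x = \int[mu]_y ((enorm y `^ gamma * `|f y|) `^ p)%:E)%E.
Proof.
move=> t0.
pose F (z : Rn R N * Rn R N) : \bar R :=
  (heat_kernel t z.1 z.2 * (enorm z.2 `^ gamma * `|f z.2|) `^ p)%:E.
have mF' : measurable_fun [set: Rn R N * Rn R N] F.
  apply/measurable_EFinP; apply: measurable_funM.
    exact: measurable_heat_kernel.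
  exact: (measurableT_comp mF).
have F0 w : (0 <= F w)%E by rewrite lee_fin mulr_ge0 ?heat_kernel_ge0 ?powR_ge0.
rewrite (fubini_tonelli (m1 := mu) (m2 := mu) F mF' F0).
apply: eq_integral => y _; rewrite /F/=.
under eq_integral do rewrite mulrC heat_kernelC EFinM.
rewrite ge0_integralZl_EFin ?powR_ge0 ?integral_heat_kernel ?mule1//.
- by move=> x _; rewrite lee_fin heat_kernel_ge0.
- by apply/measurable_EFinP; exact: measurable_heat_kernel2.
Qed.

(** Hoelder's inequality for the probability density [heat_kernel t x]: the kernel is distributed as
    [G^(1/p') G^(1/p)], and [|y|^(- gamma)] is paired with [|y|^gamma |f|]. *)
Lemma aheat_hoelder t x : 0 < t ->
  (aheat t f x <=
   (\int[mu]_y (heat_kernel t x y * enorm y `^ (- (gamma * pc)))%:E) `^ pc^-1 *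
   wmass t f x `^ p^-1)%E.
Proof.
move=> t0.
pose u y := heat_kernel t x y `^ pc^-1 * enorm y `^ (- gamma).
pose v y := heat_kernel t x y `^ p^-1 * (enorm y `^ gamma * `|f y|).
have mG : measurable_fun [set: Rn R N] (heat_kernel t x) by exact: measurable_heat_kernel2.
have mu' : measurable_fun [set: Rn R N] u.
  apply: measurable_funM; first exact: (measurableT_comp (@measurable_powR R _)).
  by apply: (measurableT_comp (@measurable_powR R _)); exact: measurable_enorm_id.
have mv : measurable_fun [set: Rn R N] v.
  apply: measurable_funM; first exact: (measurableT_comp (@measurable_powR R _)).
  by apply: measurable_weightr; exact: measurableT_comp.
have pcp : pc^-1 + p^-1 = 1 by rewrite pcV subrK.
have G0 y : 0 <= heat_kernel t x y by exact: heat_kernel_ge0.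
have u0 y : 0 <= u y by rewrite mulr_ge0 ?powR_ge0.
have v0 y : 0 <= v y by rewrite !mulr_ge0 ?powR_ge0.
have := hoelder mu mu' mv pc0 p0 pcp.
have LE (r : R) (g : Rn R N -> R) : ('N[mu]_r%:E[EFin \o g] =
    (\int[mu]_y (`|g y| `^ r)%:E) `^ r^-1)%E by rewrite unlock.
rewrite Lnorm1 !LE /=.
have -> : (\int[mu]_y `|(u y * v y)%:E| = aheat t f x)%E.
  apply: ae_eq_integral => //.
  - by apply: measurableT_comp => //; apply/measurable_EFinP; exact: measurable_funM.
  - exact: measurable_aheat_int.
  (* The weights cancel only away from the origin, hence almost everywhere. *)
  apply: filterS ae_enorm_gt0 => y y0 _ /=.
  have -> : u y * v y = heat_kernel t x y * `|f y|.
    rewrite /u /v mulrACA -powRD ?pcp ?oner_eq0// powRr1// powRN.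
    by rewrite mulKf// gt_eqF// powR_gt0.
  by rewrite normrM normr_id (ger0_norm (G0 y)).
congr (_ <= poweR _ _ * poweR _ _)%E; apply: eq_integral => y _.
  rewrite ger0_norm// /u powRM ?powR_ge0// -!powRrM mulVf ?gt_eqF// powRr1//.
  by rewrite mulNr.
by rewrite ger0_norm// /v powRM ?mulr_ge0 ?powR_ge0// -!powRrM mulVf ?gt_eqF// powRr1.
Qed.

End finite_exponent.

(** The hypothesis on [p] and [gamma] is [gamma p' < N] rewritten, so both weight estimates apply
    with [del = gamma p']. Their [1/p']-th powers are the first factor in Hoelder's inequality. *)
Lemma aheat_wmass (p gamma : R) : 1 < p -> 0 < gamma -> p^-1 + gamma / N%:R < 1 ->
  exists C : R, 0 < C /\ forall f, measurable_fun [set: Rn R N] f ->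
  forall t x, 0 < t ->
  (aheat t f x <= (C * t `^ (- (gamma / 2)))%:E * wmass p gamma t f x `^ p^-1)%E /\
  ((enorm x `^ gamma)%:E * aheat t f x <= C%:E * wmass p gamma t f x `^ p^-1)%E.
Proof.
move=> p1 g0 pg; pose pc := p / (p - 1).
have p0 : 0 < p by exact: lt_trans p1.
have pm0 : 0 < p - 1 by rewrite subr_gt0.
have pc0 : 0 < pc by rewrite divr_gt0.
have pcV : pc^-1 = 1 - p^-1 by rewrite /pc; field; rewrite !lt0r_neq0.
have pcV0 : 0 < pc^-1 by rewrite invr_gt0.
have N0' : (0 : R) < N%:R by rewrite ltr0n.
have gpc0 : 0 < gamma * pc by exact: mulr_gt0.
have gpcN : gamma * pc < N%:R.
  rewrite -[ltRHS]mul1r -ltr_pdivrMr// mulrAC -ltr_pdivlMr// mul1r pcV.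
  by move: pg; lra.
have [C1 [C10 H1]] := heat_kernel_weight_sup gpc0 gpcN.
have [C2 [C20 H2]] := heat_kernel_weight_pt gpc0 gpcN.
exists (C1 `^ pc^-1 + C2 `^ pc^-1); split; first by rewrite addr_gt0 ?powR_gt0.
move=> f mf t x t0.
have h := aheat_hoelder gamma p1 mf x t0.
set Phi := (\int[mu]_y _)%E in h.
have Phi0 : (0 <= Phi)%E.
  by apply: integral_ge0 => y _; rewrite lee_fin mulr_ge0 ?heat_kernel_ge0 ?powR_ge0.
have Phii : (0 <= Phi <= +oo)%E by rewrite Phi0 leey.
have W0 : (0 <= wmass p gamma t f x `^ p^-1)%E by exact: poweR_ge0.
split; apply: (le_trans (_ : (_ <= _)%E)).
- exact: h.
- apply: lee_wpmul2r => //.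
  apply: (@le_trans _ _ ((C1 * t `^ (- (gamma * pc / 2)))%:E `^ pc^-1)%E).
    apply: gt0_ler_poweR; rewrite ?(ltW pcV0)//.
      by rewrite in_itv/= leey lee_fin mulr_ge0 ?powR_ge0 ?(ltW C10).
    exact: H1.
  rewrite poweR_EFin lee_fin powRM ?powR_ge0 ?(ltW C10)// -powRrM.
  rewrite (_ : - (gamma * pc / 2) * pc^-1 = - (gamma / 2)); last first.
    by field; rewrite lt0r_neq0.
  by rewrite ler_wpM2r ?powR_ge0// lerDl powR_ge0.
- by apply: lee_wpmul2l; [rewrite lee_fin powR_ge0|exact: h].
- rewrite muleA; apply: lee_wpmul2r => //.
  rewrite (_ : (enorm x `^ gamma)%:E = ((enorm x `^ (gamma * pc))%:E `^ pc^-1)%E); last first.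
    by rewrite poweR_EFin -powRrM mulfK ?gt_eqF.
  rewrite -poweRM ?lee_fin ?powR_ge0//.
  apply: (@le_trans _ _ (C2%:E `^ pc^-1)%E); last first.
    by rewrite poweR_EFin lee_fin lerDr powR_ge0.
  apply: gt0_ler_poweR; rewrite ?(ltW pcV0)//.
  + by rewrite in_itv/= leey andbT mule_ge0// lee_fin powR_ge0.
  + by rewrite in_itv/= leey lee_fin (ltW C20).
  rewrite /Phi -ge0_integralZl_EFin ?powR_ge0//.
  + exact: H2.
  + by move=> y _; rewrite lee_fin mulr_ge0 ?heat_kernel_ge0 ?powR_ge0.
  + apply/measurable_EFinP; apply: measurable_funM; first exact: measurable_heat_kernel2.
    by apply: (measurableT_comp (@measurable_powR R _)); exact: measurable_enorm_id.
Qed.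

(* For finite [q] this is Hoelder's inequality with the weight [|y|^(-gamma q')]
   split off: the factor [int G_t(x,y) |y|^(-gamma q') dy] is at most
   [C min(t^(-gamma q'/2), |x|^(-gamma q'))], which yields both bounds. *)
Lemma aheat_bound (q : \bar R) (gamma : R) : (1 < q)%E -> 0 < gamma -> gamma < N%:R ->
  recip q + gamma / N%:R < 1 ->
  exists C : R, 0 < C /\ forall f, Lqw q gamma f -> forall t, 0 < t ->
  (forall x, aheat t f x <= (C * t `^ (- (N%:R / 2 * recip q + gamma / 2)) *
     fine (wnorm q gamma (EFin \o f)))%:E)%E /\
  (wnorm q gamma (aheat t f) <= (C * fine (wnorm q gamma (EFin \o f)))%:E)%E.
Proof.
move=> q1 g0 gN qg; case: q q1 qg => [p|_ _|//].
  rewrite lte_fin => p1; have p0 : 0 < p by exact: lt_trans p1.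
  have pV0 : 0 < p^-1 by rewrite invr_gt0.
  rewrite recip_fin ?gt_eqF// => pg.
  have [C [C0 H]] := aheat_wmass p1 g0 pg; exists C; split=> // f [mf fK] t t0.
  set K := fine _; have KE : wnorm p%:E gamma (EFin \o f) = K%:E.
    by rewrite fineK// ge0_fin_numE// wnorm_ge0.
  have KI := KE; rewrite wnorm_EFin in KI.
  have mW : measurable_fun [set: Rn R N] (wmass p gamma t f).
    pose F (z : Rn R N * Rn R N) : \bar R :=
      (heat_kernel t z.1 z.2 * (enorm z.2 `^ gamma * `|f z.2|) `^ p)%:E.
    apply: (measurable_fun_fubini_tonelli_F (m2 := mu) F).
      apply/measurable_EFinP; apply: measurable_funM; first exact: measurable_heat_kernel.
      apply: (measurableT_comp (@measurable_powR R _)).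
      apply: (measurableT_comp (f := fun y => enorm y `^ gamma * `|f y|)) => //.
      by apply: measurable_weightr; exact: measurableT_comp.
    by move=> z; rewrite lee_fin mulr_ge0 ?heat_kernel_ge0 ?powR_ge0.
  have I0 : (0 <= \int[mu]_y ((enorm y `^ gamma * `|f y|) `^ p)%:E)%E.
    by apply: integral_ge0 => y _; rewrite lee_fin powR_ge0.
  split=> [x|].
    have [h _] := H f mf t x t0; apply: (le_trans h).
    apply: (@le_trans _ _ ((C * t `^ (- (gamma / 2)))%:E *
        ((t `^ (- (N%:R / 2)))%:E `^ p^-1 * K%:E))%E).
      apply: lee_wpmul2l; first by rewrite lee_fin mulr_ge0 ?powR_ge0 ?(ltW C0).
      rewrite -KI -poweRM ?lee_fin ?powR_ge0//.
      apply: gt0_ler_poweR; rewrite ?(ltW pV0)//; last exact: wmass_le.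
      - by rewrite in_itv/= leey andbT wmass_ge0.
      - by rewrite in_itv/= leey andbT mule_ge0// lee_fin powR_ge0.
    rewrite poweR_EFin -!EFinM lee_fin -powRrM le_eqVlt; apply/orP; left; apply/eqP.
    rewrite opprD powRD ?lt0r_neq0 ?implybT//.
    by rewrite (_ : - (N%:R / 2 * p^-1) = - (N%:R / 2) / p); [ring|rewrite mulNr].
  rewrite wnormE.
  (* Conservation of mass for [wmass]: the pointwise bound integrates to a norm bound with no power
     of [t]. *)
  have -> : (C * K)%:E = (((C `^ p)%:E * \int[mu]_x wmass p gamma t f x) `^ p^-1)%E.
    rewrite poweRM ?lee_fin ?powR_ge0//; last by apply: integral_ge0 => x _; exact: wmass_ge0.
    by rewrite integral_wmass// KI poweR_EFin -powRrM mulfV ?gt_eqF// powRr1 ?(ltW C0).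
  apply: gt0_ler_poweR; rewrite ?(ltW pV0)//.
  - by rewrite in_itv/= leey andbT; apply: integral_ge0 => x _; exact: poweR_ge0.
  - rewrite in_itv/= leey andbT mule_ge0 ?lee_fin ?powR_ge0//.
    by apply: integral_ge0 => x _; exact: wmass_ge0.
  rewrite -ge0_integralZl_EFin ?powR_ge0//; last by move=> x _; exact: wmass_ge0.
  apply: ge0_le_integral => //.
  - by move=> x _; exact: poweR_ge0.
  - apply: (measurableT_comp (measurable_poweR _)); apply: measurableT_comp => //.
    by apply: measurable_weight; exact: measurable_aheatx.
  - exact: measurable_funeM.
  move=> x _; have [_ h] := H f mf t x t0.
  rewrite gee0_abs; last by rewrite mule_ge0 ?aheat_ge0// lee_fin powR_ge0.
  apply: (@le_trans _ _ ((C%:E * wmass p gamma t f x `^ p^-1) `^ p)%E).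
    apply: gt0_ler_poweR => //; rewrite ?(ltW p0) ?in_itv/= ?leey ?andbT//.
    - by rewrite mule_ge0 ?aheat_ge0// lee_fin powR_ge0.
    - by rewrite mule_ge0 ?poweR_ge0// lee_fin (ltW C0).
  rewrite poweRM ?poweR_ge0 ?lee_fin ?(ltW C0)//.
  by rewrite -poweRrM mulVf ?gt_eqF// poweRe1 ?wmass_ge0.
(* The case [q = +oo]: the norm bounds [|f|] by [K |y|^(- gamma)] almost everywhere, so the weight
   estimates apply directly with [del = gamma], without Hoelder's inequality. *)
rewrite recipy mulr0 add0r.
have [C1 [C10 H1]] := heat_kernel_weight_sup g0 gN.
have [C2 [C20 H2]] := heat_kernel_weight_pt g0 gN.
exists (C1 + C2); split; first by rewrite addr_gt0.
move=> f [mf fK] t t0.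
set K := fine _; have KE : wnorm +oo gamma (EFin \o f) = K%:E.
  by rewrite fineK// ge0_fin_numE// wnorm_ge0.
have K0 : 0 <= K by rewrite -lee_fin -KE wnorm_ge0.
have fae : {ae mu, forall y, `|f y| <= K * enorm y `^ (- gamma)}.
  have h1 := ess_sup_ge mu (fun x => `|(enorm x `^ gamma)%:E * (EFin \o f) x|%E).
  rewrite -wnormyE KE in h1.
  apply: filterS2 h1 ae_enorm_gt0 => y /= h y0; move: h; rewrite lee_fin normrM.
  rewrite ger0_norm ?powR_ge0// => h.
  by rewrite powRN ler_pdivlMr ?powR_gt0// mulrC.
have mw : measurable_fun [set: Rn R N] (fun y => enorm y `^ (- gamma)).
  by apply: (measurableT_comp (@measurable_powR R _)); exact: measurable_enorm_id.
have hA x : (aheat t f x <=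
    K%:E * \int[mu]_y (heat_kernel t x y * enorm y `^ (- gamma))%:E)%E.
  rewrite -ge0_integralZl_EFin//; last 2 first.
  - by move=> y _; rewrite lee_fin mulr_ge0 ?heat_kernel_ge0 ?powR_ge0.
  - by apply/measurable_EFinP; apply: measurable_funM => //; exact: measurable_heat_kernel2.
  apply: ae_ge0_le_integral => //.
  - by move=> y _; rewrite lee_fin mulr_ge0 ?heat_kernel_ge0.
  - exact: measurable_aheat_int.
  - by move=> y _; rewrite -EFinM lee_fin mulr_ge0// mulr_ge0 ?heat_kernel_ge0 ?powR_ge0.
  - apply/measurable_EFinP; apply: measurable_funM => //.
    by apply: measurable_funM => //; exact: measurable_heat_kernel2.
  apply: filterS fae => y h _; rewrite -EFinM lee_fin mulrCA.
  by rewrite ler_wpM2l ?heat_kernel_ge0.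
split=> [x|].
  apply: (le_trans (hA x)).
  apply: (@le_trans _ _ (K%:E * (C1 * t `^ (- (gamma / 2)))%:E)%E).
    by apply: lee_wpmul2l; rewrite ?lee_fin//; exact: H1.
  rewrite -EFinM lee_fin mulrC ler_wpM2r// ler_wpM2r ?powR_ge0//.
  by rewrite lerDl ltW.
rewrite wnormyE; apply/ess_supP; apply: nearW => x.
rewrite gee0_abs; last by rewrite mule_ge0 ?aheat_ge0// lee_fin powR_ge0.
apply: (le_trans (lee_wpmul2l _ (hA x))); first by rewrite lee_fin powR_ge0.
rewrite muleCA -ge0_integralZl_EFin ?powR_ge0//; last 2 first.
- by move=> y _; rewrite lee_fin mulr_ge0 ?heat_kernel_ge0 ?powR_ge0.
- by apply/measurable_EFinP; apply: measurable_funM => //; exact: measurable_heat_kernel2.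
apply: (@le_trans _ _ (K%:E * C2%:E)%E).
  by apply: lee_wpmul2l; rewrite ?lee_fin//; exact: H2.
by rewrite -EFinM lee_fin mulrC ler_wpM2r// lerDr ltW.
Qed.

(** For [q = p] finite and [r = (alpha + 1) p] one has [nu r = gamma p] and [r = alpha p + p]: the
    weighted [r]-th power is the weighted [p]-th power times [|v|^(alpha p)], and the last factor is
    at most [B^(alpha p)]. This gives the bound in L^r_nu that the solution class requires. *)
Lemma wnorm_interpolation (q : \bar R) (alpha gamma B K : R) (v : Rn R N -> R) :
  (1 < q)%E -> 0 < alpha -> 0 <= B -> 0 <= K -> measurable_fun [set: Rn R N] v ->
  (forall x, `|v x| <= B) -> (wnorm q gamma (EFin \o v) <= K%:E)%E ->
  (wnorm (r_exp alpha q) (nu_exp alpha gamma) (EFin \o v) <=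
   (B `^ (alpha / (alpha + 1)) * K `^ (alpha + 1)^-1)%:E)%E.
Proof.
move=> q1 a0 B0 K0 mv vB vK.
have a1 : 0 < alpha + 1 by rewrite addr_gt0.
have a1V : 0 < (alpha + 1)^-1 by rewrite invr_gt0.
case: q q1 vK => [p|_|//].
  rewrite lte_fin => p1; have p0 : 0 < p by exact: lt_trans p1.
  rewrite /r_exp -EFinM !wnorm_EFin => vK.
  set r := (alpha + 1) * p; have r0 : 0 < r by rewrite mulr_gt0.
  set I := (\int[mu]_y _)%E in vK.
  have I0 : (0 <= I)%E by apply: integral_ge0 => y _; rewrite lee_fin powR_ge0.
  have -> : (B `^ (alpha / (alpha + 1)) * K `^ (alpha + 1)^-1)%:E =
     (((B `^ (alpha * p))%:E * (K%:E `^ p)) `^ r^-1)%E.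
    rewrite poweRM ?poweR_ge0 ?lee_fin ?powR_ge0// !poweR_EFin -!powRrM EFinM.
    congr (_%:E * _%:E)%E; congr powR.
      by rewrite /r; field; rewrite !lt0r_neq0.
    by rewrite /r; field; rewrite !lt0r_neq0.
  have mw g : measurable_fun [set: Rn R N] (fun y => enorm y `^ g * `|v y|).
    by apply: measurable_weightr; exact: measurableT_comp.
  apply: gt0_ler_poweR; rewrite ?invr_ge0 ?(ltW r0)//.
  - rewrite in_itv/= leey andbT; apply: integral_ge0 => y _.
    by rewrite lee_fin powR_ge0.
  - by rewrite in_itv/= leey andbT mule_ge0 ?poweR_ge0// lee_fin powR_ge0.
  apply: (@le_trans _ _ ((B `^ (alpha * p))%:E * I)%E); last first.
    apply: lee_wpmul2l; first by rewrite lee_fin powR_ge0.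
    have -> : I = ((I `^ p^-1) `^ p)%E by rewrite -poweRrM mulVf ?gt_eqF// poweRe1.
    apply: gt0_ler_poweR; rewrite ?(ltW p0)//.
    + by rewrite in_itv/= leey andbT poweR_ge0.
    + by rewrite in_itv/= leey andbT lee_fin.
  rewrite -ge0_integralZl_EFin ?powR_ge0//; last 2 first.
  - by move=> y _; rewrite lee_fin powR_ge0.
  - apply/measurable_EFinP; apply: (measurableT_comp (@measurable_powR R _)); exact: mw.
  apply: ge0_le_integral => //.
  - by move=> y _; rewrite lee_fin powR_ge0.
  - apply/measurable_EFinP; apply: (measurableT_comp (@measurable_powR R _)); exact: mw.
  - apply/measurable_EFinP; apply: measurable_funM => //.
    by apply: (measurableT_comp (@measurable_powR R _)); exact: mw.
  move=> y _; rewrite -EFinM lee_fin !powRM ?powR_ge0// -!powRrM.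
  rewrite (_ : nu_exp alpha gamma * r = gamma * p); last first.
    by rewrite /nu_exp /r; field; rewrite lt0r_neq0.
  rewrite [leRHS]mulrCA ler_wpM2l ?powR_ge0//.
  rewrite (_ : r = alpha * p + p); last by rewrite /r; ring.
  have ap0 : 0 < alpha * p by rewrite mulr_gt0.
  rewrite powRD; last by rewrite gt_eqF ?addr_gt0.
  by rewrite ler_wpM2r ?powR_ge0// ge0_ler_powR ?nnegrE ?(ltW ap0).
(* For [q = +oo] also [r = +oo], and the interpolation is pointwise: the power [1 / (alpha + 1)] of
   [|v|] takes the weight, the remaining power is bounded by [B]. *)
rewrite /r_exp gt0_muley ?lte_fin// !wnormyE => vK.
apply/ess_supP; apply: filterS (ess_sup_ge mu _) => x /= h.
have {}h := le_trans h vK; move: h; rewrite !lee_fin !normrM !(ger0_norm (powR_ge0 _ _)) => h.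
have {1}-> : `|v x| = `|v x| `^ (alpha / (alpha + 1)) * `|v x| `^ (alpha + 1)^-1.
  rewrite -powRD; last by rewrite gt_eqF// addr_gt0// divr_gt0.
  by rewrite (_ : _ + _ = 1) ?powRr1//; field; rewrite lt0r_neq0.
rewrite mulrCA; apply: ler_pM; rewrite ?mulr_ge0 ?powR_ge0//.
  by rewrite ge0_ler_powR ?nnegrE// divr_ge0// ltW.
rewrite /nu_exp powRrM -powRM ?powR_ge0// ge0_ler_powR ?nnegrE ?(ltW a1V)//.
by rewrite mulr_ge0 ?powR_ge0.
Qed.

End lqw.

(** * The Duhamel term *)

Section nonlinearity.
Context {R : realType}.
Implicit Types (alpha u v : R).

Lemma power_nonlinearityN alpha u : power_nonlinearity alpha (- u) = - power_nonlinearity alpha u.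
Proof. by rewrite /power_nonlinearity normrN mulrN. Qed.

Lemma bernoulli_1BX (x : R) n : 0 <= x <= 1 -> 1 - x ^+ n <= n%:R * (1 - x).
Proof.
move=> /andP[x0 x1]; elim: n => [|n IH]; first by rewrite expr0 subrr mul0r.
rewrite exprS -natr1; have : x ^+ n <= 1 by rewrite exprn_ile1.
have : 0 <= x ^+ n by rewrite exprn_ge0.
set X := x ^+ n in IH *; move=> X0 X1; nra.
Qed.

(** By symmetry [|v| <= u]. If [v >= 0], put [z = v / u] and take an integer [n >= alpha + 1]: then
    [1 - z^(alpha + 1) <= 1 - z^n <= n (1 - z)], which spares the derivative and provides the
    constant. If [v < 0], nothing cancels and each power is at most [m^alpha]; here [L >= 1] is
    used. *)
Lemma power_nonlinearity_lip alpha : 0 < alpha -> exists L : R, 1 <= L /\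
  forall m u v, `|u| <= m -> `|v| <= m ->
  `|power_nonlinearity alpha u - power_nonlinearity alpha v| <= L * m `^ alpha * `|u - v|.
Proof.
move=> a0; have a1 : 0 < alpha + 1 by rewrite addr_gt0.
pose n := Num.bound (alpha + 1).
have an : alpha + 1 < n%:R by rewrite /n archi_boundP// ltW.
exists n%:R; have n1 : (1 : R) <= n%:R.
  by rewrite (le_trans _ (ltW an))// lerDr ltW.
split=> // m.
suff H u v : 0 <= u -> `|v| <= u -> u <= m ->
    `|power_nonlinearity alpha u - power_nonlinearity alpha v| <= n%:R * m `^ alpha * `|u - v|.
  have H' u v : `|v| <= `|u| -> `|u| <= m ->
      `|power_nonlinearity alpha u - power_nonlinearity alpha v| <= n%:R * m `^ alpha * `|u - v|.
    have [u0|u0] := leP 0 u.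
      by rewrite {1 2}(ger0_norm u0) => vu um; exact: H.
    rewrite {1 2}(ltr0_norm u0) => vu um.
    have := H (- u) (- v); rewrite oppr_ge0 normrN (ltW u0) !power_nonlinearityN.
    by rewrite -!opprD !normrN; exact.
  move=> u v um vm; have [uv|/ltW uv] := leP `|v| `|u|; first exact: H'.
  by rewrite distrC (distrC u); exact: H'.
move=> u0 vu um; have m0 : 0 <= m by exact: le_trans um.
rewrite /power_nonlinearity (ger0_norm u0).
have [u00|un0] := eqVneq u 0.
  move: vu; rewrite u00 normr_le0 => /eqP ->.
  by rewrite !mulr0 subrr !normr0 mulr0.
have up : 0 < u by rewrite lt_def un0.
have mua : u `^ alpha <= m `^ alpha by rewrite ge0_ler_powR ?nnegrE// ltW.
have [v0|v0] := leP 0 v.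
  rewrite (ger0_norm v0) in vu *.
  have -> : v `^ alpha * v = u `^ alpha * u * (v / u) `^ (alpha + 1).
    have vuE : v = u * (v / u) by rewrite mulrC mulfVK.
    rewrite {1 2}vuE powRM ?divr_ge0// powRD; last by rewrite (gt_eqF a1).
    by rewrite powRr1 ?divr_ge0//; ring.
  have th0 : 0 <= v / u by rewrite divr_ge0.
  have th1 : v / u <= 1 by rewrite ler_pdivrMr// mul1r.
  have hth : (v / u) ^+ n <= (v / u) `^ (alpha + 1).
    have [->|tn0] := eqVneq (v / u) 0.
      rewrite powR0 ?gt_eqF//.
      by rewrite expr0n; case: (n) n1 => //; rewrite ler10.
    by rewrite -powR_mulrn// ger_powR ?(ltW an)// th1 andbT lt_def tn0 th0.
  have hb : 1 - (v / u) `^ (alpha + 1) <= n%:R * (1 - v / u).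
    have th01 : 0 <= v / u <= 1 by rewrite th0.
    by apply: le_trans (bernoulli_1BX n th01); rewrite lerB.
  rewrite -{1}(mulr1 (u `^ alpha * u)) -mulrBr ger0_norm; last first.
    rewrite mulr_ge0 ?mulr_ge0 ?powR_ge0// subr_ge0.
    have : (v / u) `^ (alpha + 1) <= 1 `^ (alpha + 1).
      by rewrite ge0_ler_powR ?nnegrE ?(ltW a1).
    by rewrite powR1.
  rewrite ger0_norm ?subr_ge0//.
  apply: (@le_trans _ _ (u `^ alpha * u * (n%:R * (1 - v / u)))).
    by rewrite ler_wpM2l// mulr_ge0// powR_ge0.
  rewrite [leLHS](_ : _ = n%:R * u `^ alpha * (u - v)); last by field.
  by rewrite ler_wpM2r ?subr_ge0// ler_wpM2l.
rewrite (ltr0_norm v0) in vu *.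
have vm : (- v) `^ alpha <= m `^ alpha.
  by rewrite ge0_ler_powR ?nnegrE ?oppr_ge0 ?(ltW v0) ?(ltW a0)//; exact: le_trans um.
rewrite !ger0_norm ?subr_ge0; last 2 first.
- exact: le_trans (ltW v0) u0.
- by apply: (@le_trans _ _ 0); rewrite ?mulr_ge0 ?powR_ge0// mulr_ge0_le0 ?powR_ge0// ltW.
apply: (@le_trans _ _ (m `^ alpha * (u - v))).
  rewrite mulrBr -!mulrN lerD ?ler_wpM2r ?oppr_ge0//; exact: ltW.
by rewrite ler_wpM2r ?subr_ge0 ?(le_trans (ltW v0))// ler_peMl ?powR_ge0.
Qed.

Lemma power_nonlinearity0 alpha : power_nonlinearity alpha 0 = 0.
Proof. by rewrite /power_nonlinearity mulr0. Qed.

Lemma measurable_power_nonlinearity d (T : measurableType d) alpha (u : T -> R) :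
  measurable_fun [set: T] u -> measurable_fun [set: T] (power_nonlinearity alpha \o u).
Proof.
move=> mu; apply: measurable_funM => //.
by apply: (measurableT_comp (@measurable_powR R _)); exact: measurableT_comp.
Qed.

(* [v n - 2 2^-n B] increases, [v n + 2 2^-n B] decreases, and their common limit is [l]. *)
Lemma geometric_limit (v : nat -> R) (B : R) :
  (forall n, `|v n.+1 - v n| <= 2 ^- n * B) ->
  exists l, forall n, `|v n - l| <= 2 * (2 ^- n * B).
Proof.
move=> H.
pose e n : R := 2 ^- n * B.
have e0 n : 0 <= e n by exact: le_trans (H n).
have eS n : e n = 2 * e n.+1.
  by rewrite /e exprS invfM mulrA mulrA mulfV ?mul1r// pnatr_eq0.
have lo n : v n - 2 * e n <= v n.+1 - 2 * e n.+1.
  by have := H n; rewrite -/(e n) ler_norml -eS => /andP[]; have := eS n; lra.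
have hi n : v n.+1 + 2 * e n.+1 <= v n + 2 * e n.
  by have := H n; rewrite -/(e n) ler_norml -eS => /andP[]; have := eS n; lra.
have lom n k : v n - 2 * e n <= v (n + k)%N - 2 * e (n + k)%N.
  by elim: k => [|k IH]; rewrite ?addn0// addnS (le_trans IH).
have him n k : v (n + k)%N + 2 * e (n + k)%N <= v n + 2 * e n.
  by elim: k => [|k IH]; rewrite ?addn0// addnS (le_trans _ IH).
have lohi n m : v n - 2 * e n <= v m + 2 * e m.
  apply: (le_trans (lom n m)); rewrite addnC; apply: le_trans (him m n).
  by have := e0 (m + n)%N; lra.
pose S := [set v n - 2 * e n | n in [set: nat]].
have S0 : S !=set0 by exists (v 0%N - 2 * e 0%N), 0%N.
have Sub m : ubound S (v m + 2 * e m) by move=> _ [n _ <-].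
exists (sup S) => n; rewrite ler_distl; apply/andP; split.
  by have := ge_sup S0 (Sub n); rewrite -/(e n); lra.
have : v n - 2 * e n <= sup S.
  by apply: ub_le_sup; [exists (v 0%N + 2 * e 0%N)|exists n].
by rewrite -/(e n); lra.
Qed.

Lemma measurable_param_integral d1 d2 (T1 : measurableType d1) (T2 : measurableType d2)
    (m : {sigma_finite_measure set T2 -> \bar R}) (F : T1 * T2 -> \bar R) :
  measurable_fun [set: T1 * T2] F ->
  measurable_fun [set: T1] (fun x => \int[m]_y F (x, y))%E.
Proof.
move=> mF.
under eq_fun do rewrite integralE.
apply: emeasurable_funB.
- have := @measurable_fun_fubini_tonelli_F _ _ _ _ _ m _ (measurable_funepos mF) (funepos_ge0 _).
  by apply: eq_measurable_fun => x _; apply: eq_integral => y _; rewrite !funeposE.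
- have := @measurable_fun_fubini_tonelli_F _ _ _ _ _ m _ (measurable_funeneg mF) (funeneg_ge0 _).
  by apply: eq_measurable_fun => x _; apply: eq_integral => y _; rewrite !funenegE.
Qed.

Lemma measurable_param_integral2 d1 d2 d3 (T1 : measurableType d1)
    (A : measurableType d2) (B : measurableType d3)
    (m1 : {sigma_finite_measure set A -> \bar R})
    (m2 : {sigma_finite_measure set B -> \bar R}) (F : T1 * (A * B) -> \bar R) :
  measurable_fun [set: T1 * (A * B)] F ->
  measurable_fun [set: T1] (fun x => \int[m1 \x m2]_z F (x, z))%E.
Proof.
have H (G : T1 * (A * B) -> \bar R) : (forall w, 0 <= G w)%E ->
    measurable_fun [set: T1 * (A * B)] G ->
    measurable_fun [set: T1] (fun x => \int[m1 \x m2]_z G (x, z))%E.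
  move=> G0 mG.
  (* Reassociating the triple product allows the two variables to be integrated out one at a
     time. *)
  have mG' : measurable_fun [set: (T1 * A) * B]
      (fun w : (T1 * A) * B => G (w.1.1, (w.1.2, w.2))).
    apply: (measurableT_comp mG); apply: measurable_fun_pair.
      exact: (measurableT_comp measurable_fst measurable_fst).
    apply: measurable_fun_pair; last exact: measurable_snd.
    exact: (measurableT_comp measurable_snd measurable_fst).
  have h1 := @measurable_fun_fubini_tonelli_F _ _ _ _ _ m2 _ mG' (fun w => G0 _).
  have h := @measurable_fun_fubini_tonelli_F _ _ _ _ _ m1 _ h1
    (fun w => integral_ge0 _ (fun y _ => G0 _)).
  apply: eq_measurable_fun h => x _.
  rewrite fubini_tonelli1//; exact: measurable_fun_pair2 mG.
move=> mF; under eq_fun do rewrite integralE.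
apply: emeasurable_funB.
- have := H _ (funepos_ge0 _) (measurable_funepos mF).
  by apply: eq_measurable_fun => x _; apply: eq_integral => y _; rewrite !funeposE.
- have := H _ (funeneg_ge0 _) (measurable_funeneg mF).
  by apply: eq_measurable_fun => x _; apply: eq_integral => y _; rewrite !funenegE.
Qed.

End nonlinearity.

Section duhamel_kernel.
Context {R : realType} {N : nat}.
Local Notation leb := (@lebesgue_measure R).
Local Notation mu := (@lebesgue_Rn R N).
Local Notation Z := (measurableTypeR R * Rn R N)%type.
Local Notation muZ := (product_measure1 leb mu).
Implicit Types (s t : R) (x y : Rn R N) (F : Z -> R).

(** The kernel of the Duhamel term, extended by 0 to all of space-time. The domain of integration
    then no longer depends on [t], so that values at different times can be subtracted under one
    integral. *)
Definition kern t x (z : Z) : R :=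
  if (0 < z.1) && (z.1 < t) then heat_kernel (t - z.1) x z.2 else 0.

Lemma kern_ge0 t x z : 0 <= kern t x z.
Proof. by rewrite /kern; case: ifP => // _; exact: heat_kernel_ge0. Qed.

Lemma measurable_kern2 : measurable_fun [set: Z * Z] (fun w => kern w.1.1 w.1.2 w.2).
Proof.
have m1 : measurable_fun [set: Z * Z] (fun w => w.1.1 : R).
  by apply: (measurableT_comp measurable_fst); exact: measurable_fst.
have m2 : measurable_fun [set: Z * Z] (fun w => w.2.1 : R).
  by apply: (measurableT_comp measurable_fst); exact: measurable_snd.
apply: measurable_fun_ifT.
- apply: measurable_and; apply: measurable_fun_ltr => //; exact: measurable_cst.
- apply: measurable_heat_kernel.
  + exact: measurable_funB.
  + by apply: (measurableT_comp measurable_snd); exact: measurable_fst.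
  + by apply: (measurableT_comp measurable_snd); exact: measurable_snd.
- exact: measurable_cst.
Qed.

Lemma measurable_kern t x : measurable_fun [set: Z] (kern t x).
Proof. have h : measurable_fun [set: Z] (fun z : Z => ((t, x) : Z, z)).
  by apply: measurable_fun_pair; [exact: measurable_cst|exact: measurable_id].
exact: (measurableT_comp measurable_kern2 h). Qed.

(** The Duhamel term of [|F|]. Its finiteness is the absolute convergence under which [kernD] is
    finite and agrees with the iterated integral of [duhamel]. *)
Definition kernA t x F : \bar R := (\int[muZ]_z (kern t x z * `|F z|)%:E)%E.

Definition kernD t x F : \bar R := (\int[muZ]_z (kern t x z * F z)%:E)%E.

Lemma measurable_kernD F : measurable_fun [set: Z] F ->
  measurable_fun [set: Z] (fun z => kernD z.1 z.2 F).
Proof.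
move=> mF.
have h : measurable_fun [set: Z * Z] (fun w => (kern w.1.1 w.1.2 w.2 * F w.2)%:E).
  apply/measurable_EFinP; apply: measurable_funM; first exact: measurable_kern2.
  exact: (measurableT_comp mF).
have := measurable_param_integral2 leb mu h.
by apply: eq_measurable_fun => -[t x] _.
Qed.

Variable F : Z -> R.
Hypothesis mF : measurable_fun [set: Z] F.

Let mFs s : measurable_fun [set: Rn R N] (fun y => F (s, y)).
Proof. exact: measurable_fun_pair2 mF. Qed.

Let mkF t x : measurable_fun [set: Z] (fun z => (kern t x z * F z)%:E).
Proof. by apply/measurable_EFinP; apply: measurable_funM => //; exact: measurable_kern. Qed.

Lemma kernAE t x :
  kernA t x F = (\int[leb]_(s in `]0%R, t[) aheat (t - s) (fun y => F (s, y)) x)%E.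
Proof.
rewrite /kernA fubini_tonelli1.
- rewrite [RHS]integral_mkcond; apply: eq_integral => s _.
  rewrite patchE /fubini_F /kern/= mem_setE in_itv/=; case: ifP => // _.
  by rewrite integral0_eq// => y _; rewrite mul0r.
- apply/measurable_EFinP; apply: measurable_funM; first exact: measurable_kern.
  exact: measurableT_comp.
- by move=> z; rewrite lee_fin mulr_ge0 ?kern_ge0.
Qed.

Lemma integrable_kern t x : (kernA t x F < +oo)%E ->
  (muZ).-integrable [set: Z] (fun z => (kern t x z * F z)%:E).
Proof.
move=> h; apply/integrableP; split; first exact: mkF.
apply: le_lt_trans h; rewrite le_eqVlt; apply/orP; left; apply/eqP.
by apply: eq_integral => z _; rewrite /= normrM (ger0_norm (kern_ge0 _ _ _)).
Qed.

Lemma kernDE t x : (kernA t x F < +oo)%E ->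
  kernD t x F = (\int[leb]_(s in `]0%R, t[) heat (t - s) (fun y => F (s, y)) x)%E.
Proof.
move=> h; rewrite /kernD -integral12_prod_meas1; last exact: integrable_kern.
rewrite [RHS]integral_mkcond; apply: eq_integral => s _.
rewrite patchE /fubini_F /kern/= mem_setE in_itv/=; case: ifP => // _.
by rewrite integral0_eq// => y _; rewrite mul0r.
Qed.

Lemma abse_kernD_le t x : (`|kernD t x F| <= kernA t x F)%E.
Proof.
apply: (le_trans (le_abse_integral _ _ _)) => //.
rewrite le_eqVlt; apply/orP; left; apply/eqP.
by apply: eq_integral => z _; rewrite /= normrM (ger0_norm (kern_ge0 _ _ _)).
Qed.

Lemma kernD_fin t x : (kernA t x F < +oo)%E -> kernD t x F \is a fin_num.
Proof.
move=> h; rewrite fin_num_abs; exact: le_lt_trans (abse_kernD_le _ _) h.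
Qed.

End duhamel_kernel.

Section duhamel_difference.
Context {R : realType} {N : nat}.
Local Notation Z := (measurableTypeR R * Rn R N)%type.

Lemma kernD_sub_le (F1 F2 : Z -> R) (t : R) (x : Rn R N) :
  measurable_fun [set: Z] F1 -> measurable_fun [set: Z] F2 ->
  (kernA t x F1 < +oo)%E -> (kernA t x F2 < +oo)%E ->
  (`|fine (kernD t x F1) - fine (kernD t x F2)|%:E <=
   kernA t x (fun z => F1 z - F2 z)%R)%E.
Proof.
move=> m1 m2 h1 h2.
have m12 : measurable_fun [set: Z] (fun z => F1 z - F2 z) by exact: measurable_funB.
apply: le_trans (abse_kernD_le m12 t x).
rewrite -abse_EFin EFinB !fineK ?kernD_fin//.
rewrite /kernD -integralB_EFin//; try exact: integrable_kern.
rewrite le_eqVlt; apply/orP; left; apply/eqP; congr (`|_|)%E.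
by apply: eq_integral => z _; rewrite mulrBr.
Qed.

End duhamel_difference.

(** * Picard iteration *)

Section fixed_point.
Context {R : realType} {N : nat}.
Local Notation leb := (@lebesgue_measure R).
Local Notation mu := (@lebesgue_Rn R N).
Local Notation Z := (measurableTypeR R * Rn R N)%type.
Implicit Types (s t : R) (x y : Rn R N) (u v F : Z -> R).

Variables (alpha a b A L Ca T : R) (f : Rn R N -> R).
Hypotheses (alpha0 : 0 < alpha) (aE : a = alpha * b) (a1 : a < 1).
Hypotheses (A0 : 0 <= A) (L1 : 1 <= L) (Ca0 : 0 < Ca) (T0 : 0 < T).
Hypothesis mf : measurable_fun [set: Rn R N] f.
Hypothesis fA : forall t x, 0 < t -> (aheat t f x <= (A * t `^ (- b))%:E)%E.
Hypothesis HL : forall m v w : R, `|v| <= m -> `|w| <= m ->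
  `|power_nonlinearity alpha v - power_nonlinearity alpha w| <= L * m `^ alpha * `|v - w|.
Hypothesis HCa : forall t, 0 < t ->
  (\int[leb]_(s in `]0%R, t[) (s `^ (- a))%:E <= (Ca * t `^ (1 - a))%:E)%E.

(** The profile h as a real function on space-time. By [aheatE], [fine] loses nothing at positive
    times. *)
Definition hprof (z : Z) : R := fine (aheat z.1 f z.2).

Local Notation P := hprof.

Lemma hprof_ge0 z : 0 <= P z.
Proof. by rewrite fine_ge0// aheat_ge0. Qed.

Lemma aheatE t x : 0 < t -> aheat t f x = (P (t, x))%:E.
Proof.
move=> t0; rewrite fineK// ge0_fin_numE ?aheat_ge0//.
by apply: le_lt_trans (fA x t0) _; rewrite ltry.
Qed.

Lemma hprof_le t x : 0 < t -> P (t, x) <= A * t `^ (- b).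
Proof. by move=> t0; rewrite -lee_fin -aheatE//; exact: fA. Qed.

Lemma abse_heat_le t x : (`|heat t f x| <= aheat t f x)%E.
Proof.
apply: (le_trans (le_abse_integral _ _ _)) => //.
  by apply/measurable_EFinP; apply: measurable_funM => //; exact: measurable_heat_kernel2.
rewrite le_eqVlt; apply/orP; left; apply/eqP.
by apply: eq_integral => z _; rewrite /= normrM (ger0_norm (heat_kernel_ge0 _ _ _)).
Qed.

Lemma heat_fin t x : 0 < t -> heat t f x \is a fin_num.
Proof.
move=> t0; rewrite fin_num_abs; apply: le_lt_trans (abse_heat_le _ _) _.
by rewrite aheatE// ltry.
Qed.

Lemma fine_heat_le t x : 0 < t -> `|fine (heat t f x)| <= P (t, x).
Proof.
move=> t0; rewrite -lee_fin -aheatE// -abse_EFin fineK ?heat_fin//.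
exact: abse_heat_le.
Qed.

Lemma measurable_heat : measurable_fun [set: Z] (fun z => heat z.1 f z.2).
Proof.
have h : measurable_fun [set: Z * Rn R N] (fun w => (heat_kernel w.1.1 w.1.2 w.2 * f w.2)%:E).
  apply/measurable_EFinP; apply: measurable_funM; last exact: (measurableT_comp mf).
  apply: measurable_heat_kernel => //.
  - by apply: (measurableT_comp measurable_fst); exact: measurable_fst.
  - by apply: (measurableT_comp measurable_snd); exact: measurable_fst.
exact: measurable_param_integral mu _ h.
Qed.

(** By positivity of the kernel, a bound by the profile at time [s] is propagated by the flow, and
    the semigroup law identifies the propagated profile. *)
Lemma aheat_profile_le (g : Rn R N -> R) (c : R) s t x : measurable_fun [set: Rn R N] g ->
  0 <= c -> 0 < t -> 0 < s -> (forall y, `|g y| <= c * P (s, y)) ->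
  (aheat t g x <= (c * P (t + s, x))%:E)%E.
Proof.
move=> mg c0 t0 s0 Hg.
rewrite EFinM -aheatE ?addr_gt0// -(aheat_semigroup mf x t0 s0).
rewrite -ge0_integralZl_EFin//; last 2 first.
- by move=> y _; rewrite mule_ge0 ?aheat_ge0// lee_fin heat_kernel_ge0.
- apply: emeasurable_funM; last exact: measurable_aheatx.
  by apply/measurable_EFinP; exact: measurable_heat_kernel2.
apply: ge0_le_integral => //.
- by move=> y _; rewrite lee_fin mulr_ge0 ?heat_kernel_ge0.
- exact: measurable_aheat_int.
- apply: measurable_funeM; apply: emeasurable_funM; last exact: measurable_aheatx.
  by apply/measurable_EFinP; exact: measurable_heat_kernel2.
by move=> y _; rewrite aheatE// -!EFinM lee_fin mulrCA ler_wpM2l ?heat_kernel_ge0// Hg.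
Qed.

(* Chapman-Kolmogorov turns [int_0^t e^((t-s)Delta) (c s^-a h(s)) ds] into
   [(c int_0^t s^-a ds) h(t)]. *)
Lemma kernA_le F (c : R) t x : measurable_fun [set: Z] F -> 0 <= c -> 0 < t <= T ->
  (forall s y, 0 < s <= T -> `|F (s, y)| <= c * s `^ (- a) * P (s, y)) ->
  (kernA t x F <= (c * (Ca * t `^ (1 - a)) * P (t, x))%:E)%E.
Proof.
move=> mF c0 /andP[t0 tT] HF; rewrite kernAE//.
have mpw : measurable_fun [set: measurableTypeR R] (fun s : measurableTypeR R => (s `^ (- a))%:E).
  by apply/measurable_EFinP; exact: measurable_powR.
apply: (@le_trans _ _ (\int[leb]_(s in `]0%R, t[) ((c * P (t, x))%:E * (s `^ (- a))%:E))%E).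
  apply: ge0_le_integral => //.
  - by move=> s _; exact: aheat_ge0.
  - apply: measurable_funTS.
    pose G (w : measurableTypeR R * Rn R N) : \bar R :=
      (heat_kernel (t - w.1) x w.2 * `|F w|)%:E.
    apply: (@measurable_fun_fubini_tonelli_F _ _ _ _ _ mu G).
      apply/measurable_EFinP; apply: measurable_funM; last exact: measurableT_comp.
      by apply: measurable_heat_kernel => //; exact: measurable_funB.
    by move=> w; rewrite lee_fin mulr_ge0 ?heat_kernel_ge0.
  - by apply: measurable_funTS; exact: measurable_funeM.
  move=> s /=; rewrite in_itv/= => /andP[s0 st].
  have ts : 0 < t - s by rewrite subr_gt0.
  have sT : 0 < s <= T by rewrite s0/= (le_trans (ltW st)).
  have mFs : measurable_fun [set: Rn R N] (fun y => F (s, y)) by exact: measurable_fun_pair2 mF.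
  have cs0 : 0 <= c * s `^ (- a) by rewrite mulr_ge0 ?powR_ge0.
  apply: (le_trans (aheat_profile_le x mFs cs0 ts s0 (fun y => HF s y sT))).
  by rewrite subrK -EFinM lee_fin mulrAC.
rewrite ge0_integralZl_EFin ?mulr_ge0 ?hprof_ge0//; last 2 first.
- by move=> s _; rewrite lee_fin powR_ge0.
- exact: measurable_funTS.
apply: (le_trans (lee_wpmul2l _ (HCa t0))); first by rewrite lee_fin mulr_ge0 ?hprof_ge0.
by rewrite -EFinM lee_fin mulrAC.
Qed.

(** The Lipschitz factor of the nonlinearity on the set of functions bounded by 2 h, once [s^(- a)]
    is taken out: there [m = 2 h(s) <= 2 A s^(- b)], so [m^alpha <= (2 A)^alpha s^(- a)]. *)
Definition kappa : R := L * (2 * A) `^ alpha.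

Lemma kappa_ge0 : 0 <= kappa.
Proof. by rewrite mulr_ge0 ?powR_ge0// (le_trans ler01). Qed.

Lemma nonlin_lip s y u v : 0 < s -> `|u (s, y)| <= 2 * P (s, y) -> `|v (s, y)| <= 2 * P (s, y) ->
  `|power_nonlinearity alpha (u (s, y)) - power_nonlinearity alpha (v (s, y))| <=
  kappa * s `^ (- a) * `|u (s, y) - v (s, y)|.
Proof.
move=> s0 hu hv; apply: (le_trans (HL hu hv)).
rewrite ler_wpM2r// /kappa -mulrA ler_wpM2l ?(le_trans ler01)//.
have -> : s `^ (- a) = (s `^ (- b)) `^ alpha by rewrite -powRrM aE mulNr mulrC.
rewrite -powRM ?mulr_ge0 ?powR_ge0// ge0_ler_powR ?nnegrE ?(ltW alpha0)//.
- by rewrite mulr_ge0 ?hprof_ge0.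
- by rewrite !mulr_ge0 ?powR_ge0.
by rewrite -mulrA ler_wpM2l// hprof_le.
Qed.

(** The value 1/2 serves twice: [2 kappa Ca T^(1 - a) <= 1] keeps the Duhamel term below h, so that
    the bound 2 h is reproduced, and 1/2 is the contraction factor. *)
Hypothesis small : kappa * (Ca * T `^ (1 - a)) <= 1 / 2.

Lemma smallt t : 0 < t <= T -> kappa * (Ca * t `^ (1 - a)) <= 1 / 2.
Proof.
move=> /andP[t0 tT]; apply: le_trans small; rewrite ler_wpM2l ?kappa_ge0//.
rewrite ler_wpM2l ?(ltW Ca0)// ge0_ler_powR ?nnegrE ?subr_ge0 ?(ltW a1) ?(ltW t0) ?(ltW T0)//.
Qed.

Definition picard (u : Z -> R) (z : Z) : R :=
  if (0 < z.1) && (z.1 <= T) then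
    fine (heat z.1 f z.2) + fine (kernD z.1 z.2 (power_nonlinearity alpha \o u))
  else 0.

Lemma measurable_picard u : measurable_fun [set: Z] u -> measurable_fun [set: Z] (picard u).
Proof.
move=> mu'; apply: measurable_fun_ifT.
- apply: measurable_and.
    by apply: measurable_fun_ltr; [exact: measurable_cst|exact: measurable_fst].
  by apply: measurable_fun_ler; [exact: measurable_fst|exact: measurable_cst].
- apply: measurable_funD.
    apply: (measurableT_comp (f := fine)); first exact: fine_measurable.
    exact: measurable_heat.
  apply: (measurableT_comp (f := fine)); first exact: fine_measurable.
  by apply: measurable_kernD; exact: measurable_power_nonlinearity.
- exact: measurable_cst.
Qed.

(* [2 e^(t Delta)|f|] is a supersolution. *)
Definition bounded2 u := forall t x, 0 < t <= T -> `|u (t, x)| <= 2 * P (t, x).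

Lemma nonlin_bound u s y : bounded2 u -> 0 < s <= T ->
  `|power_nonlinearity alpha (u (s, y))| <= 2 * kappa * s `^ (- a) * P (s, y).
Proof.
move=> hu /[dup] sT /andP[s0 _].
have h0 : `|(fun=> 0 : R) (s, y)| <= 2 * P (s, y) by rewrite normr0 mulr_ge0 ?hprof_ge0.
have := nonlin_lip (u := u) (v := fun=> 0) s0 (hu _ y sT) h0.
rewrite power_nonlinearity0 !subr0 => h; apply: (le_trans h).
rewrite [leRHS](_ : _ = kappa * s `^ (- a) * (2 * P (s, y))); last by ring.
by rewrite ler_wpM2l ?hu// mulr_ge0 ?powR_ge0 ?kappa_ge0.
Qed.

Lemma kernA_nonlin u t x : measurable_fun [set: Z] u -> bounded2 u -> 0 < t <= T ->
  (kernA t x (power_nonlinearity alpha \o u) <= (P (t, x))%:E)%E.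
Proof.
move=> mu' hu tT.
have k20 : 0 <= 2 * kappa by rewrite mulr_ge0 ?kappa_ge0.
have := kernA_le x (measurable_power_nonlinearity alpha mu') k20 tT
  (fun s y => @nonlin_bound u s y hu).
move=> h; apply: (le_trans h); rewrite lee_fin ler_piMl ?hprof_ge0//.
by have := smallt tT; lra.
Qed.

Lemma kernA_nonlin_lt u t x : measurable_fun [set: Z] u -> bounded2 u -> 0 < t <= T ->
  (kernA t x (power_nonlinearity alpha \o u) < +oo)%E.
Proof. by move=> mu' hu tT; apply: le_lt_trans (kernA_nonlin x mu' hu tT) _; rewrite ltry. Qed.

Lemma bounded2_picard u : measurable_fun [set: Z] u -> bounded2 u -> bounded2 (picard u).
Proof.
move=> mu' hu t x tT; rewrite /picard/= tT.
have t0 : 0 < t by case/andP: tT.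
apply: (le_trans (ler_normD _ _)); rewrite mulr_natl mulr2n lerD ?fine_heat_le//.
rewrite -lee_fin -abse_EFin fineK; last first.
  by apply: kernD_fin; [exact: measurable_power_nonlinearity|exact: kernA_nonlin_lt].
apply: le_trans (kernA_nonlin x mu' hu tT).
by apply: abse_kernD_le; exact: measurable_power_nonlinearity.
Qed.

Lemma picard_lip u v (c : R) t x : measurable_fun [set: Z] u -> measurable_fun [set: Z] v ->
  bounded2 u -> bounded2 v -> 0 <= c ->
  (forall s y, 0 < s <= T -> `|u (s, y) - v (s, y)| <= c * P (s, y)) ->
  0 < t <= T -> `|picard u (t, x) - picard v (t, x)| <= c / 2 * P (t, x).
Proof.
move=> mu' mv hu hv c0 huv tT; rewrite /picard/= tT.
rewrite opprD addrACA subrr add0r -lee_fin.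
have mpu := measurable_power_nonlinearity alpha mu'.
have mpv := measurable_power_nonlinearity alpha mv.
apply: (le_trans (kernD_sub_le mpu mpv (kernA_nonlin_lt x mu' hu tT) (kernA_nonlin_lt x mv hv tT))).
have k0 : 0 <= kappa * c by rewrite mulr_ge0 ?kappa_ge0.
have h s y : 0 < s <= T -> `|(power_nonlinearity alpha \o u) (s, y) -
     (power_nonlinearity alpha \o v) (s, y)| <= kappa * c * s `^ (- a) * P (s, y).
  move=> /[dup] sT /andP[s0 _]; apply: (le_trans (nonlin_lip s0 (hu _ _ sT) (hv _ _ sT))).
  rewrite [leRHS](_ : _ = kappa * s `^ (- a) * (c * P (s, y))); last by ring.
  by rewrite ler_wpM2l ?huv// mulr_ge0 ?powR_ge0 ?kappa_ge0.
apply: (le_trans (kernA_le x (measurable_funB mpu mpv) k0 tT h)).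
rewrite lee_fin ler_wpM2r ?hprof_ge0//.
rewrite [leLHS](_ : _ = c * (kappa * (Ca * t `^ (1 - a)))); last by ring.
rewrite ler_wpM2l//; have := smallt tT; lra.
Qed.

(** The iteration is run at each point of space-time, with increments at most [2^-n] h, which avoids
    setting up a complete space of functions dominated by h. Measurability survives as that of a
    pointwise limit, and the contraction estimate passes to the limit because the distance to it is
    again a multiple of h. *)
Lemma picard_fixpoint : exists u, [/\ measurable_fun [set: Z] u, bounded2 u &
  forall t x, 0 < t <= T -> u (t, x) = picard u (t, x)].
Proof.
pose un n := iter n picard (fun=> 0).
have mun n : measurable_fun [set: Z] (un n).
  by elim: n => [|n IH] /=; [exact: measurable_cst|exact: measurable_picard].
have bun n : bounded2 (un n).
  elim: n => [|n IH]; last by apply: bounded2_picard => //; exact: mun.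
  by move=> t x _; rewrite normr0 mulr_ge0 ?hprof_ge0.
have dun n t x : 0 < t <= T -> `|un n.+1 (t, x) - un n (t, x)| <= 2 ^- n * P (t, x).
  elim: n t x => [|n IH] t x tT.
    rewrite expr0 invr1 mul1r subr0 /un/= /picard/= tT.
    have -> : power_nonlinearity alpha \o (fun=> 0) = (fun=> 0) :> (Z -> R).
      by apply/funext => z; exact: power_nonlinearity0.
    rewrite [kernD _ _ _](_ : _ = 0%E) ?addr0.
      by apply: fine_heat_le; case/andP: tT.
    by apply: integral0_eq => z _; rewrite mulr0.
  have c0 : 0 <= 2 ^- n :> R by rewrite invr_ge0 exprn_ge0.
  have := picard_lip x (mun n.+1) (mun n) (bun n.+1) (bun n) c0 IH tT.
  by rewrite (_ : 2 ^- n.+1 = 2 ^- n / 2)// exprSr invfM mulrC.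
have out n t x : (0 < t <= T) = false -> un n (t, x) = 0.
  by case: n => // n h; rewrite /un/= /picard/= h.
(* The profile cut off to (0, T]: all iterates vanish elsewhere, so the geometric bound holds at
   every point and the limit exists everywhere. *)
pose B (z : Z) := if (0 < z.1) && (z.1 <= T) then P z else 0.
have dunB z n : `|un n.+1 z - un n z| <= 2 ^- n * B z.
  case: z => t x; rewrite /B/=; case: ifPn => [tT|/negbTE tT]; first exact: dun.
  by have := out n.+1 t x tT; have := out n t x tT => /= -> ->; rewrite subrr normr0 mulr0.
have ex z := geometric_limit (dunB z).
pose u z := sval (cid (ex z)).
have hu z n : `|un n z - u z| <= 2 * (2 ^- n * B z) by exact: (svalP (cid (ex z))).
have B0 z : 0 <= B z by rewrite /B; case: ifP => // _; exact: hprof_ge0.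
have e0 c : 0 < c -> forall M : R, 0 <= M -> exists n, 2 ^- n * M <= c.
  move=> c0 M M0; exists (Num.bound (M / c)).
  have h1 : M / c < (Num.bound (M / c))%:R by rewrite archi_boundP// divr_ge0// ltW.
  rewrite mulrC ler_pdivrMr ?exprn_gt0// mulrC -ler_pdivrMr//.
  by rewrite (le_trans (ltW h1))// -natrX ler_nat ltnW// ltn_expl.
have mu' : measurable_fun [set: Z] u.
  apply: (measurable_fun_cvg mun) => z _; apply/cvgrPdist_le => e ep.
  have [n hn] := e0 _ ep (2 * B z) (mulr_ge0 (ler0n _ 2) (B0 z)).
  exists n => // m /= nm; rewrite distrC (le_trans (hu z m))//.
  rewrite mulrCA (le_trans _ hn)// ler_wpM2r ?mulr_ge0// lef_pV2 ?posrE ?exprn_gt0//.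
  by rewrite ler_weXn2l// ler1n.
have bu : bounded2 u.
  move=> t x tT; apply/ler_addgt0Pr => e ep.
  have [n hn] := e0 _ ep (2 * B (t, x)) (mulr_ge0 (ler0n _ 2) (B0 (t, x))).
  rewrite -(subrK (un n (t, x)) (u (t, x))) (le_trans (ler_normD _ _))// addrC lerD ?bun//.
  by rewrite distrC (le_trans (hu _ n))// mulrCA.
exists u; split=> // t x tT; apply/eqP; rewrite -subr_eq0 -normr_le0; apply/ler_addgt0Pr => e ep; rewrite add0r.
have BP s y : 0 < s <= T -> B (s, y) = P (s, y) by move=> sT; rewrite /B/= sT.
have [n hn] := e0 _ ep (2 * P (t, x)) (mulr_ge0 (ler0n _ 2) (hprof_ge0 _)).
have h1 := hu (t, x) n.+1; rewrite BP// in h1.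
have c0 : 0 <= 2 * 2 ^- n :> R by rewrite mulr_ge0 ?invr_ge0 ?exprn_ge0.
have hun s y : 0 < s <= T -> `|un n (s, y) - u (s, y)| <= 2 * 2 ^- n * P (s, y).
  by move=> sT; rewrite -mulrA -BP//; exact: hu.
have := picard_lip x (mun n) mu' (bun n) bu c0 hun tT => h2.
rewrite -(subrK (un n.+1 (t, x)) (u (t, x))) -addrA.
apply: (le_trans (ler_normD _ _)); apply: le_trans hn.
rewrite distrC [leRHS](_ : _ = 2 * (2 ^- n.+1 * P (t, x)) + 2 * 2 ^- n / 2 * P (t, x)).
  exact: lerD.
by rewrite exprSr invfM; field; rewrite expf_neq0.
Qed.

End fixed_point.

(** * Continuity in time *)

Section time_continuity.
Context {R : realType} {N : nat}.
Local Notation leb := (@lebesgue_measure R).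
Local Notation mu := (@lebesgue_Rn R N).
Local Notation Z := (measurableTypeR R * Rn R N)%type.
Implicit Types (s t : R) (x y : Rn R N).

Variables (a b A Ca T : R) (f : Rn R N -> R).
Hypotheses (a0 : 0 < a) (a1 : a < 1) (Ca0 : 0 < Ca) (T0 : 0 < T).
Hypothesis mf : measurable_fun [set: Rn R N] f.
Hypothesis fA : forall t x, 0 < t -> (aheat t f x <= (A * t `^ (- b))%:E)%E.
Hypothesis HCa : forall t, 0 < t ->
  (\int[leb]_(s in `]0%R, t[) (s `^ (- a))%:E <= (Ca * t `^ (1 - a))%:E)%E.

Local Notation P := (hprof f).

Lemma hprof_mono s t x : 0 < s -> s <= t -> P (s, x) <= (t / s) `^ (N%:R / 2) * P (t, x).
Proof.
move=> s0 st; rewrite -lee_fin EFinM -!(aheatE fA)//; last exact: lt_le_trans st.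
exact: aheat_le.
Qed.

(** All profiles at times between [tau] and [t] are thereby measured against the single function
    [P (t, x)], with a constant that is uniform in [x]. *)
Lemma hprof_mono_unif tau s t x : 0 < tau -> tau <= s -> s <= t ->
  P (s, x) <= (t / tau) `^ (N%:R / 2) * P (t, x).
Proof.
move=> tau0 ts st; have s0 : 0 < s by exact: lt_le_trans ts.
have t0 : 0 < t by exact: lt_le_trans st.
apply: (le_trans (hprof_mono x s0 st)); rewrite ler_wpM2r ?hprof_ge0//.
rewrite ge0_ler_powR ?nnegrE ?divr_ge0 ?(ltW t0) ?(ltW s0) ?(ltW tau0)//.
by rewrite ler_wpM2l ?(ltW t0)// lef_pV2.
Qed.

Lemma heat_time_diff : exists C : R, 0 < C /\ forall s t x, 0 < s -> s <= t -> t <= 2 * s ->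
  `|fine (heat t f x) - fine (heat s f x)| <= C * ((t - s) / s) * P (2 * t, x).
Proof.
have [C [C0 HC]] := @heat_kernel_diff R N; exists C; split=> // s t x s0 st ts.
have t0 : 0 < t by exact: lt_le_trans st.
have ig r : 0 < r -> mu.-integrable [set: Rn R N] (EFin \o (fun y => heat_kernel r x y * f y)).
  move=> r0; apply/integrableP; split.
    by apply/measurable_EFinP; apply: measurable_funM => //; exact: measurable_heat_kernel2.
  apply: (@le_lt_trans _ _ (aheat r f x)); last by rewrite (aheatE fA)// ltry.
  rewrite le_eqVlt; apply/orP; left; apply/eqP.
  by apply: eq_integral => y _; rewrite /= normrM (ger0_norm (heat_kernel_ge0 _ _ _)).
rewrite -lee_fin -abse_EFin EFinB !fineK ?(heat_fin mf fA)//.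
rewrite /heat -integralB_EFin//; try exact: ig.
apply: (le_trans (le_abse_integral _ _ _)) => //.
  apply/measurable_EFinP; apply: measurable_funB; apply: measurable_funM => //;
  exact: measurable_heat_kernel2.
rewrite EFinM -(aheatE fA) ?mulr_gt0//.
have Cr : 0 <= C * ((t - s) / s).
  by rewrite mulr_ge0 ?divr_ge0 ?subr_ge0 ?(ltW C0) ?(ltW s0).
apply: le_trans (aheat_diff_le mf Cr (s := s) (x := x) (fun y => HC s t x y s0 st ts)).
rewrite le_eqVlt; apply/orP; left; apply/eqP.
by apply: eq_integral => y _; rewrite /= -mulrBl normrM.
Qed.

(* The time integral is cut at distance [sqrt (t - s)] from [s]. *)
Lemma kern_time_diff (c tau : R) : 0 <= c -> 0 < tau -> exists C : R, 0 < C /\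
  forall F : Z -> R, measurable_fun [set: Z] F ->
  (forall s y, 0 < s <= T -> `|F (s, y)| <= c * s `^ (- a) * P (s, y)) ->
  forall s t x, tau <= s -> s < t -> t <= T ->
  Num.sqrt (t - s) <= 1 -> Num.sqrt (t - s) <= tau / 2 ->
  (\int[product_measure1 leb mu]_z (`|kern t x z - kern s x z| * `|F z|)%:E <=
    (C * Num.sqrt (t - s) * P (2 * T, x))%:E)%E.
Proof.
move=> c0 tau0; have [C3 [C30 HC3]] := @heat_kernel_diff R N.
(* [M] compares every profile at a time in [tau, 2T] with the one at [2 * T]. [B1] and [B2] are the
   coefficients before and after the cut. *)
pose M : R := (2 * T / tau) `^ (N%:R / 2).
have M0 : 0 < M by rewrite powR_gt0// divr_gt0// mulr_gt0.
pose B1 : R := C3 * c * M; pose B2 : R := 2 * c * (tau / 2) `^ (- a) * M.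
have B10 : 0 <= B1 by rewrite !mulr_ge0// ltW.
have B20 : 0 <= B2 by rewrite !mulr_ge0 ?powR_ge0// ltW.
exists (B1 * (Ca * T `^ (1 - a)) + 2 * B2 + 1); split.
  have h1 : 0 <= B1 * (Ca * T `^ (1 - a)) by rewrite !mulr_ge0 ?powR_ge0// ltW.
  by rewrite ltr_pwDr// addr_ge0// mulr_ge0.
move=> F mF HF s t x taus st tT eta1 etatau.
set eta := Num.sqrt (t - s) in eta1 etatau *; set H := P (2 * T, x).
have H0 : 0 <= H by exact: hprof_ge0.
have s0 : 0 < s by exact: lt_le_trans taus.
have t0 : 0 < t by exact: lt_trans st.
have d0 : 0 < t - s by rewrite subr_gt0.
have eta0 : 0 < eta by rewrite sqrtr_gt0.
have eta2 : t - s = eta * eta by rewrite -expr2 sqr_sqrtr// ltW.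
have deta : t - s <= eta by rewrite eta2 ler_piMl// ltW.
have HP r : tau <= r -> r <= 2 * T -> P (r, x) <= M * H by move=> h1 h2; exact: hprof_mono_unif.
have mk r : measurable_fun [set: Z] (kern r x) by exact: measurable_kern.
have mdiff : measurable_fun [set: Z] (fun z => (`|kern t x z - kern s x z| * `|F z|)%:E).
  apply/measurable_EFinP; apply: measurable_funM; last exact: measurableT_comp.
  by apply: measurableT_comp => //; exact: measurable_funB.
rewrite fubini_tonelli1//.
set I := fubini_F _ _.
have I0 sg : (0 <= I sg)%E by apply: integral_ge0 => y _; rewrite lee_fin mulr_ge0.
have mI : measurable_fun [set: measurableTypeR R] I.
  exact: measurable_fun_fubini_tonelli_F.
have mFs sg : measurable_fun [set: Rn R N] (fun y => F (sg, y)) by exact: measurable_fun_pair2 mF.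
have BHe : 0 <= B1 * H * eta := mulr_ge0 (mulr_ge0 B10 H0) (ltW eta0).
have BH2 : 0 <= B2 * H := mulr_ge0 B20 H0.
have key sg : (I sg <= (B1 * H * eta)%:E * ((sg `^ (- a))%:E * (\1_(`]0%R, t[%classic) sg)%:E) +
     (B2 * H)%:E * (\1_(`](s - eta), t[%classic) sg)%:E)%E.
  have R1 : (0 <= (B1 * H * eta)%:E * ((sg `^ (- a))%:E * (\1_(`]0%R, t[%classic) sg)%:E))%E.
    apply: mule_ge0; first by rewrite lee_fin.
    by apply: mule_ge0; rewrite lee_fin ?powR_ge0.
  have R2 : (0 <= (B2 * H)%:E * (\1_(`](s - eta), t[%classic) sg)%:E)%E.
    by apply: mule_ge0; rewrite lee_fin.
  have [/andP[sg0 sgt]|nsg] := boolP ((0 < sg) && (sg < t)); last first.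
    rewrite [I sg]integral0_eq ?adde_ge0// => y _.
    rewrite /kern/= (negbTE nsg) ifF ?subr0 ?normr0 ?mul0r//.
    apply/negbTE; apply: contra nsg => /andP[-> h]/=; exact: lt_trans h st.
  have sgT : 0 < sg <= T by rewrite sg0/= (le_trans (ltW sgt)).
  have tsg : 0 < t - sg by rewrite subr_gt0.
  have csg : 0 <= c * sg `^ (- a) by rewrite mulr_ge0 ?powR_ge0.
  have HFs y : `|F (sg, y)| <= c * sg `^ (- a) * P (sg, y) by exact: HF.
  (* Before the cut, [t - s = eta^2] and [s - sg >= eta]: the kernel comparison applies because
     [t - s <= s - sg], and its factor [(t - s) / (s - sg)] is at most [eta]. *)
  have [sgs|sgs] := leP sg (s - eta).
    rewrite -[leLHS]adde0; apply: leeD => //.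
    have ssg : eta <= s - sg by lra.
    have ssg0 : 0 < s - sg by exact: lt_le_trans ssg.
    have hd y : `|heat_kernel (t - sg) x y - heat_kernel (s - sg) x y| <=
        C3 * eta * heat_kernel (2 * (t - sg)) x y.
      apply: (le_trans (HC3 (s - sg) (t - sg) x y ssg0 _ _)); [lra|lra|].
      rewrite ler_wpM2r ?heat_kernel_ge0// ler_wpM2l ?(ltW C30)//.
      rewrite (_ : t - sg - (s - sg) = eta * eta); last by rewrite -eta2; ring.
      by rewrite ler_pdivrMr// ler_wpM2l// ltW.
    have C3e : 0 <= C3 * eta by rewrite mulr_ge0 ?ltW.
    have E1 : (I sg <= (C3 * eta)%:E * aheat (2 * (t - sg)) (fun y => F (sg, y)) x)%E.
      have := aheat_diff_le (mFs sg) C3e hd.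
      apply: le_trans; rewrite le_eqVlt; apply/orP; left; apply/eqP.
      apply: eq_integral => y _; rewrite /kern/= sg0 sgt/=.
      by rewrite -subr_gt0 ssg0.
    apply: (le_trans E1).
    have t2 : 0 < 2 * (t - sg) by rewrite mulr_gt0.
    apply: (le_trans (lee_wpmul2l _ (aheat_profile_le mf fA x (mFs sg) csg t2 sg0 HFs))).
      by rewrite lee_fin.
    have -> : \1_(`]0%R, t[%classic) sg = 1 :> R.
      by rewrite indicE mem_set//= in_itv/= sg0.
    rewrite mule1 -!EFinM lee_fin.
    apply: (@le_trans _ _ (C3 * eta * (c * sg `^ (- a) * (M * H)))).
      rewrite ler_wpM2l// ler_wpM2l//; apply: HP; lra.
    by rewrite le_eqVlt /B1; apply/orP; left; apply/eqP; ring.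
  (* After the cut no cancellation is used: the two kernels are bounded separately. Since
     [sg >= tau / 2], the power of [sg] is bounded, and smallness comes from the length of the
     interval, at most [2 * eta]. *)
  rewrite -[leLHS]add0e; apply: leeD => //.
  have -> : \1_(`](s - eta), t[%classic) sg = 1 :> R.
    by rewrite indicE mem_set//= in_itv/= sgs.
  rewrite mule1.
  have hsg : sg `^ (- a) <= (tau / 2) `^ (- a).
    have tau20 : 0 < tau / 2 by rewrite divr_gt0.
    rewrite !powRN lef_pV2 ?posrE ?powR_gt0// ge0_ler_powR ?nnegrE ?(ltW a0) ?(ltW tau20) ?(ltW sg0)//.
    lra.
  have E1 : (I sg <= \int[mu]_y ((kern t x (sg, y) * `|F (sg, y)|)%:E + (kern s x (sg, y) * `|F (sg, y)|)%:E))%E.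
    apply: ge0_le_integral => //.
    - exact: measurable_fun_pair2 mdiff.
    - by apply: emeasurable_funD; apply/measurable_EFinP; apply: measurable_funM;
        try exact: measurableT_comp; exact: measurable_fun_pair2 (mk _).
    move=> y _; rewrite -EFinD lee_fin -mulrDl ler_wpM2r//.
    by rewrite (le_trans (ler_normB _ _))// !ger0_norm ?kern_ge0.
  apply: (le_trans E1); rewrite ge0_integralD//; last 4 first.
  - by move=> y _; rewrite lee_fin mulr_ge0 ?kern_ge0.
  - by apply/measurable_EFinP; apply: measurable_funM;
      [exact: measurable_fun_pair2 (mk _)|exact: measurableT_comp].
  - by move=> y _; rewrite lee_fin mulr_ge0 ?kern_ge0.
  - by apply/measurable_EFinP; apply: measurable_funM;
      [exact: measurable_fun_pair2 (mk _)|exact: measurableT_comp].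
  have part r : s <= r -> r <= t ->
      (\int[mu]_y (kern r x (sg, y) * `|F (sg, y)|)%:E <= (B2 / 2 * H)%:E)%E.
    move=> sr rt; have [sgr|sgr] := ltP sg r; last first.
      rewrite integral0_eq; first by rewrite lee_fin mulr_ge0// divr_ge0.
      by move=> y _; rewrite /kern/= (ltNge sg) sgr andbF mul0r.
    have rsg : 0 < r - sg by rewrite subr_gt0.
    rewrite [leLHS](_ : _ = aheat (r - sg) (fun y => F (sg, y)) x); last first.
      by apply: eq_integral => y _; rewrite /kern/= sg0 sgr.
    apply: (le_trans (aheat_profile_le mf fA x (mFs sg) csg rsg sg0 HFs)).
    rewrite subrK lee_fin.
    apply: (@le_trans _ _ (c * (tau / 2) `^ (- a) * (M * H))).
      apply: ler_pM => //; first exact: hprof_ge0.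
        by rewrite ler_wpM2l.
      by apply: HP; lra.
    by rewrite le_eqVlt /B2; apply/orP; left; apply/eqP; field.
  apply: (le_trans (leeD (part t (ltW st) (lexx _)) (part s (lexx _) (ltW st)))).
  by rewrite -EFinD lee_fin le_eqVlt; apply/orP; left; apply/eqP; field.
have m1 : measurable_fun [set: measurableTypeR R]
    (fun sg : measurableTypeR R => ((sg `^ (- a))%:E * (\1_(`]0%R, t[%classic : set (measurableTypeR R)) sg)%:E)%E).
  apply/measurable_EFinP; apply: measurable_funM; first exact: measurable_powR.
  by apply: measurable_indic; exact: measurable_itv.
have m2 : measurable_fun [set: measurableTypeR R]
    (fun sg : measurableTypeR R => ((\1_(`](s - eta), t[%classic : set (measurableTypeR R)) sg)%:E : \bar R)).
  by apply/measurable_EFinP; apply: measurable_indic; exact: measurable_itv.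
apply: (@le_trans _ _ (\int[leb]_sg ((B1 * H * eta)%:E * ((sg `^ (- a))%:E * (\1_(`]0%R, t[%classic) sg)%:E) +
     (B2 * H)%:E * (\1_(`](s - eta), t[%classic) sg)%:E))%E).
  apply: ge0_le_integral => //.
  by apply: emeasurable_funD; exact: measurable_funeM.
have p1 sg : (0 <= (sg `^ (- a))%:E * (\1_(`]0%R, t[%classic) sg)%:E)%E.
  by apply: mule_ge0; rewrite lee_fin ?powR_ge0.
have p2 sg : (0 <= (\1_(`](s - eta), t[%classic) sg)%:E :> \bar R)%E.
  by rewrite lee_fin.
rewrite ge0_integralD//; last 4 first.
- by move=> sg _; rewrite mule_ge0.
- exact: measurable_funeM.
- by move=> sg _; rewrite mule_ge0.
- exact: measurable_funeM.
rewrite !ge0_integralZl_EFin//.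
have E1 : (\int[leb]_sg ((sg `^ (- a))%:E * (\1_(`]0%R, t[%classic) sg)%:E) <= (Ca * T `^ (1 - a))%:E)%E.
  rewrite [leLHS](_ : _ = \int[leb]_(sg in `]0%R, t[) (sg `^ (- a))%:E)%E; last first.
    rewrite [RHS]integral_mkcond; apply: eq_integral => sg _.
    by rewrite patchE indicE; case: ifP => _; rewrite ?mule1 ?mule0.
  apply: (le_trans (HCa t0)); rewrite lee_fin ler_wpM2l ?(ltW Ca0)//.
  by rewrite ge0_ler_powR ?nnegrE ?subr_ge0 ?(ltW a1) ?(ltW t0) ?(ltW T0).
have E2 : (\int[leb]_sg (\1_(`](s - eta), t[%classic) sg)%:E <= (2 * eta)%:E)%E.
  rewrite integral_indic// setIT [leLHS](lebesgue_measure_itv `](s - eta), t[%R)/= lte_fin.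
  rewrite ifT; last by lra.
  by rewrite -EFinD lee_fin; lra.
apply: (le_trans (leeD (lee_wpmul2l _ E1) (lee_wpmul2l _ E2))); rewrite ?lee_fin//.
rewrite [leLHS](_ : _ = (B1 * (Ca * T `^ (1 - a)) + 2 * B2) * eta * H); last by ring.
by rewrite ler_wpM2r// ler_wpM2r ?(ltW eta0)// lerDl.
Qed.

End time_continuity.

(** * Strong continuity of the heat flow at time 0 *)

(** Dominated convergence, as every point eventually leaves the sets [S n]. It serves both to
    approximate countable unions by finite ones and to truncate functions of L^q_gamma. *)
Lemma integral_tail d (T : measurableType d) (R : realType)
    (m : {measure set T -> \bar R}) (g : T -> R) (S : (set T)^nat) :
  measurable_fun [set: T] g -> (forall x, 0 <= g x) ->
  (\int[m]_x (g x)%:E < +oo)%E -> (forall n, measurable (S n)) ->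
  (forall x, exists k, forall n, (k <= n)%N -> ~ S n x) ->
  forall e : R, 0 < e -> exists n, (\int[m]_x (g x * \1_(S n) x)%:E <= e%:E)%E.
Proof.
move=> mg g0 goo mS S0 e e0.
have ig : m.-integrable [set: T] (EFin \o g).
  apply/integrableP; split; first exact/measurable_EFinP.
  by under eq_integral do rewrite /= ger0_norm//.
have mf n : measurable_fun [set: T] (fun x => (g x * \1_(S n) x)%:E).
  by apply/measurable_EFinP; apply: measurable_funM => //; exact: measurable_indic.
have cv : {ae m, forall x, [set: T] x ->
    (fun n => (g x * \1_(S n) x)%:E) @ \oo --> (cst 0%E : T -> \bar R) x}.
  apply: aeW => x _; have [k Hk] := S0 x.
  apply: cvg_near_cst; exists k => // n /= kn.
  by rewrite indicE memNset ?mulr0//; exact: Hk.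
have dom : {ae m, forall x n, [set: T] x -> (`|(g x * \1_(S n) x)%:E| <= (EFin \o g) x)%E}.
  apply: aeW => x n _; rewrite /= lee_fin normrM (ger0_norm (g0 x)) ger0_norm//.
  by rewrite ler_piMr// indicE lern1 leq_b1.
have [_ _] := dominated_convergence measurableT mf (measurable_cst _) cv ig dom.
rewrite integral0 => /fine_cvgP[[k1 _ fin] /cvgrPdist_le/(_ _ e0)[k2 _ Hk]].
exists (maxn k1 k2).
have := Hk (maxn k1 k2) (leq_maxr _ _); rewrite /= sub0r normrN => h.
have /= f1 := fin (maxn k1 k2) (leq_maxl _ _).
by rewrite -(fineK f1) lee_fin (le_trans _ h)// ler_norm.
Qed.

Lemma indic_bool (R : realType) (T : Type) (P : T -> bool) x :
  \1_[set y | P y] x = (P x)%:R :> R.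
Proof. by rewrite indicE; congr (nat_of_bool _)%:R; apply/idP/idP; rewrite inE. Qed.

(** * Mean oscillation under the heat kernel *)

Section oscillation.
Context {R : realType} {N : nat}.
Local Notation mu := (@lebesgue_Rn R N).
Local Notation X := (Rn R N).
Implicit Types (s t : R) (x y z : Rn R N).

Implicit Types (f g : X -> R) (D : X * X -> R).

Let o : X := nseq_tuple N 0.

Variable sg : R.
Hypothesis sg0 : 0 < sg.

(* The joint density of the positions at times 0 and [t] of a Brownian motion
   started from a Gaussian law. *)
Definition pair_density t (w : X * X) : R :=
  heat_kernel sg o w.1 * heat_kernel t w.1 w.2.

Definition pair_mean t (D : X * X -> R) : \bar R :=
  (\int[product_measure1 mu mu]_w (pair_density t w * D w)%:E)%E.

Definition osc (f : X -> R) (w : X * X) : R := `|f w.1 - f w.2|.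

(** For [D = osc f] this says that the expectation of |f(X_0) - f(X_t)| tends to 0 with [t], a form
    of continuity in mean in which the weight of L^q_gamma does not appear. *)
Definition vanishing (D : X * X -> R) := forall e, 0 < e ->
  exists2 d, 0 < d & forall t, 0 < t -> t < d -> (pair_mean t D <= e%:E)%E.

Lemma pair_density_ge0 t w : 0 <= pair_density t w.
Proof. by rewrite mulr_ge0 ?heat_kernel_ge0. Qed.

Lemma measurable_pair_int t D : measurable_fun [set: X * X] D ->
  measurable_fun [set: X * X] (fun w => (pair_density t w * D w)%:E).
Proof.
move=> mD; apply/measurable_EFinP; apply: measurable_funM => //.
by apply: measurable_funM; exact: measurable_heat_kernel.
Qed.

Lemma measurable_osc f : measurable_fun [set: X] f -> measurable_fun [set: X * X] (osc f).
Proof.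
move=> mf; apply: measurableT_comp => //.
by apply: measurable_funB; exact: (measurableT_comp mf).
Qed.

Lemma pair_mean_comb D D1 D2 (a b : R) t : 0 <= a -> 0 <= b ->
  measurable_fun [set: X * X] D -> measurable_fun [set: X * X] D1 ->
  measurable_fun [set: X * X] D2 ->
  (forall w, 0 <= D w) -> (forall w, 0 <= D1 w) -> (forall w, 0 <= D2 w) ->
  (forall w, D w <= a * D1 w + b * D2 w) ->
  (pair_mean t D <= a%:E * pair_mean t D1 + b%:E * pair_mean t D2)%E.
Proof.
move=> a0 b0 mD mD1 mD2 D0 D10 D20 H.
have p0 E w : 0 <= E w -> (0 <= (pair_density t w * E w)%:E)%E.
  by move=> E0; rewrite lee_fin mulr_ge0 ?pair_density_ge0.
rewrite -!ge0_integralZl_EFin//; last 4 first.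
- by move=> w _; exact: p0.
- exact: measurable_pair_int.
- by move=> w _; exact: p0.
- exact: measurable_pair_int.
rewrite -ge0_integralD//; last 4 first.
- by move=> w _; apply: mule_ge0 => //; exact: p0.
- by apply: measurable_funeM; exact: measurable_pair_int.
- by move=> w _; apply: mule_ge0 => //; exact: p0.
- by apply: measurable_funeM; exact: measurable_pair_int.
apply: ge0_le_integral => //.
- by move=> w _; exact: p0.
- exact: measurable_pair_int.
- by apply: emeasurable_funD; apply: measurable_funeM; exact: measurable_pair_int.
move=> w _; rewrite -!EFinM -EFinD lee_fin.
rewrite [leRHS](_ : _ = pair_density t w * (a * D1 w + b * D2 w)); last by ring.
by rewrite ler_wpM2l ?pair_density_ge0.
Qed.

Lemma pair_mean_fst g t : 0 < t -> measurable_fun [set: X] g -> (forall x, 0 <= g x) ->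
  pair_mean t (g \o fst) = (\int[mu]_x (heat_kernel sg o x * g x)%:E)%E.
Proof.
move=> t0 mg g0; rewrite /pair_mean fubini_tonelli1; last 2 first.
- by apply: measurable_pair_int; exact: (measurableT_comp mg).
- by move=> w; rewrite lee_fin mulr_ge0 ?pair_density_ge0 ?g0.
apply: eq_integral => x _; rewrite /fubini_F/=.
rewrite [LHS](_ : _ = \int[mu]_y ((heat_kernel sg o x * g x)%:E * (heat_kernel t x y)%:E))%E; last first.
  by apply: eq_integral => y _; rewrite -EFinM; congr EFin; rewrite /pair_density/=; ring.
rewrite ge0_integralZl_EFin//.
- by rewrite integral_heat_kernel// mule1.
- by move=> y _; rewrite lee_fin heat_kernel_ge0.
- by apply/measurable_EFinP; exact: measurable_heat_kernel2.
- by rewrite mulr_ge0 ?heat_kernel_ge0.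
Qed.

(** By Chapman-Kolmogorov the second marginal is the Gaussian at time [sg + t]. *)
Lemma pair_mean_snd g t : 0 < t -> measurable_fun [set: X] g -> (forall x, 0 <= g x) ->
  pair_mean t (g \o snd) = (\int[mu]_y (heat_kernel (sg + t) o y * g y)%:E)%E.
Proof.
move=> t0 mg g0; rewrite /pair_mean fubini_tonelli2; last 2 first.
- by apply: measurable_pair_int; exact: (measurableT_comp mg).
- by move=> w; rewrite lee_fin mulr_ge0 ?pair_density_ge0 ?g0.
apply: eq_integral => y _; rewrite /fubini_G/=.
rewrite [LHS](_ : _ = \int[mu]_x ((g y)%:E * (heat_kernel sg o x * heat_kernel t x y)%:E))%E; last first.
  by apply: eq_integral => x _; rewrite -EFinM; congr EFin; rewrite /pair_density/=; ring.
rewrite ge0_integralZl_EFin//.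
- by rewrite integral_heat_kernelM// -EFinM mulrC.
- by move=> x _; rewrite lee_fin mulr_ge0 ?heat_kernel_ge0.
- by apply/measurable_EFinP; apply: measurable_funM;
    [exact: measurable_heat_kernel2|exact: measurable_heat_kernel1].
Qed.

(** For [t <= sg] both marginals are dominated by a multiple of one Gaussian, at time [2 * sg]; a
    set that is small for it is small for both points, uniformly in [t]. *)
Lemma pair_mean_sum g t : 0 < t -> t <= sg -> measurable_fun [set: X] g ->
  (forall x, 0 <= g x) ->
  (pair_mean t (fun w => g w.1 + g w.2)%R <=
   (2 * 2 `^ (N%:R / 2))%:E * \int[mu]_x (heat_kernel (2 * sg) o x * g x)%:E)%E.
Proof.
move=> t0 tsg mg g0.
have mh r : measurable_fun [set: X] (fun x => (heat_kernel r o x * g x)%:E).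
  by apply/measurable_EFinP; apply: measurable_funM => //; exact: measurable_heat_kernel2.
have part r : sg <= r -> r <= 2 * sg ->
    (\int[mu]_x (heat_kernel r o x * g x)%:E <=
     (2 `^ (N%:R / 2))%:E * \int[mu]_x (heat_kernel (2 * sg) o x * g x)%:E)%E.
  move=> sr rs; have r0 : 0 < r by exact: lt_le_trans sr.
  rewrite -ge0_integralZl_EFin ?powR_ge0//; last first.
    by move=> x _; rewrite lee_fin mulr_ge0 ?heat_kernel_ge0.
  apply: ge0_le_integral => //.
  - by move=> x _; rewrite lee_fin mulr_ge0 ?heat_kernel_ge0.
  - exact: measurable_funeM.
  move=> x _; rewrite -EFinM lee_fin mulrA ler_wpM2r//.
  apply: (le_trans (heat_kernel_le _ _ r0 rs)); rewrite ler_wpM2r ?heat_kernel_ge0//.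
  rewrite ge0_ler_powR ?nnegrE ?divr_ge0 ?mulr_ge0 ?(ltW sg0) ?(ltW r0)//.
  by rewrite ler_pdivrMr// ler_wpM2l.
apply: (@le_trans _ _ (1%:E * pair_mean t (g \o fst) + 1%:E * pair_mean t (g \o snd))%E).
  apply: pair_mean_comb => //=.
  - by apply: measurable_funD; exact: (measurableT_comp mg).
  - exact: (measurableT_comp mg).
  - exact: (measurableT_comp mg).
  - by move=> w; rewrite addr_ge0.
  - by move=> w; rewrite !mul1r.
rewrite !mul1e pair_mean_fst// pair_mean_snd//.
apply: (le_trans (leeD (part sg _ _) (part (sg + t) _ _))) => //.
- by rewrite ler_pMl// ler1n.
- by rewrite lerDl ltW.
- by rewrite mulr_natl mulr2n lerD2l.
by rewrite [in leRHS]mulr_natl mulr2n EFinD ge0_muleDl ?lee_fin ?powR_ge0.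
Qed.

Lemma vanishing_approx D : measurable_fun [set: X * X] D -> (forall w, 0 <= D w) ->
  (forall e, 0 < e -> exists D1 D2 : X * X -> R, [/\ measurable_fun [set: X * X] D1 /\ measurable_fun [set: X * X] D2,
    (forall w, 0 <= D1 w), (forall w, 0 <= D2 w), (forall w, D w <= D1 w + D2 w) &
    vanishing D1 /\ exists2 d, 0 < d & forall t, 0 < t -> t < d -> (pair_mean t D2 <= e%:E)%E]) ->
  vanishing D.
Proof.
move=> mD D0 H e e0; have e20 : 0 < e / 2 by rewrite divr_gt0.
have [D1 [D2 [[m1 m2] D10 D20 le [/(_ _ e20)[d1 d10 H1] [d2 d20 H2]]]]] := H _ e20.
exists (Num.min d1 d2); first by rewrite lt_min d10.
move=> t t0; rewrite lt_min => /andP[t1 t2].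
apply: (@le_trans _ _ (1%:E * pair_mean t D1 + 1%:E * pair_mean t D2)%E).
  by apply: pair_mean_comb => // w; rewrite !mul1r.
rewrite !mul1e (splitr e) EFinD; exact: leeD (H1 _ t0 t1) (H2 _ t0 t2).
Qed.

Lemma vanishing_comb D D1 D2 (a b : R) : 0 <= a -> 0 <= b ->
  measurable_fun [set: X * X] D -> measurable_fun [set: X * X] D1 ->
  measurable_fun [set: X * X] D2 ->
  (forall w, 0 <= D w) -> (forall w, 0 <= D1 w) -> (forall w, 0 <= D2 w) ->
  (forall w, D w <= a * D1 w + b * D2 w) ->
  vanishing D1 -> vanishing D2 -> vanishing D.
Proof.
move=> a0 b0 mD mD1 mD2 D0 D10 D20 H v1 v2 e e0.
(* Division by [a + 1], as [a] may be 0. *)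
have [d1 d10 H1] := v1 (e / 2 / (a + 1)) ltac:(by rewrite !divr_gt0// ltr_wpDl).
have [d2 d20 H2] := v2 (e / 2 / (b + 1)) ltac:(by rewrite !divr_gt0// ltr_wpDl).
exists (Num.min d1 d2); first by rewrite lt_min d10.
move=> t t0; rewrite lt_min => /andP[t1 t2].
apply: (le_trans (pair_mean_comb t a0 b0 mD mD1 mD2 D0 D10 D20 H)).
have k (c : R) : 0 <= c -> c * (e / 2 / (c + 1)) <= e / 2.
  move=> c0; rewrite mulrA ler_pdivrMr ?ltr_wpDl// mulrC ler_wpM2l ?divr_ge0 ?(ltW e0)//.
  by rewrite lerDl.
rewrite (splitr e) EFinD; apply: leeD.
  apply: (@le_trans _ _ (a%:E * (e / 2 / (a + 1))%:E)%E); first exact/lee_wpmul2l/H1.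
  by rewrite -EFinM lee_fin k.
apply: (@le_trans _ _ (b%:E * (e / 2 / (b + 1))%:E)%E); first exact/lee_wpmul2l/H2.
by rewrite -EFinM lee_fin k.
Qed.

(* These sets form a sigma-algebra that contains the half-spaces [x_i > c], hence
   contain every Borel set. *)
Definition oscless (A : set X) := measurable A /\ vanishing (osc \1_A).

Lemma osc_ge0 f w : 0 <= osc f w. Proof. exact: normr_ge0. Qed.

Lemma measurable_oscless A : measurable A -> measurable_fun [set: X * X] (osc \1_A).
Proof. by move=> mA; apply: measurable_osc; exact: measurable_indic. Qed.

Lemma osclessC A : oscless A -> oscless (~` A).
Proof.
move=> [mA vA]; split; first exact: measurableC.
rewrite (_ : osc _ = osc \1_A)//; apply/funext => w.
rewrite /osc !indicE !in_setC.
by case: (_ \in _); case: (_ \in _) => /=; rewrite ?subrr// ?subr0 ?sub0r// normrN.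
Qed.

Lemma osclessU A B : oscless A -> oscless B -> oscless (A `|` B).
Proof.
move=> [mA vA] [mB vB]; split; first exact: measurableU.
apply: (@vanishing_comb _ (osc \1_A) (osc \1_B) 1 1) => //; try exact: osc_ge0.
- by apply: measurable_oscless; exact: measurableU.
- exact: measurable_oscless.
- exact: measurable_oscless.
move=> w; rewrite /osc !mul1r !indicE !in_setU.
case: (_ \in A); case: (_ \in B); case: (_ \in A); case: (_ \in B) => /=;
  rewrite ?subrr ?subr0 ?sub0r ?normrN ?normr1 ?normr0 ?addr0 ?add0r ?ler01 ?lexx ?lerDl ?ler01 ?ler1n//.
Qed.

Lemma oscless0 : oscless set0.
Proof.
split; first exact: measurable0.
move=> e e0; exists 1 => // t t0 t1; rewrite /pair_mean integral0_eq ?lee_fin ?(ltW e0)// => w _.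
by rewrite /osc !indicE !in_set0 subrr normr0 mulr0.
Qed.

Lemma integral_gauss_indic (S : (set X)^nat) (e : R) : 0 < e -> (forall n, measurable (S n)) ->
  (forall x, exists k, forall n, (k <= n)%N -> ~ S n x) ->
  exists n, (\int[mu]_x (heat_kernel (2 * sg) o x * \1_(S n) x)%:E <= e%:E)%E.
Proof.
move=> e0 mS S0; apply: integral_tail => //; first exact: measurable_heat_kernel2.
- by move=> x; exact: heat_kernel_ge0.
- by rewrite integral_heat_kernel ?ltry// mulr_gt0.
Qed.

(** The indicator of the union differs from that of a finite union [B] only on the remainder [S n].
    The sets [S n] decrease to the empty set, so their Gaussian mass becomes small, uniformly in [t]
    by [pair_mean_sum]. *)
Lemma oscless_bigcup (F : (set X)^nat) : (forall n, oscless (F n)) -> oscless (\bigcup_n F n).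
Proof.
move=> HF; pose A := \bigcup_n F n.
have mA : measurable A by apply: bigcup_measurable => n _; have [] := HF n.
split => //.
have HB n : oscless (\big[setU/set0]_(k < n) F k).
  by elim/big_ind : _ => [|B C|//]; [exact: oscless0|exact: osclessU].
apply: vanishing_approx.
- exact: measurable_oscless.
- exact: osc_ge0.
move=> e e0; pose K : R := 2 * 2 `^ (N%:R / 2).
have K0 : 0 < K by rewrite mulr_gt0// powR_gt0.
have eK : 0 < e / K by rewrite divr_gt0.
pose S n := A `\` \big[setU/set0]_(k < n) F k.
have mS n : measurable (S n) by apply: measurableD => //; have [] := HB n.
have S0 x : exists k, forall n, (k <= n)%N -> ~ S n x.
  have [[k _ Fk]|nA] := pselect (A x); last by exists 0%N => n _ [].
  exists k.+1 => n kn [_]; apply; rewrite -bigcup_mkord; by exists k.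
have [n Hn] := integral_gauss_indic eK mS S0.
pose B := \big[setU/set0]_(k < n) F k.
exists (osc \1_B), (fun w => \1_(S n) w.1 + \1_(S n) w.2); split.
- split; first by apply: measurable_oscless; have [] := HB n.
  by apply: measurable_funD; apply: (measurableT_comp (measurable_indic (mS n))).
- exact: osc_ge0.
- by move=> w; rewrite addr_ge0.
- have BA x : x \in B -> x \in A.
    by rewrite !inE /B -bigcup_mkord => -[k _ Fk]; exists k.
  move=> w; rewrite /osc /S !indicE !in_setD -/A -/B.
  have := BA w.1; have := BA w.2.
  case: (w.1 \in B); case: (w.2 \in B); case: (w.1 \in A); case: (w.2 \in A) => /= h1 h2;
    rewrite ?subrr ?subr0 ?sub0r ?normrN ?normr1 ?normr0 ?addr0 ?add0r ?ler01 ?lexx ?lerDl ?ler01 ?ler1n//;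
    by [have := h1 isT|have := h2 isT].
- split; first by have [] := HB n.
  exists sg => // t t0 tsg.
  apply: (le_trans (pair_mean_sum t0 (ltW tsg) (measurable_indic (mS n)) _)) => //.
  apply: (@le_trans _ _ (K%:E * (e / K)%:E)%E).
    by apply: lee_wpmul2l => //; rewrite lee_fin ltW.
  by rewrite -EFinM lee_fin mulrC divfK ?gt_eqF.
Qed.

(** If the indicators at the two points differ, either the first point is within [eta] of the
    boundary hyperplane, a slab of small Gaussian mass, or the points are more than [eta] apart,
    which is controlled as in Chebyshev's inequality by the second moment of the increment. *)
Lemma oscless_halfspace (i : 'I_N) (c : R) : oscless [set x : X | c < tnth x i].
Proof.
have mt : measurable_fun [set: X] (fun x : X => tnth x i : R) by exact: measurable_tnth.
have mA : measurable [set x : X | c < tnth x i].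
  by have := mt measurableT _ (measurable_itv `]c, +oo[%R); rewrite setTI /preimage/=;
    congr measurable; apply/seteqP; split => x /=; rewrite in_itv/= andbT.
split => //; apply: vanishing_approx; [exact: measurable_oscless|exact: osc_ge0|].
move=> e e0.
pose M := (4 * pi * sg) `^ (- (1 / 2)) : R.
have M0 : 0 < M by rewrite powR_gt0// !mulr_gt0// pi_gt0.
(* [M] bounds the one-dimensional Gaussian density, so the slab of width [2 * eta] has mass at most
   [e]. *)
pose eta := e / (2 * M).
have eta0 : 0 < eta by rewrite divr_gt0// mulr_gt0.
pose I : set (measurableTypeR R) := `[c - eta, c + eta]%classic.
have mI : measurable I by exact: measurable_itv.
pose g x : R := \1_I (tnth x i).
have mg : measurable_fun [set: X] g.
  exact: (measurableT_comp (measurable_indic mI) mt).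
exists (fun w => eta ^- 2 * sqdist w.1 w.2), (g \o fst); split.
- split; last exact: (measurableT_comp mg).
  by apply: measurable_funM => //; exact: measurable_sqdist.
- by move=> w; rewrite mulr_ge0 ?sqdist_ge0// invr_ge0 exprn_ge0// ltW.
- by move=> w; rewrite /g/= indicE.
- move=> w; rewrite /osc/g/= !indic_bool.
  have q0 : 0 <= eta ^- 2 * sqdist w.1 w.2.
    by rewrite mulr_ge0 ?sqdist_ge0// invr_ge0 exprn_ge0// ltW.
  have [wI|wI] := boolP ((tnth w.1 i : R) \in `[(c - eta), (c + eta)]%R).
    apply: (@le_trans _ _ 1); last by rewrite lerDr.
    by case: (_ < _); case: (_ < _); rewrite /= ?subrr ?subr0 ?sub0r ?normrN ?normr1 ?normr0.
  rewrite addr0.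
  have far : eta < `|tnth w.1 i - c|.
    rewrite ltNge; apply: contra wI => h; rewrite in_itv/=.
    by move: h; rewrite ler_norml => /andP[h1 h2]; apply/andP; split; lra.
  have [E|nE] := eqVneq (c < tnth w.1 i) (c < tnth w.2 i).
    by rewrite E subrr normr0.
  apply: (@le_trans _ _ 1).
    by case: (c < _); case: (c < _); rewrite /= ?subrr ?subr0 ?sub0r ?normrN ?normr1 ?normr0.
  rewrite mulrC ler_pdivlMr ?exprn_gt0// mul1r.
  apply: (@le_trans _ _ (((tnth w.1 i : R) - tnth w.2 i) ^+ 2)); last first.
    by rewrite /sqdist (bigD1 i)//= lerDl sumr_ge0// => j _; exact: sqr_ge0.
  rewrite -[leRHS]real_normK ?num_real// lerXn2r ?nnegrE ?(ltW eta0)//.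
  apply: (le_trans (ltW far)).
  case: (ltP c (tnth w.1 i)) nE => h1; case: (ltP c (tnth w.2 i)) => h2 // _.
    rewrite !ger0_norm ?subr_ge0 ?(ltW h1)//; last exact: le_trans h2 (ltW h1).
    by rewrite lerD2l lerN2.
  rewrite !ler0_norm ?subr_le0//; last exact: le_trans h1 (ltW h2).
  by rewrite !opprB lerD2r ltW.
- split.
    (* The squared distance is exchanged for a factor [C * t] and a kernel at time [2 * t], whose
       mass is still 1. *)
    have [C [C0 HC]] := @heat_kernel_moment R N 1 ltr01.
    move=> e' e'0; exists (e' / (eta ^- 2 * C)).
      by rewrite divr_gt0// mulr_gt0// invr_gt0 exprn_gt0.
    move=> t t0 tlt.
    pose k1 : R := eta ^- 2 * C * t.
    have Hk : (pair_mean t (fun w => (eta ^- 2 * sqdist w.1 w.2)%R) <=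
        k1%:E * pair_mean (2 * t)%R ((cst 1%R : X -> R) \o fst))%E.
      rewrite -ge0_integralZl_EFin//; last 3 first.
      - by move=> w _; rewrite lee_fin mulr_ge0 ?pair_density_ge0.
      - by apply: measurable_pair_int; exact: (@measurable_cst _ _ _ _ _ (1 : R)).
      - by rewrite /k1 !mulr_ge0 ?invr_ge0 ?exprn_ge0 ?(ltW eta0) ?(ltW C0) ?(ltW t0).
      apply: ge0_le_integral => //.
      + move=> w _; rewrite lee_fin mulr_ge0 ?pair_density_ge0// mulr_ge0 ?sqdist_ge0//.
        by rewrite invr_ge0 exprn_ge0// ltW.
      + apply: measurable_pair_int; apply: measurable_funM => //.
        exact: measurable_sqdist.
      + by apply: measurable_funeM; apply: measurable_pair_int; exact: (@measurable_cst _ _ _ _ _ (1 : R)).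
      move=> w _; rewrite -EFinM lee_fin /= mulr1 /pair_density.
      have := HC t w.1 w.2 t0; rewrite !powRr1 ?sqdist_ge0 ?(ltW t0)// => h.
      rewrite [leLHS](_ : _ = (eta ^- 2 * heat_kernel sg o w.1) *
        (sqdist w.1 w.2 * heat_kernel t w.1 w.2)); last by ring.
      rewrite [leRHS](_ : _ = (eta ^- 2 * heat_kernel sg o w.1) *
        (C * t * heat_kernel (2 * t) w.1 w.2)); last by rewrite /k1; ring.
      by rewrite ler_wpM2l// mulr_ge0 ?heat_kernel_ge0// ?invr_ge0 ?exprn_ge0// ltW.
    apply: (le_trans Hk); rewrite pair_mean_fst ?mulr_gt0//.
    under eq_integral do rewrite /= mulr1.
    rewrite integral_heat_kernel// mule1 lee_fin /k1.
    by rewrite mulrC -ler_pdivlMr ?mulr_gt0 ?invr_gt0 ?exprn_gt0// ltW.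
  exists 1 => // t t0 t1; rewrite pair_mean_fst//.
  have -> : (\int[mu]_x (heat_kernel sg o x * g x)%:E =
      \int[mu]_x (\prod_(j < N) (gauss1 sg 0 (tnth x j) *
         (if j == i then \1_I (tnth x j) else 1)))%:E)%E.
    apply: eq_integral => x _; congr EFin.
    rewrite big_split/= heat_kernel_prod//; congr (_ * _).
      by apply: eq_bigr => j _; rewrite tnth_nseq.
    by rewrite -big_mkcond/= big_pred1_eq.
  pose ci : R := fine (\int[lebesgue_measure]_x (gauss1 sg 0 x * \1_I x)%:E)%E.
  have mgI : measurable_fun [set: R] (fun x : R => gauss1 sg 0 x * \1_I x).
    by apply: measurable_funM; [exact: measurable_gauss1|exact: measurable_indic].
  have gIle : (\int[lebesgue_measure]_x (gauss1 sg 0 x * \1_I x)%:E <= e%:E)%E.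
    apply: (@le_trans _ _ (\int[lebesgue_measure]_x (M%:E * (\1_I x)%:E))%E).
      apply: ge0_le_integral => //.
      - by move=> x _; rewrite lee_fin mulr_ge0 ?gauss1_ge0.
      - exact/measurable_EFinP.
      - by apply: measurable_funeM; apply/measurable_EFinP; exact: measurable_indic.
      by move=> x _; rewrite -EFinM lee_fin ler_wpM2r// gauss1_ub.
    rewrite ge0_integralZl_EFin ?(ltW M0)//; last first.
      by apply/measurable_EFinP; exact: measurable_indic.
    rewrite integral_indic// setIT.
    rewrite [X in (_ * X)%E](lebesgue_measure_itv `[(c - eta), (c + eta)]%R)/= lte_fin.
    rewrite ifT; last by lra.
    rewrite -EFinD -EFinM lee_fin /eta le_eqVlt; apply/orP; left; apply/eqP.
    by field; rewrite gt_eqF.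
  have gIfin : (\int[lebesgue_measure]_x (gauss1 sg 0 x * \1_I x)%:E = ci%:E)%E.
    rewrite fineK// ge0_fin_numE ?(le_lt_trans gIle) ?ltry//.
    by apply: integral_ge0 => x _; rewrite lee_fin mulr_ge0 ?gauss1_ge0.
  rewrite (integral_Rn_prod
    (f := fun j (w : R) => gauss1 sg 0 w * (if j == i then \1_I w else 1))
    (c := fun j => if j == i then ci else 1)).
  + by rewrite -big_mkcond/= big_pred1_eq -gIfin.
  + move=> j; case: eqP => _ //; under eq_fun do rewrite mulr1.
    exact: measurable_gauss1.
  + by move=> j w; rewrite mulr_ge0 ?gauss1_ge0//; case: ifP.
  + move=> j; case: eqP => _ //; under eq_integral do rewrite mulr1.
    exact: integral_gauss1.
Qed.

Lemma sigma_algebra_oscless : sigma_algebra setT oscless.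
Proof.
split; first exact: oscless0.
- by move=> A /osclessC; rewrite setTD.
- exact: oscless_bigcup.
Qed.

(** The product sigma-algebra is generated by preimages under coordinates, and Borel sets of the
    line by open rays; each of the two generation steps uses that [oscless] sets are closed under
    the operations of a sigma-algebra. *)
Lemma measurable_oscless_set (A : set X) : measurable A -> oscless A.
Proof.
move: A; apply: smallest_sub; first exact: sigma_algebra_oscless.
elim/big_ind : _ => [//|U V HU HV A [/HU//|/HV//]|i _ A].
case=> B mB <-; rewrite setTI.
pose H : set (set R) := [set B | oscless ((fun x : X => tnth x i : R) @^-1` B)].
have sH : sigma_algebra setT H.
  split; first by rewrite /H/= preimage_set0; exact: oscless0.
  - by move=> C HC; rewrite /H/= setTD preimage_setC; exact: osclessC.
  - by move=> F HF; rewrite /H/= preimage_bigcup; exact: oscless_bigcup.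
have : H B.
  move: mB; rewrite RGenOInfty.measurableE; move: B.
  apply: smallest_sub => // C [c ->]; rewrite /H/=.
  rewrite (_ : _ @^-1` _ = [set x : X | c < tnth x i]); first exact: oscless_halfspace.
  by apply/seteqP; split => x /=; rewrite in_itv/= andbT.
exact.
Qed.

Lemma pair_mean_cst (c : R) t : 0 <= c -> 0 < t -> pair_mean t (cst c) = c%:E.
Proof.
move=> c0 t0; rewrite -[cst c]/(cst c \o fst) pair_mean_fst//.
under eq_integral do rewrite mulrC EFinM.
rewrite ge0_integralZl_EFin//.
- by rewrite integral_heat_kernel// mule1.
- by move=> x _; rewrite lee_fin heat_kernel_ge0.
- by apply/measurable_EFinP; exact: measurable_heat_kernel2.
Qed.

(* Halving: [g = M/2 1_{g > M/2} + h] with [0 <= h <= M/2]. *)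
Lemma vanishing_osc (f : X -> R) (M : R) : measurable_fun [set: X] f ->
  (forall x, `|f x| <= M) -> vanishing (osc f).
Proof.
(* For a function with values in [0, M] the oscillation is at most M. Each step removes one
   indicator, of vanishing oscillation, and halves the range. *)
have half n : forall (M : R) g, 0 <= M -> measurable_fun [set: X] g ->
    (forall x, 0 <= g x <= M) -> forall e, 0 < e ->
    exists2 d, 0 < d & forall t, 0 < t -> t < d ->
      (pair_mean t (osc g) <= (M / 2 ^+ n + e)%:E)%E.
  elim: n => [|n IH] {}M g M0 mg gM e e0.
    exists 1 => // t t0 _.
    apply: (@le_trans _ _ (1%:E * pair_mean t (cst M) + 0%:E * pair_mean t (cst M))%E).
      apply: pair_mean_comb => //; first exact: measurable_osc.
      - exact: osc_ge0.
      move=> w; rewrite mul1r mul0r addr0 /osc.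
      have /andP[a1 a2] := gM w.1; have /andP[b1 b2] := gM w.2.
      by rewrite /= ler_norml; apply/andP; split; lra.
    by rewrite mul1e mul0e adde0 pair_mean_cst// expr0 divr1 lee_fin lerDl ltW.
  pose A := [set x : X | M / 2 < g x].
  have mA : measurable A.
    by have := mg measurableT _ (measurable_itv `]M / 2, +oo[%R); rewrite setTI /preimage/=;
      congr measurable; apply/seteqP; split => x /=; rewrite in_itv/= andbT.
  pose h x := g x - M / 2 * \1_A x.
  have mh : measurable_fun [set: X] h.
    by apply: measurable_funB => //; apply: measurable_funM => //; exact: measurable_indic.
  have hM x : 0 <= h x <= M / 2.
    rewrite /h indic_bool; have /andP[a1 a2] := gM x.
    by case: ltP => /= k; rewrite ?mulr1 ?mulr0; lra.
  have M20 : 0 <= M / 2 by rewrite divr_ge0.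
  have e20 : 0 < e / 2 by rewrite divr_gt0.
  have [d1 d10 H1] := IH (M / 2) h M20 mh hM (e / 2) e20.
  have [_ vA] := measurable_oscless_set mA.
  have [d2 d20 H2] := vA (e / 2 / (M / 2 + 1)) ltac:(by rewrite !divr_gt0// ltr_wpDl).
  exists (Num.min d1 d2); first by rewrite lt_min d10.
  move=> t t0; rewrite lt_min => /andP[t1 t2].
  apply: (@le_trans _ _ (1%:E * pair_mean t (osc h) + (M / 2)%:E * pair_mean t (osc \1_A))%E).
    apply: pair_mean_comb => //; try exact: osc_ge0; try exact: measurable_osc.
    move=> w; rewrite mul1r /osc -[X in _ + X * _]ger0_norm// -normrM mulrBr.
    rewrite [X in `|X|](_ : _ = (h w.1 - h w.2) + (M / 2 * \1_A w.1 - M / 2 * \1_A w.2)).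
      exact: ler_normD.
    by rewrite /h; ring.
  rewrite mul1e.
  apply: (@le_trans _ _ ((M / 2 / 2 ^+ n + e / 2)%:E + (M / 2)%:E * (e / 2 / (M / 2 + 1))%:E)%E).
    by apply: leeD; [exact: H1|apply: lee_wpmul2l; [rewrite lee_fin|exact: H2]].
  rewrite -EFinM -EFinD lee_fin.
  have -> : M / 2 ^+ n.+1 = M / 2 / 2 ^+ n by rewrite exprS invfM mulrA.
  rewrite -addrA lerD2l [leRHS]splitr lerD2l mulrA ler_pdivrMr ?ltr_wpDl// mulrC.
  by rewrite ler_wpM2l ?(ltW e20)// lerDl.
move=> mf fM e e0.
have M0 : 0 <= M by exact: le_trans (fM o).
(* A constant shift makes the function nonnegative, with values in [0, 2M], and leaves its
   oscillation unchanged. *)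
pose g x := f x + M.
have mg : measurable_fun [set: X] g by exact: measurable_funD.
have gM x : 0 <= g x <= 2 * M.
  by have := fM x; rewrite ler_norml /g => /andP[h1 h2]; lra.
have e20 : 0 < e / 2 by rewrite divr_gt0.
have [n Hn] : exists n, 2 * M / 2 ^+ n <= e / 2.
  exists (Num.bound ((e / 2)^-1 * (2 * M))).
  rewrite ler_pdivrMr ?exprn_gt0// -ler_pdivrMl//.
  apply: (@le_trans _ _ ((Num.bound ((e / 2)^-1 * (2 * M)))%:R)).
    by rewrite ltW// archi_boundP// mulr_ge0 ?invr_ge0 ?(ltW e20)// mulr_ge0.
  by rewrite -natrX ler_nat ltnW// ltn_expl.
have M20 : 0 <= 2 * M by rewrite mulr_ge0.
have [d d0 H] := half n (2 * M) g M20 mg gM (e / 2) e20.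
exists d => // t t0 td.
have -> : osc f = osc g by apply/funext => w; rewrite /osc /g; congr (`|_|); ring.
by apply: (le_trans (H t t0 td)); rewrite lee_fin [leRHS]splitr lerD2r.
Qed.

End oscillation.

(** * Convergence to the initial value in the weighted norm *)

Section strong_continuity.
Context {R : realType} {N : nat}.
Local Notation mu := (@lebesgue_Rn R N).
Local Notation X := (Rn R N).
Implicit Types (s t : R) (x y : X) (f g : X -> R).

Let o : X := nseq_tuple N 0.

Lemma wnorm_triangle (q : \bar R) (gamma : R) f g : (1 <= q)%E ->
  measurable_fun [set: X] f -> measurable_fun [set: X] g ->
  (wnorm q gamma (EFin \o (f \+ g)%R) <=
   wnorm q gamma (EFin \o f) + wnorm q gamma (EFin \o g))%E.
Proof.
move=> q1 mf mg.
have := eminkowski mu (measurable_weightr gamma mf) (measurable_weightr gamma mg) q1.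
congr (_ <= _)%E; rewrite /wnorm; congr (Lnorm _ _ _); apply/funext => x /=.
by rewrite -EFinM mulrDr.
Qed.

Lemma integrable_heat f t x : measurable_fun [set: X] f -> (aheat t f x < +oo)%E ->
  mu.-integrable [set: X] (fun y => (heat_kernel t x y * f y)%:E).
Proof.
move=> mf fx; apply/integrableP; split.
  by apply/measurable_EFinP; apply: measurable_funM => //; exact: measurable_heat_kernel2.
apply: (le_lt_trans _ fx); rewrite le_eqVlt; apply/orP; left; apply/eqP.
by apply: eq_integral => y _; rewrite /= normrM (ger0_norm (heat_kernel_ge0 _ _ _)).
Qed.

Lemma sqdist0 x : sqdist o x = enorm x ^+ 2.
Proof.
rewrite /enorm sqr_sqrtr ?sumr_ge0//; last by move=> i _; exact: sqr_ge0.
by apply: eq_bigr => i _; rewrite tnth_nseq sub0r sqrrN.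
Qed.

Lemma weight_heat_kernel_le (m r : R) : 0 < m -> 0 < r -> exists C : R, 0 < C /\
  forall x, enorm x `^ m * heat_kernel 2 o x `^ r <= C * heat_kernel (4 / r) o x.
Proof.
move=> m0 r0; pose k : R := r / 16.
have k0 : 0 < k by rewrite divr_gt0.
have m20 : 0 < m / 2 by rewrite divr_gt0.
pose c1 : R := ((4 * pi * 2) `^ (- (N%:R / 2))) `^ r.
pose c2 : R := (4 * pi * (4 / r)) `^ (- (N%:R / 2)).
have c10 : 0 < c1 by rewrite !powR_gt0// !mulr_gt0// pi_gt0.
have c20 : 0 < c2 by rewrite powR_gt0// !mulr_gt0 ?invr_gt0// pi_gt0.
exists (c1 * (k `^ (- (m / 2)) * (m / 2) `^ (m / 2)) / c2); split.
  by rewrite divr_gt0// !mulr_gt0// powR_gt0.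
move=> x; rewrite /heat_kernel sqdist0 -/c2.
rewrite powRM ?powR_ge0 ?expR_ge0// -/c1.
rewrite mulrA -[in leRHS]mulrA -mulrA.
set z := enorm x; have z0 : 0 <= z by exact: enorm_ge0.
rewrite -expRM.
have -> : z `^ m = k `^ (- (m / 2)) * (k * z ^+ 2) `^ (m / 2).
  rewrite powRM ?(ltW k0) ?sqr_ge0// mulrA -powRD; last by rewrite (gt_eqF k0) implybT.
  rewrite addNr powRr0 mul1r -powR_mulrn// -powRrM; congr powR; by field.
have h := powR_expRN_le (mulr_ge0 (ltW k0) (sqr_ge0 z)) m20.
have -> : - (z ^+ 2 / (4 * 2)) * r = - (k * z ^+ 2) + - (z ^+ 2 / (4 * (4 / r))).
  by rewrite /k; field; rewrite gt_eqF.
rewrite expRD.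
set E := expR (- (z ^+ 2 / _)).
rewrite [leRHS](_ : _ = c1 * k `^ (- (m / 2)) * E * (m / 2) `^ (m / 2)); last first.
  by field; rewrite gt_eqF.
rewrite [leLHS](_ : _ = c1 * k `^ (- (m / 2)) * E *
   ((k * z ^+ 2) `^ (m / 2) * expR (- (k * z ^+ 2)))); last by ring.
by rewrite ler_wpM2l// !mulr_ge0 ?powR_ge0 ?expR_ge0// ltW.
Qed.

Variables (p gamma : R).
Hypotheses (p1 : 1 < p) (gamma0 : 0 < gamma).

Let p0 : 0 < p. Proof. exact: lt_trans p1. Qed.

(** [g] is the value of the Gaussian at radius [K], a lower bound for it on the ball that carries
    [f]. A Gaussian majorant is used because the flow maps it to another Gaussian. *)
Lemma bounded_le_heat_kernel f (K : R) : 0 <= K -> (forall y, `|f y| <= K) ->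
  (forall y, K < enorm y -> f y = 0) -> exists c : R, 0 <= c /\
  forall y, `|f y| <= c * heat_kernel 1 o y.
Proof.
move=> K0 fK f0; pose g : R := (4 * pi * 1) `^ (- (N%:R / 2)) * expR (- (K ^+ 2 / (4 * 1))).
have g0 : 0 < g by rewrite mulr_gt0 ?expR_gt0// powR_gt0// !mulr_gt0// pi_gt0.
exists (K / g); split; first by rewrite divr_ge0// ltW.
move=> y; have [Ky|yK] := ltP K (enorm y).
  by rewrite f0// normr0 mulr_ge0 ?heat_kernel_ge0// divr_ge0// ltW.
apply: (le_trans (fK y)); rewrite -mulrA ler_peMr// mulrC ler_pdivlMr// mul1r.
rewrite /g /heat_kernel ler_wpM2l ?powR_ge0// ler_expR lerN2 sqdist0.
by rewrite ler_wpM2r ?invr_ge0// lerXn2r ?nnegrE// enorm_ge0.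
Qed.

(* [|e^(t Delta) f - f|^p] is bounded by its factor [|e^(t Delta) f - f|^(p-1)], whose
   Gaussian decay absorbs the weight, times the mean oscillation of [f]. *)
Lemma heat_strong_cvg_bounded f (K : R) : 0 <= K -> measurable_fun [set: X] f ->
  (forall y, `|f y| <= K) -> (forall y, K < enorm y -> f y = 0) ->
  forall e, 0 < e -> exists2 d, 0 < d & forall t, 0 < t -> t < d ->
    (wnorm p%:E gamma (fun x => (fine (heat t f x) - f x)%:E) <= e%:E)%E.
Proof.
move=> K0 mf fK f0 e e0.
have [c [c0 Hc]] := bounded_le_heat_kernel K0 fK f0.
have r0 : 0 < p - 1 by rewrite subr_gt0.
have m0 : 0 < gamma * p by rewrite mulr_gt0.
have [C [C0 HC]] := weight_heat_kernel_le m0 r0.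
(* [sg] is the time of the Gaussian left when the [(p - 1)]-th power of the decay absorbs the
   weight. Below, [c'] is such that the difference is at most [c'] times the kernel at time 2: for
   [t < 1] both terms have Gaussian majorants at times in [1, 2], hence the factor 2. *)
pose sg := 4 / (p - 1); have sg0 : 0 < sg by rewrite divr_gt0.
pose c' : R := 2 * (c * 2 `^ (N%:R / 2)).
have c'0 : 0 <= c' by rewrite !mulr_ge0 ?powR_ge0.
pose B : R := c' `^ (p - 1) * C.
have B0 : 0 <= B by rewrite mulr_ge0 ?powR_ge0 ?(ltW C0).
have [d d0 Hd] := vanishing_osc sg0 mf fK (ltac:(by rewrite divr_gt0 ?powR_gt0// ltr_wpDl) : 0 < e `^ p / (B + 1)).
exists (Num.min 1 d); first by rewrite lt_min ltr01.
move=> t t0; rewrite lt_min => /andP[t1 td].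
have aub x : (aheat t f x <= (c * heat_kernel (t + 1) x o)%:E)%E.
  rewrite EFinM -integral_heat_kernelM// -ge0_integralZl_EFin//; last 2 first.
  - by move=> y _; rewrite lee_fin mulr_ge0 ?heat_kernel_ge0.
  - by apply/measurable_EFinP; apply: measurable_funM;
      [exact: measurable_heat_kernel2|exact: measurable_heat_kernel1].
  apply: ge0_le_integral => //.
  - by move=> y _; rewrite lee_fin mulr_ge0 ?heat_kernel_ge0.
  - exact: measurable_aheat_int.
  - apply: measurable_funeM; apply/measurable_EFinP; apply: measurable_funM;
      [exact: measurable_heat_kernel2|exact: measurable_heat_kernel1].
  move=> y _; rewrite -EFinM lee_fin mulrCA ler_wpM2l ?heat_kernel_ge0//.
  by rewrite (heat_kernelC _ y); exact: Hc.
have afin x : (aheat t f x < +oo)%E by apply: le_lt_trans (aub x) (ltry _).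
have hfin x : heat t f x \is a fin_num.
  by rewrite fin_num_abs; apply: le_lt_trans (abse_heat_le mf t x) (afin x).
have G2 r x : 1 <= r -> r <= 2 -> heat_kernel r o x <= 2 `^ (N%:R / 2) * heat_kernel 2 o x.
  move=> r1 r2; have r0' : 0 < r by exact: lt_le_trans r1.
  apply: (le_trans (heat_kernel_le _ _ r0' r2)); rewrite ler_wpM2r ?heat_kernel_ge0//.
  rewrite ge0_ler_powR ?nnegrE ?divr_ge0 ?(ltW r0')//.
  by rewrite ler_pdivrMr// ler_peMr.
pose D x : R := fine (heat t f x) - f x.
have mD : measurable_fun [set: X] D.
  apply: measurable_funB => //; apply: (measurableT_comp (f := fine)); first exact: fine_measurable.
  exact: measurable_fun_pair2 (measurable_heat mf).
have Dub x : `|D x| <= c' * heat_kernel 2 o x.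
  apply: (le_trans (ler_normB _ _)).
  rewrite /c' -mulrA mulr_natl mulr2n -mulrA; apply: lerD.
    rewrite -lee_fin -abse_EFin fineK//.
    apply: (le_trans (abse_heat_le mf t x)); apply: (le_trans (aub x)).
    rewrite lee_fin ler_wpM2l// heat_kernelC; apply: G2.
      by rewrite lerDr ltW.
    by rewrite -[leRHS]/(1 + 1) lerD2r ltW.
  by apply: (le_trans (Hc x)); rewrite ler_wpM2l// G2// ler1n.
pose osc_int x : \bar R := (\int[mu]_y (heat_kernel t x y * osc f (x, y))%:E)%E.
have Dosc x : (`|D x|%:E <= osc_int x)%E.
  have mk : measurable_fun [set: X] (fun y => (heat_kernel t x y * f x)%:E).
    by apply/measurable_EFinP; apply: measurable_funM => //; exact: measurable_heat_kernel2.
  have ik : mu.-integrable [set: X] (fun y => (heat_kernel t x y * f x)%:E).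
    apply: (@integrable_heat (cst (f x)) t x) => //.
    rewrite /aheat /cst/=; under eq_integral do rewrite mulrC EFinM.
    rewrite ge0_integralZl_EFin//.
    - by rewrite integral_heat_kernel// mule1 ltry.
    - by move=> y _; rewrite lee_fin heat_kernel_ge0.
    - by apply/measurable_EFinP; exact: measurable_heat_kernel2.
  have fE : ((f x)%:E = \int[mu]_y (heat_kernel t x y * f x)%:E)%E.
    under eq_integral do rewrite mulrC EFinM.
    rewrite integralZl//; first by rewrite integral_heat_kernel// mule1.
    apply/integrableP; split; first by apply/measurable_EFinP; exact: measurable_heat_kernel2.
    under eq_integral do rewrite /= ger0_norm ?heat_kernel_ge0//.
    by rewrite integral_heat_kernel// ltry.
  have -> : `|D x|%:E = (`|heat t f x - (f x)%:E|)%E.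
    by rewrite /D -abse_EFin EFinB fineK.
  rewrite {1}fE /heat -integralB_EFin//; last exact: integrable_heat.
  apply: (le_trans (le_abse_integral _ _ _)) => //.
    apply/measurable_EFinP; apply: measurable_funB; apply/measurable_EFinP => //.
    by apply/measurable_EFinP; apply: measurable_funM => //; exact: measurable_heat_kernel2.
  rewrite le_eqVlt; apply/orP; left; apply/eqP; apply: eq_integral => y _ /=.
  by rewrite -mulrBr normrM ger0_norm ?heat_kernel_ge0// distrC.
have osc_int0 x : (0 <= osc_int x)%E.
  by apply: integral_ge0 => y _; rewrite lee_fin mulr_ge0 ?heat_kernel_ge0 ?osc_ge0.
have mosc : measurable_fun [set: X] osc_int.
  apply: (measurable_fun_fubini_tonelli_F (m2 := mu)
    (fun w : X * X => (heat_kernel t w.1 w.2 * osc f (w.1, w.2))%:E)).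
    apply/measurable_EFinP; apply: measurable_funM; first exact: measurable_heat_kernel.
    rewrite (_ : (fun w : X * X => osc f (w.1, w.2)) = osc f); last by apply/funext => -[].
    exact: measurable_osc.
  by move=> w; rewrite lee_fin mulr_ge0 ?heat_kernel_ge0 ?osc_ge0.
have pt x : (((enorm x `^ gamma * `|D x|) `^ p)%R%:E <=
    B%:E * ((heat_kernel sg o x)%:E * osc_int x))%E.
  apply: (@le_trans _ _ (B * (heat_kernel sg o x * `|D x|))%:E); last first.
    rewrite !EFinM; apply: lee_wpmul2l => //.
    by apply: lee_wpmul2l => //; rewrite lee_fin heat_kernel_ge0.
  rewrite lee_fin powRM ?powR_ge0// -powRrM.
  have -> : `|D x| `^ p = `|D x| `^ (p - 1) * `|D x|.
    have [->|D0] := eqVneq `|D x| 0; first by rewrite powR0 ?gt_eqF// mulr0.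
    by rewrite -[X in _ = _ * X]powRr1// -powRD ?subrK// D0 implybT.
  rewrite mulrA (mulrA B) ler_wpM2r//.
  apply: (@le_trans _ _ (enorm x `^ (gamma * p) * (c' * heat_kernel 2 o x) `^ (p - 1))).
    rewrite ler_wpM2l ?powR_ge0// ge0_ler_powR ?nnegrE ?(ltW r0)//.
    by rewrite mulr_ge0 ?heat_kernel_ge0.
  by rewrite powRM ?heat_kernel_ge0// mulrCA /B -mulrA ler_wpM2l ?powR_ge0.
have e0' := ltW e0; have -> : e%:E = ((e `^ p)%:E `^ p^-1)%E.
  by rewrite poweR_EFin -powRrM mulfV ?gt_eqF// powRr1.
rewrite (_ : (fun x => _) = EFin \o D)// wnorm_EFin.
apply: gt0_ler_poweR; rewrite ?invr_ge0 ?(ltW p0)//.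
- by rewrite in_itv/= leey andbT; apply: integral_ge0 => x _; rewrite lee_fin powR_ge0.
- by rewrite in_itv/= leey andbT lee_fin powR_ge0.
apply: (@le_trans _ _ (\int[mu]_x (B%:E * ((heat_kernel sg o x)%:E * osc_int x)))%E).
  apply: ge0_le_integral => //.
  - by move=> x _; rewrite lee_fin powR_ge0.
  - apply/measurable_EFinP; apply: (measurableT_comp (@measurable_powR R _)).
    by apply: measurable_weightr; exact: measurableT_comp.
  - apply: measurable_funeM; apply: emeasurable_funM => //.
    by apply/measurable_EFinP; exact: measurable_heat_kernel2.
rewrite ge0_integralZl_EFin//; last 2 first.
- by move=> x _; apply: mule_ge0 => //; rewrite lee_fin heat_kernel_ge0.
- apply: emeasurable_funM => //.
  by apply/measurable_EFinP; exact: measurable_heat_kernel2.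
have -> : (\int[mu]_x ((heat_kernel sg o x)%:E * osc_int x) = pair_mean sg t (osc f))%E.
  rewrite /pair_mean fubini_tonelli1; last 2 first.
  - by apply: measurable_pair_int; exact: measurable_osc.
  - by move=> w; rewrite lee_fin mulr_ge0 ?pair_density_ge0 ?osc_ge0.
  apply: eq_integral => x _; rewrite /fubini_F/= /osc_int -ge0_integralZl_EFin ?heat_kernel_ge0//.
  - by apply: eq_integral => y _; rewrite -EFinM /pair_density mulrA.
  - by move=> y _; rewrite lee_fin mulr_ge0 ?heat_kernel_ge0 ?osc_ge0.
  - apply/measurable_EFinP; apply: measurable_funM; first exact: measurable_heat_kernel2.
    exact: measurable_fun_pair2 (measurable_osc mf).
apply: (le_trans (lee_wpmul2l _ (Hd t t0 td))); first by rewrite lee_fin.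
rewrite -EFinM lee_fin mulrA ler_pdivrMr ?ltr_wpDl// mulrC ler_wpM2l ?powR_ge0//.
by rewrite lerDl.
Qed.

Hypotheses (gammaN : gamma < N%:R) (pg : p^-1 + gamma / N%:R < 1).

(** Truncation: [h] is the part of [f] where [|f|] or the norm exceeds [n], and [g = f - h] is
    bounded with bounded support. The flow is bounded in L^q_gamma uniformly in time, so the
    contribution of [h] stays small while that of [g] tends to 0. *)
Lemma heat_strong_cvg f : Lqw p%:E gamma f ->
  forall e, 0 < e -> exists2 d, 0 < d & forall t, 0 < t -> t < d ->
    (wnorm p%:E gamma (fun x => (fine (heat t f x) - f x)%:E) <= e%:E)%E.
Proof.
move=> [mf fK] e e0.
have N0 : (0 < N)%N by rewrite -(ltr_nat R); exact: lt_trans gammaN.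
have [C [C0 HC]] := @aheat_bound R N N0 p%:E gamma p1 gamma0 gammaN
  ltac:(by rewrite recip_fin ?gt_eqF).
(* The part [h] enters once through the flow, with factor [C], and once directly, with factor 1. *)
pose eta := e / 2 / (C + 1).
have eta0 : 0 < eta by rewrite !divr_gt0// ltr_wpDl// ltW.
pose S n := [set x : X | (n%:R < `|f x|) || (n%:R < enorm x)].
have mS n : measurable (S n).
  have m1 : measurable_fun [set: X] (fun x => `|f x|) by exact: measurableT_comp.
  have -> : S n = ~` ([set x | `|f x| <= n%:R] `&` [set x | enorm x <= n%:R]).
    apply/seteqP; split=> x /=.
      by move=> /orP[h|h] [h1 h2]; [move: h1|move: h2]; rewrite leNgt h.
    move=> /not_andP[]/negP; rewrite -ltNge /S/= => ->; by rewrite ?orbT.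
  apply: measurableC; apply: measurableI; apply: measurable_le_set => //.
  exact: measurable_enorm_id.
have S0 x : exists k, forall n, (k <= n)%N -> ~ S n x.
  exists (Num.bound (`|f x| + enorm x)) => n kn /=.
  have h : `|f x| + enorm x < n%:R.
    apply: (@lt_le_trans _ _ (Num.bound (`|f x| + enorm x))%:R); last by rewrite ler_nat.
    by rewrite archi_boundP// addr_ge0// enorm_ge0.
  have := enorm_ge0 x; have := normr_ge0 (f x) => h1 h2.
  by case/orP; lra.
pose wf x := (enorm x `^ gamma * `|f x|) `^ p.
have mwf : measurable_fun [set: X] wf.
  apply: (measurableT_comp (@measurable_powR R _)).
  by apply: measurable_weightr; exact: measurableT_comp.
have wfoo : (\int[mu]_x (wf x)%:E < +oo)%E.
  rewrite ltey; apply/eqP => E; move: fK.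
  by rewrite wnorm_EFin E poweRyr ?invr_eq0 ?gt_eqF.
have [n Hn] := integral_tail mwf (fun x => powR_ge0 _ _) wfoo mS S0 (powR_gt0 p eta0).
have mI : measurable_fun [set: X] (\1_(S n) : X -> R) by exact: measurable_indic.
pose h x := f x * \1_(S n) x.
have mh : measurable_fun [set: X] h by exact: measurable_funM.
have hE : (wnorm p%:E gamma (EFin \o h) <= eta%:E)%E.
  have -> : eta%:E = ((eta `^ p)%:E `^ p^-1)%E.
    by rewrite poweR_EFin -powRrM mulfV ?gt_eqF// powRr1// ltW.
  rewrite wnorm_EFin; apply: gt0_ler_poweR; rewrite ?invr_ge0 ?(ltW p0)//.
  - by rewrite in_itv/= leey andbT; apply: integral_ge0 => x _; rewrite lee_fin powR_ge0.
  - by rewrite in_itv/= leey andbT lee_fin powR_ge0.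
  apply: le_trans Hn; rewrite le_eqVlt; apply/orP; left; apply/eqP.
  apply: eq_integral => x _; rewrite /h /wf indicE.
  by case: (_ \in _); rewrite ?mulr1// mulr0 normr0 mulr0 powR0 ?gt_eqF// mulr0.
pose g x := f x - h x.
have mg : measurable_fun [set: X] g by exact: measurable_funB.
have gE x : g x = if x \in S n then 0 else f x.
  by rewrite /g /h indicE; case: ifP => _; rewrite ?mulr1 ?subrr// mulr0 subr0.
have nS x : x \notin S n -> `|f x| <= n%:R /\ enorm x <= n%:R.
  by move=> /negP xS; rewrite !leNgt; split; apply/negP => k; apply: xS;
    rewrite inE /S/= k ?orbT.
have gK x : `|g x| <= n%:R.
  rewrite gE; case: ifPn => [_|/nS[]//]; by rewrite normr0.
have g0 x : n%:R < enorm x -> g x = 0.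
  by rewrite gE; case: ifPn => [//|/nS[_]]; rewrite leNgt => /negbTE ->.
have e20 : 0 < e / 2 by rewrite divr_gt0.
have [d d0 Hd] := heat_strong_cvg_bounded (ler0n R n) mg gK g0 e20.
exists d => // t t0 td.
have hL : Lqw p%:E gamma h by split => //; apply: le_lt_trans hE (ltry _).
have gL : Lqw p%:E gamma g.
  split => //; apply: le_lt_trans fK; rewrite -[leRHS]mul1e.
  apply: le_wnorm => //; try exact/measurable_EFinP.
  move=> x; rewrite mul1e /= lee_fin gE; case: ifP => _ //; by rewrite normr0.
have afin k x : Lqw p%:E gamma k -> (aheat t k x < +oo)%E.
  by move=> kL; have [/(_ x)kb _] := HC k kL t t0; apply: le_lt_trans kb (ltry _).
have hfin k x : Lqw p%:E gamma k -> heat t k x \is a fin_num.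
  move=> kL; rewrite fin_num_abs.
  by have [mk _] := kL; apply: le_lt_trans (abse_heat_le mk t x) (afin k x kL).
have fL : Lqw p%:E gamma f by [].
have hD x : fine (heat t f x) = fine (heat t g x) + fine (heat t h x).
  apply: EFin_inj; rewrite EFinD !fineK ?hfin// /heat -integralD_EFin//.
  - apply: eq_integral => y _ /=; congr EFin; rewrite /g; ring.
  - exact: (integrable_heat mg (afin _ _ gL)).
  - exact: (integrable_heat mh (afin _ _ hL)).
have mfh k : measurable_fun [set: X] k -> measurable_fun [set: X] (fun x => fine (heat t k x)).
  move=> mk; apply: (measurableT_comp (f := fine)); first exact: fine_measurable.
  exact: measurable_fun_pair2 (measurable_heat mk).
have p1' : (1 <= p%:E)%E by rewrite lee_fin ltW.
pose A x := fine (heat t g x) - g x.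
pose B x := fine (heat t h x).
pose B' x := - h x.
have mA : measurable_fun [set: X] A by apply: measurable_funB => //; exact: mfh.
have mB : measurable_fun [set: X] B by exact: mfh.
have mB' : measurable_fun [set: X] B' by exact: measurable_funN.
rewrite (_ : (fun x => _) = EFin \o (A \+ (B \+ B'))); last first.
  apply/funext => x /=; congr EFin; rewrite hD /A /B /B' /g; ring.
apply: (le_trans (wnorm_triangle _ p1' mA (measurable_funD mB mB'))).
rewrite (splitr e) EFinD; apply: leeD; first exact: Hd.
apply: (le_trans (wnorm_triangle _ p1' mB mB')).
apply: (@le_trans _ _ ((C * eta)%:E + eta%:E)%E).
  apply: leeD.
    have [_ hb] := HC h hL t t0.
    apply: (@le_trans _ _ (wnorm p%:E gamma (aheat t h))).
      rewrite -[leRHS]mul1e; apply: le_wnorm => //; first exact/measurable_EFinP.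
        exact: measurable_aheatx.
      move=> x; rewrite mul1e /= (gee0_abs (aheat_ge0 _ _ _)) /B -abse_EFin fineK ?hfin//.
      exact: abse_heat_le.
    apply: (le_trans hb); rewrite lee_fin ler_wpM2l ?(ltW C0)//.
    rewrite -lee_fin fineK//; have [_ hh] := hL; by rewrite ge0_fin_numE ?wnorm_ge0.
  apply: le_trans hE; rewrite -[leRHS]mul1e; apply: le_wnorm => //; try exact/measurable_EFinP.
  by move=> x; rewrite mul1e /B' /= normrN.
rewrite -EFinD lee_fin -[X in _ + X]mul1r -mulrDl /eta mulrC divfK//.
by rewrite gt_eqF// ltr_wpDl// ltW.
Qed.

End strong_continuity.

(** * Existence time *)

Lemma cvg_within0 (R : realType) (D : set R) (F : R -> \bar R) (t0 : R) :
  (forall t, (0 <= F t)%E) ->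
  (forall e, 0 < e -> exists2 d, 0 < d & forall t, D t -> `|t - t0| < d -> (F t <= e%:E)%E) ->
  F t @[t --> within D (nbhs t0)] --> 0%E.
Proof.
move=> F0 H; apply/fine_cvgP.
have near e : 0 < e -> \forall t \near within D (nbhs t0), (F t <= e%:E)%E.
  move=> e0; have [d d0 Hd] := H e e0; apply/nbhs_ballP; exists d => // t /=.
  by rewrite /ball/= distrC => td Dt; exact: Hd.
split.
  apply: filterS (near 1 ltr01) => t h.
  by rewrite ge0_fin_numE// (le_lt_trans h)// ltry.
apply/cvgrPdist_le => e e0; apply: filterS (near e e0) => t h /=.
have fF : F t \is a fin_num by rewrite ge0_fin_numE// (le_lt_trans h)// ltry.
by rewrite sub0r normrN ger0_norm ?fine_ge0// -lee_fin fineK.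
Qed.

Lemma small_powR (R : realType) (M r : R) : 0 <= M -> 0 < r -> forall e, 0 < e ->
  exists2 d, 0 < d & forall t, 0 < t -> t < d -> M * t `^ r <= e.
Proof.
move=> M0 r0 e e0; have M1 : 0 < M + 1 by rewrite ltr_wpDl.
exists ((e / (M + 1)) `^ r^-1); first exact/powR_gt0/divr_gt0.
move=> t t0 td.
apply: (@le_trans _ _ ((M + 1) * (e / (M + 1)))); last by rewrite mulrC divfK// gt_eqF.
apply: ler_pM; rewrite ?powR_ge0 ?lerDl//.
have -> : e / (M + 1) = ((e / (M + 1)) `^ r^-1) `^ r.
  by rewrite -powRrM mulVf ?gt_eqF// powRr1// divr_ge0 ?ltW.
by rewrite ge0_ler_powR ?nnegrE ?powR_ge0 ?(ltW r0) ?(ltW t0) ?(ltW td).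
Qed.

(** * Membership of the fixed point in the solution class *)

Section local_solution.
Context {R : realType} {N : nat}.
Local Notation leb := (@lebesgue_measure R).
Local Notation mu := (@lebesgue_Rn R N).
Local Notation X := (Rn R N).
Local Notation Z := (measurableTypeR R * Rn R N)%type.
Implicit Types (s t : R) (x y : X).

Variables (alpha gamma a b A L Ca T : R) (q : \bar R) (f : X -> R).
Hypotheses (alpha0 : 0 < alpha) (b0 : 0 < b) (aE : a = alpha * b) (a1 : a < 1).
Hypotheses (A0 : 0 <= A) (L1 : 1 <= L) (Ca0 : 0 < Ca) (T0 : 0 < T).
Hypotheses (q1 : (1 < q)%E) (bE : b = N%:R / 2 * recip q + gamma / 2).
Hypothesis fL : Lqw q gamma f.
Hypothesis fA : forall t x, 0 < t -> (aheat t f x <= (A * t `^ (- b))%:E)%E.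
Hypothesis fW : forall t, 0 < t -> (wnorm q gamma (aheat t f) <= A%:E)%E.
Hypothesis HL : forall m v w : R, `|v| <= m -> `|w| <= m ->
  `|power_nonlinearity alpha v - power_nonlinearity alpha w| <= L * m `^ alpha * `|v - w|.
Hypothesis HCa : forall t, 0 < t ->
  (\int[leb]_(s in `]0%R, t[) (s `^ (- a))%:E <= (Ca * t `^ (1 - a))%:E)%E.
Hypothesis small : kappa alpha A L * (Ca * T `^ (1 - a)) <= 1 / 2.
Hypothesis f_cvg : q != +oo%E -> forall e, 0 < e ->
  exists2 d, 0 < d & forall t, 0 < t -> t < d ->
    (wnorm q gamma (fun x => (fine (heat t f x) - f x)%:E) <= e%:E)%E.

Let mf : measurable_fun [set: X] f. Proof. by case: fL. Qed.
Let q0 : (0 < q)%E. Proof. exact: lt_trans q1. Qed.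
Let a0 : 0 < a. Proof. by rewrite aE mulr_gt0. Qed.
Let a1' : 0 < 1 - a. Proof. by rewrite subr_gt0. Qed.

Local Notation P := (hprof f).
Local Notation kap := (kappa alpha A L).

Let kap0 : 0 <= kap. Proof. exact: kappa_ge0. Qed.

Lemma wnorm_le_profile (g : X -> R) (c : R) t : measurable_fun [set: X] g -> 0 <= c -> 0 < t ->
  (forall x, `|g x| <= c * P (t, x)) -> (wnorm q gamma (EFin \o g) <= (c * A)%:E)%E.
Proof.
move=> mg c0 t0 H; rewrite EFinM.
apply: (@le_trans _ _ (c%:E * wnorm q gamma (aheat t f))%E); last first.
  by apply: lee_wpmul2l; rewrite ?lee_fin// fW.
apply: le_wnorm => //; first exact/measurable_EFinP.
  exact: measurable_aheatx.
by move=> x; rewrite (gee0_abs (aheat_ge0 _ _ _)) (aheatE fA)// -EFinM lee_fin.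
Qed.

Variable v : Z -> R.
Hypotheses (mv : measurable_fun [set: Z] v) (bv : bounded2 T f v).
Hypothesis vE : forall t x, 0 < t <= T -> v (t, x) = picard alpha T f v (t, x).

Local Notation F := (power_nonlinearity alpha \o v).

Let mF : measurable_fun [set: Z] F.
Proof. exact: measurable_power_nonlinearity. Qed.

Let HF s y : 0 < s <= T -> `|F (s, y)| <= 2 * kap * s `^ (- a) * P (s, y).
Proof. exact: (nonlin_bound alpha0 aE A0 L1 fA HL). Qed.

Let k20 : 0 <= 2 * kap. Proof. exact: mulr_ge0. Qed.

Let kA t x : 0 < t <= T -> (kernA t x F < +oo)%E.
Proof. exact: (kernA_nonlin_lt alpha0 aE a1 A0 L1 Ca0 T0 mf fA HL HCa small). Qed.

Let mvt t : measurable_fun [set: X] (fun x => v (t, x)).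
Proof. exact: measurable_fun_pair2 mv. Qed.

Let mkD t : measurable_fun [set: X] (fun x => fine (kernD t x F)).
Proof.
apply: (measurableT_comp (f := fine)); first exact: fine_measurable.
exact: measurable_fun_pair2 (measurable_kernD mF).
Qed.

Let mheat t : measurable_fun [set: X] (fun x => fine (heat t f x)).
Proof.
apply: (measurableT_comp (f := fine)); first exact: fine_measurable.
exact: measurable_fun_pair2 (measurable_heat mf).
Qed.

Let vD t x : 0 < t <= T -> v (t, x) = fine (heat t f x) + fine (kernD t x F).
Proof. by move=> tT; rewrite vE// /picard/= tT. Qed.

Lemma duhamel_le t x : 0 < t <= T ->
  `|fine (kernD t x F)| <= 2 * kap * (Ca * t `^ (1 - a)) * P (t, x).
Proof.
move=> tT; rewrite -lee_fin -abse_EFin fineK; last exact: kernD_fin (kA x tT).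
apply: (le_trans (abse_kernD_le mF t x)).
exact: (kernA_le mf fA HCa x mF k20 tT HF).
Qed.

(** The fixed point is prescribed only on (0, T]; the initial value is inserted at time 0. *)
Definition sol t x := if 0 < t <= T then v (t, x) else f x.

Lemma solE t : 0 < t <= T -> sol t = fun x => v (t, x).
Proof. by move=> tT; apply/funext => x; rewrite /sol tT. Qed.

Lemma sol0 : sol 0 = f.
Proof. by apply/funext => x; rewrite /sol ltxx. Qed.

Lemma time_domainP t : time_domain q T t -> 0 < t <= T \/ (q != +oo%E /\ t = 0).
Proof.
rewrite /time_domain; case: ifPn => qoo /=; rewrite in_itv/=; first by left.
by rewrite le_eqVlt => /andP[/orP[/eqP <-|-> ->]]; [right|left].
Qed.

Lemma wnorm_sol_le t : 0 < t <= T -> (wnorm q gamma (EFin \o sol t) <= (2 * A)%:E)%E.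
Proof.
move=> tT; rewrite solE//; case/andP: (tT) => t0 _.
by apply: (wnorm_le_profile (t := t)) => // x; exact: bv.
Qed.

Lemma sol_Lqw t : time_domain q T t -> Lqw q gamma (sol t).
Proof.
move=> /time_domainP[tT|[_ ->]]; last by rewrite sol0.
split; first by rewrite solE.
by apply: le_lt_trans (wnorm_sol_le tT) _; rewrite ltry.
Qed.

(** The modulus of continuity is relative to one fixed profile, at time [2 * T], so that
    [wnorm_le_profile] turns it into continuity in L^q_gamma. *)
Lemma sol_time_diff tau : 0 < tau -> exists C : R, 0 < C /\ forall s t x,
  tau <= s -> s < t -> t <= T -> Num.sqrt (t - s) <= 1 -> Num.sqrt (t - s) <= tau / 2 ->
  `|v (t, x) - v (s, x)| <= C * Num.sqrt (t - s) * P (2 * T, x).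
Proof.
move=> tau0.
have [C1 [C10 H1]] := heat_time_diff mf fA.
have [C2 [C20 H2]] := kern_time_diff a0 a1 Ca0 T0 mf fA HCa k20 tau0.
pose M : R := (2 * T / (2 * tau)) `^ (N%:R / 2).
have M0 : 0 <= M by exact: powR_ge0.
exists (C1 / tau * M + C2); split.
  by rewrite ltr_wpDl// mulr_ge0// divr_ge0// ltW.
move=> s t x ts st tT e1 e2; set eta := Num.sqrt (t - s) in e1 e2 *.
have s0 : 0 < s by exact: lt_le_trans ts.
have t0 : 0 < t by exact: lt_trans st.
have sT' : 0 < s <= T by rewrite s0 (le_trans (ltW st)).
have tT' : 0 < t <= T by rewrite t0.
have eta0 : 0 <= eta by exact: sqrtr_ge0.
have tse : t - s = eta ^+ 2 by rewrite sqr_sqrtr// subr_ge0 ltW.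
have tseta : t - s <= eta by rewrite tse expr2 ler_piMl.
rewrite !vD// opprD addrACA; apply: (le_trans (ler_normD _ _)).
rewrite mulrDl [leRHS]mulrDl; apply: lerD.
  have t2s : t <= 2 * s by lra.
  apply: (le_trans (H1 s t x s0 (ltW st) t2s)).
  have h2 : P (2 * t, x) <= M * P (2 * T, x).
    by apply: (hprof_mono_unif mf fA); rewrite ?mulr_gt0// ler_wpM2l// (le_trans ts)// ltW.
  have h3 : (t - s) / s <= eta / tau.
    apply: ler_pM; rewrite ?invr_ge0 ?subr_ge0 ?(ltW st) ?(ltW s0)//.
    by rewrite lef_pV2.
  rewrite [leRHS](_ : _ = C1 * (eta / tau) * (M * P (2 * T, x))); last by field; rewrite gt_eqF.
  apply: ler_pM => //; last by rewrite ler_wpM2l ?(ltW C10).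
    by rewrite mulr_ge0 ?(ltW C10)// divr_ge0 ?subr_ge0 ?(ltW st) ?(ltW s0).
  exact: hprof_ge0.
rewrite -lee_fin; apply: le_trans (H2 F mF _ s t x ts st tT e1 e2); last first.
  by move=> r y rT; exact: HF.
have ik r : 0 < r <= T -> (product_measure1 leb mu).-integrable [set: Z]
    (fun z => (kern r x z * F z)%:E).
  by move=> rT; exact: (integrable_kern mF (kA x rT)).
have -> : `|fine (kernD t x F) - fine (kernD s x F)|%:E = `|kernD t x F - kernD s x F|%E.
  by rewrite -abse_EFin EFinB !fineK//; apply: kernD_fin => //; exact: kA.
rewrite /kernD -integralB_EFin//; [|exact: ik|exact: ik].
apply: (le_trans (le_abse_integral _ _ _)) => //.
  apply/measurable_EFinP; apply: measurable_funB; apply: measurable_funM => //; exact: measurable_kern.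
rewrite le_eqVlt; apply/orP; left; apply/eqP.
by apply: eq_integral => z _ /=; rewrite -mulrBl normrM.
Qed.

Lemma sol_continuous_gt0 t0 : 0 < t0 <= T -> forall e, 0 < e -> exists2 d, 0 < d &
  forall t, time_domain q T t -> `|t - t0| < d ->
    (wnorm q gamma (fun x => (sol t x - sol t0 x)%:E) <= e%:E)%E.
Proof.
move=> t0T e e0; have /andP[t00 t0T'] := t0T.
pose tau := t0 / 2; have tau0 : 0 < tau by rewrite divr_gt0.
have [C [C0 HC]] := sol_time_diff tau0.
(* The three terms are the two side conditions of [sol_time_diff] and the final accuracy. The square
   root in the modulus leads to the radius [eta^2], and [tau = t0 / 2] keeps nearby times above
   [tau]. *)
pose eta := Num.min 1 (Num.min (tau / 2) (e / (C * A + 1))).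
have CA1 : 0 < C * A + 1 by rewrite ltr_wpDl// mulr_ge0// ltW.
have eta0 : 0 < eta by rewrite /eta !lt_min ltr01 !divr_gt0.
exists (Num.min tau (eta ^+ 2)); first by rewrite lt_min tau0 exprn_gt0.
move=> t tD; rewrite lt_min => /andP[d1 d2].
have tT : 0 < t <= T.
  case: (time_domainP tD) => // -[_ tz].
  by move: d1; rewrite tz sub0r normrN gtr0_norm// /tau; lra.
have /andP[tgt0 tT'] := tT.
have tau_t : tau <= t by move: d1; rewrite ltr_norml => /andP[h _]; rewrite /tau in h *; lra.
have tau_t0 : tau <= t0 by rewrite /tau; lra.
pose r := Num.sqrt `|t - t0|.
have r0 : 0 <= r by exact: sqrtr_ge0.
have re : r <= eta.
  by rewrite -[leRHS]gtr0_norm// -sqrtr_sqr ler_wsqrtr// ltW.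
have r1 : r <= 1 by rewrite (le_trans re)// /eta ge_min lexx.
have r2 : r <= tau / 2 by rewrite (le_trans re)// /eta !ge_min lexx orbT.
have r3 : r <= e / (C * A + 1) by rewrite (le_trans re)// /eta !ge_min lexx !orbT.
have diff x : `|v (t, x) - v (t0, x)| <= C * r * P (2 * T, x).
  have [tt0|t0t|->] := ltgtP t t0.
  - have rE : r = Num.sqrt (t0 - t) by rewrite /r distrC gtr0_norm ?subr_gt0.
    by rewrite distrC rE; apply: HC => //; rewrite -rE.
  - have rE : r = Num.sqrt (t - t0) by rewrite /r gtr0_norm ?subr_gt0.
    by rewrite rE; apply: HC => //; rewrite -rE.
  - by rewrite subrr normr0 mulr_ge0 ?hprof_ge0// mulr_ge0// ltW.
rewrite !solE//.
apply: (@le_trans _ _ (C * r * A)%:E).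
  apply: (wnorm_le_profile (t := 2 * T)) => //.
  - exact: measurable_funB.
  - by rewrite mulr_ge0// ltW.
  - by rewrite mulr_gt0.
rewrite lee_fin mulrAC.
apply: (@le_trans _ _ ((C * A + 1) * (e / (C * A + 1)))).
  apply: ler_pM => //; first by rewrite mulr_ge0// ltW.
  by rewrite lerDl.
by rewrite mulrC divfK// gt_eqF.
Qed.

(** The factor [t^(1 - a)] in the domination by h tends to 0. This gives the initial condition for
    [q = +oo] directly, and for finite [q] it reduces continuity at time 0 to that of the heat
    flow. *)
Lemma wnorm_duhamel_small e : 0 < e -> exists2 d, 0 < d & forall t, 0 < t <= T -> t < d ->
  (wnorm q gamma (fun x => (fine (kernD t x F))%:E) <= e%:E)%E.
Proof.
move=> e0; pose M := 2 * kap * Ca * A.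
have M0 : 0 <= M by rewrite mulr_ge0// mulr_ge0// ltW.
have [d d0 Hd] := small_powR M0 a1' e0; exists d => // t tT td.
have /andP[t0 _] := tT.
apply: (@le_trans _ _ (2 * kap * (Ca * t `^ (1 - a)) * A)%:E).
  apply: (wnorm_le_profile (t := t)) => //.
    by rewrite mulr_ge0// mulr_ge0 ?powR_ge0// ltW.
  by move=> x; exact: duhamel_le.
by rewrite lee_fin [leLHS](_ : _ = M * t `^ (1 - a)) ?Hd// /M; ring.
Qed.

Lemma sol_continuous0 : q != +oo%E -> forall e, 0 < e -> exists2 d, 0 < d &
  forall t, time_domain q T t -> `|t - 0| < d ->
    (wnorm q gamma (fun x => (sol t x - sol 0 x)%:E) <= e%:E)%E.
Proof.
move=> qoo e e0; have e20 : 0 < e / 2 by rewrite divr_gt0.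
have [d1 d10 H1] := f_cvg qoo e20.
have [d2 d20 H2] := wnorm_duhamel_small e20.
exists (Num.min d1 d2); first by rewrite lt_min d10.
move=> t tD; rewrite subr0 sol0 => td.
case: (time_domainP tD) => [tT|[_ ->]]; last first.
  rewrite sol0; apply: (@le_trans _ _ (0 * A)%:E); last by rewrite mul0r lee_fin ltW.
  apply: (wnorm_le_profile (t := 1)) => //; first exact: measurable_funB.
  by move=> x; rewrite subrr normr0 mul0r.
have /andP[t0 _] := tT; rewrite gtr0_norm// lt_min in td; case/andP: td => td1 td2.
have m1 : measurable_fun [set: X] (fun x => fine (heat t f x) - f x) by exact: measurable_funB.
rewrite (_ : (fun x => _) = EFin \o ((fun x => fine (heat t f x) - f x) \+
    (fun x => fine (kernD t x F)))); last first.
  by apply/funext => x /=; rewrite /sol tT vD// addrAC.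
apply: (le_trans (wnorm_triangle _ (ltW q1) m1 (mkD t))).
by rewrite (splitr e) EFinD; apply: leeD; [exact: H1|exact: H2].
Qed.

Lemma sol_initial : if q == +oo%E then
    wnorm q gamma (fun x => (sol t x)%:E - heat t f x)%E @[t --> 0^'+] --> 0%E
  else {ae mu, forall x, sol 0 x = f x}.
Proof.
case: ifPn => [_|_]; last by apply: aeW => x; rewrite sol0.
apply: cvg_within0 => [t|e e0]; first exact: wnorm_ge0.
have [d d0 Hd] := wnorm_duhamel_small e0.
exists (Num.min d T); first by rewrite lt_min d0.
move=> t /= t0; rewrite subr0 gtr0_norm// lt_min => /andP[td tT].
have tT' : 0 < t <= T by rewrite t0 ltW.
rewrite (_ : (fun x => _) = fun x => (fine (kernD t x F))%:E); first exact: Hd.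
apply/funext => x; rewrite /sol tT' vD// EFinD fineK ?(heat_fin mf fA)//.
by rewrite addeAC subee ?add0e// (heat_fin mf fA).
Qed.

Lemma sol_equation t x : 0 < t <= T ->
  ((sol t x)%:E = heat t f x + duhamel alpha sol t x)%E.
Proof.
move=> tT; have /andP[t0 tT'] := tT.
have -> : duhamel alpha sol t x = kernD t x F.
  rewrite (kernDE mF (kA x tT)); apply: eq_integral => s.
  rewrite inE/= in_itv/= => /andP[s0 st].
  by rewrite solE// s0 (le_trans (ltW st)).
rewrite /sol tT vD// EFinD.
by rewrite (fineK (heat_fin mf fA x t0)) (fineK (kernD_fin mF (kA x tT))).
Qed.

(** The interpolated bound carries the power [alpha / (alpha + 1)] of [t^(- b)], so in [sol_bounded]
    the factor [t^beta] cancels the time dependence exactly. *)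
Lemma beta_expE : @beta_exp R N alpha gamma q = b * (alpha / (alpha + 1)).
Proof.
have a10 : alpha + 1 != 0 by rewrite gt_eqF// addr_gt0.
have rE : recip (r_exp alpha q) = recip q / (alpha + 1) :> R.
  case: (q) q1 => [p|_|//].
    rewrite lte_fin => p1; have p0 : p != 0 by rewrite gt_eqF// (lt_trans _ p1).
    by rewrite /r_exp -EFinM !recip_fin ?mulf_neq0// invfM mulrC.
  by rewrite /r_exp gt0_muley ?lte_fin ?addr_gt0// recipy mul0r.
by rewrite /beta_exp rE bE /nu_exp; field.
Qed.

Lemma sol_bounded t : 0 < t <= T ->
  ((t `^ @beta_exp R N alpha gamma q)%:E *
     wnorm (r_exp alpha q) (nu_exp alpha gamma) (EFin \o sol t) <=
   ((2 * A) `^ (alpha / (alpha + 1)) * (2 * A) `^ (alpha + 1)^-1)%:E)%E.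
Proof.
move=> tT; have /andP[t0 _] := tT.
have A20 : 0 <= 2 * A by exact: mulr_ge0.
pose B := 2 * A * t `^ (- b); have B0 : 0 <= B by rewrite mulr_ge0 ?powR_ge0.
have vB x : `|sol t x| <= B.
  rewrite /sol tT; apply: (le_trans (bv _ tT)).
  by rewrite /B -mulrA ler_wpM2l// (hprof_le fA).
have mS : measurable_fun [set: X] (sol t) by rewrite solE.
have h := wnorm_interpolation q1 alpha0 B0 A20 mS vB (wnorm_sol_le tT).
apply: (le_trans (lee_wpmul2l _ h)); first by rewrite lee_fin powR_ge0.
rewrite -EFinM lee_fin /B powRM ?powR_ge0// -powRrM beta_expE.
rewrite mulNr powRN; set w := t `^ _; have w0 : w != 0 by rewrite gt_eqF// powR_gt0.
by rewrite le_eqVlt; apply/orP; left; apply/eqP; field.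
Qed.

Lemma mild_solution_sol : mild_solution alpha gamma q T f sol.
Proof.
split.
- apply: (eq_measurable_fun (fun p => v p)).
    move=> [t x]; rewrite inE/= in_itv/= => -[tT _].
    by rewrite /sol tT.
  exact: measurable_funTS.
- exact: sol_Lqw.
- move=> t0 t0D; apply: cvg_within0 => [t|e e0]; first exact: wnorm_ge0.
  case: (time_domainP t0D) => [t0T|[qoo ->]]; first exact: sol_continuous_gt0.
  exact: sol_continuous0.
- exact: sol_initial.
- by move=> t tT; apply: aeW => x; exact: sol_equation.
- by exists ((2 * A) `^ (alpha / (alpha + 1)) * (2 * A) `^ (alpha + 1)^-1) => t tT; exact: sol_bounded.
Qed.

End local_solution.

(** * The lower bound on the existence time *)

Section existence_time.
Context {R : realType} {N : nat}.
Local Notation X := (Rn R N).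

Variables (alpha gamma : R) (q : \bar R).
Hypotheses (N0 : (0 < N)%N) (alpha0 : 0 < alpha) (gamma0 : 0 < gamma) (gammaN : gamma < N%:R).
Hypotheses (q1 : (1 < q)%E) (qN : recip q + gamma / N%:R < 1).

Let b : R := N%:R / 2 * recip q + gamma / 2.
Let a : R := alpha * b.

Hypothesis a1 : a < 1.

Lemma recip_ge0 : 0 <= recip q.
Proof.
case: (q) q1 => [p|_|//]; last by rewrite recipy.
rewrite lte_fin => p1; have p0 : 0 < p by exact: lt_trans p1.
by rewrite recip_fin ?gt_eqF// invr_ge0 ltW.
Qed.

Let b0 : 0 < b.
Proof. by rewrite ltr_wpDl ?divr_gt0// mulr_ge0 ?recip_ge0. Qed.

(** With [A = C * K] the factor [kappa] becomes [L (2 C)^alpha K^alpha], so the smallness condition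
    depends on the datum only through [K^alpha], and [D = L (2 C)^alpha Ca] is uniform. *)
Lemma local_existence : exists D : R, 0 < D /\ forall (f : X -> R) (K T : R),
  Lqw q gamma f -> (wnorm q gamma (EFin \o f) <= K%:E)%E -> 0 < T ->
  D * K `^ alpha * T `^ (1 - a) <= 1 / 2 ->
  exists u, mild_solution alpha gamma q T f u.
Proof.
have [C [C0 HC]] := aheat_bound N0 q1 gamma0 gammaN qN.
have [L [L1 HL]] := power_nonlinearity_lip alpha0.
have a01 : 0 < a < 1 by rewrite mulr_gt0.
have [Ca [Ca0 HCa]] := integral_time_singular a01.
have L0 : 0 < L by exact: lt_le_trans L1.
exists (L * (2 * C) `^ alpha * Ca); split.
  by rewrite !mulr_gt0// powR_gt0// mulr_gt0.
move=> f K T fL fK T0 small.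
have K0 : 0 <= K by rewrite -lee_fin (le_trans _ fK)// wnorm_ge0.
pose A := C * K; have A0 : 0 <= A by rewrite mulr_ge0// ltW.
have fine_le : fine (wnorm q gamma (EFin \o f)) <= K.
  by rewrite -lee_fin fineK// ge0_fin_numE ?wnorm_ge0//; case: fL.
have fA t x : 0 < t -> (aheat t f x <= (A * t `^ (- b))%:E)%E.
  move=> t0; have [/(_ x) h _] := HC f fL t t0; apply: (le_trans h).
  by rewrite lee_fin /A mulrAC ler_wpM2r ?powR_ge0// ler_wpM2l// ltW.
have fW t : 0 < t -> (wnorm q gamma (aheat t f) <= A%:E)%E.
  move=> t0; have [_ h] := HC f fL t t0; apply: (le_trans h).
  by rewrite lee_fin ler_wpM2l// ltW.
have mf : measurable_fun [set: X] f by case: fL.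
have small' : kappa alpha A L * (Ca * T `^ (1 - a)) <= 1 / 2.
  rewrite [leLHS](_ : _ = L * (2 * C) `^ alpha * Ca * K `^ alpha * T `^ (1 - a))//.
  by rewrite /kappa /A (mulrA 2 C K) powRM ?mulr_ge0 ?(ltW C0)//; ring.
have f_cvg : q != +oo%E -> forall e, 0 < e ->
    exists2 d, 0 < d & forall t, 0 < t -> t < d ->
    (wnorm q gamma (fun x => (fine (heat t f x) - f x)%:E) <= e%:E)%E.
  case: (q) q1 qN fL => [p|//|//]; rewrite lte_fin => p1 pN pL _.
  have p0 : 0 < p by exact: lt_trans p1.
  apply: heat_strong_cvg => //; by rewrite -recip_fin ?gt_eqF.
have [v [mv bv vE]] := picard_fixpoint alpha0 (erefl a) a1 A0 L1 Ca0 T0 mf fA HL HCa small'.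
exists (sol T f v).
exact: (mild_solution_sol alpha0 b0 (erefl a) a1 A0 L1 Ca0 T0 q1 (erefl b) fL fA fW HL HCa small' f_cvg mv bv vE).
Qed.

(** Stating the bound for any majorant [K] of the norm means that the theorem only has to compare
    the norm of [lambda phi] with [lambda] times that of [phi]. The exponent appears because
    [1 / alpha - b = (1 - a) / alpha]. *)
Lemma Tmax_ge : exists C : R, 0 < C /\ forall (f : X -> R) (K : R), Lqw q gamma f ->
  (wnorm q gamma (EFin \o f) <= K%:E)%E ->
  (C%:E / (K%:E `^ (1 / alpha - N%:R / 2 * recip q - gamma / 2)^-1) <= Tmax alpha gamma q f)%E.
Proof.
have [D [D0 HD]] := local_existence.
have a1' : 0 < 1 - a by rewrite subr_gt0.
have thE : (1 / alpha - N%:R / 2 * recip q - gamma / 2)^-1 = alpha / (1 - a).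
  rewrite (_ : 1 / alpha - _ - _ = (1 - a) / alpha) ?invf_div//.
  by rewrite /a /b; field; rewrite gt_eqF.
have th0 : 0 < alpha / (1 - a) by rewrite divr_gt0.
(* Chosen so that [T = C / K^(alpha / (1 - a))] solves [D K^alpha T^(1 - a) = 1/2]. *)
pose C := (1 / (2 * D)) `^ (1 - a)^-1.
have C0 : 0 < C by rewrite powR_gt0// divr_gt0// mulr_gt0.
exists C; split => // f K fL fK.
have K0 : 0 <= K by rewrite -lee_fin (le_trans _ fK)// wnorm_ge0.
have ub T : 0 < T -> D * K `^ alpha * T `^ (1 - a) <= 1 / 2 ->
    (T%:E <= Tmax alpha gamma q f)%E.
  move=> T0 h; apply: ereal_sup_ubound => /=; exists T => //; split => //.
  exact: (HD f K T).
rewrite thE poweR_EFin; have [Kz|Kn0] := eqVneq K 0.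
  (* For [K = 0] the smallness condition reads [0 <= 1/2], so every [T] is admissible and [Tmax] is
     infinite, whatever the quotient by a power of 0 denotes. *)
  rewrite (_ : Tmax _ _ _ _ = +oo%E) ?leey//; apply/eqyP => T T0; apply: ub => //.
  by rewrite Kz powR0 ?gt_eqF// mulr0 mul0r divr_ge0.
have Kp : 0 < K by rewrite lt_def Kn0.
rewrite inver gt_eqF ?powR_gt0// -EFinM; apply: ub.
  by rewrite divr_gt0// powR_gt0.
rewrite le_eqVlt; apply/orP; left; apply/eqP.
rewrite powRM ?invr_ge0 ?powR_ge0//.
rewrite -[(_ `^ (alpha / _))^-1]powRN -!powRrM mulVf ?gt_eqF// powRr1; last first.
  by rewrite divr_ge0// mulr_ge0// ltW.
rewrite mulNr divfK ?gt_eqF// powRN.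
have Ka : K `^ alpha != 0 by rewrite gt_eqF// powR_gt0.
by field; rewrite Ka gt_eqF.
Qed.

End existence_time.

Theorem theorem1p3 (R : realType) (N : nat) (alpha gamma : R) (q : \bar R)
  (hN : (1 <= N)%N)
  (halpha : 0 < alpha)
  (hgamma0 : 0 < gamma) (hgammaN : gamma < N%:R) (hgamma : gamma < 2 / alpha)
  (hq : (1 < q)%E)
  (hqN : recip q + gamma / N%:R < 1)
  (hsub : N%:R * alpha / 2 * recip q + alpha * gamma / 2 < 1) :
  exists C : R, 0 < C /\
    forall (phi : Rn R N -> R), Lqw q gamma phi ->
    forall lambda : R, 0 < lambda ->
      (C%:E / ((lambda%:E * wnorm q gamma (EFin \o phi))
                 `^ (1 / alpha - N%:R / 2 * recip q - gamma / 2)^-1)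
       <= Tmax alpha gamma q (fun x => lambda * phi x)%R)%E.
Proof.
have a1 : alpha * (N%:R / 2 * recip q + gamma / 2) < 1.
  by move: hsub; congr (_ < _); ring.
have [C [C0 HC]] := Tmax_ge hN halpha hgamma0 hgammaN hq hqN a1.
exists C; split => // phi [mphi phiK] lambda l0.
have phifin : wnorm q gamma (EFin \o phi) \is a fin_num.
  by rewrite ge0_fin_numE ?wnorm_ge0.
have ml : measurable_fun [set: Rn R N] (fun x => lambda * phi x) by exact: measurable_funM.
have le : (wnorm q gamma (EFin \o (fun x => lambda * phi x)%R) <=
    lambda%:E * wnorm q gamma (EFin \o phi))%E.
  apply: le_wnorm; rewrite ?(ltW l0) ?(lt_trans _ hq)//; try exact/measurable_EFinP.
  by move=> x; rewrite /= normrM gtr0_norm.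
rewrite -(fineK phifin) -EFinM in le *; apply: HC => //.
by split => //; apply: le_lt_trans le (ltry _).
Qed.
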